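(* Let $n^+,n^-\ge 1$ be integers and consider the piecewise holomorphic system $$\dot z=F^+(z)\ \text{ when } \operatorname{Im}(z)>0,\qquad \dot z=F^-(z)\ \text{ when }\operatorname{Im}(z)<0,$$ with $F^\pm(z)=iz+\epsilon h^\pm(z)$, where $h^\pm$ are complex polynomials with $\deg(h^\pm)=n^\pm$. Then, by using the averaging theory up to order two, for $\epsilon$ small enough, the maximum number of limit cycles that bifurcate from the periodic orbits of the center $\dot z=iz$ is $\left[\frac{3\max\{n^+,n^-\}-1}{2}\right]$; this upper bound is attained and, in this case, all these limit cycles are hyperbolic. As a consequence, $$\mathcal L_{n^+,n^-}\ \ge\ \left[\frac{3\max\{n^+,n^-\}-1}{2}\right].$$
   Context: $[x]$ denotes the integer part of the real number $x$. A piecewise polynomial holomorphic system (PWHS) is a system $\dot z=F^+(z)$ for $\operatorname{Im} z>0$, $\dot z=F^-(z)$ for $\operatorname{Im} z<0$, where $z=x+iy$ and $F^\pm$ are complex polynomials of $z$ with $\deg F^\pm=n^\pm$; orbits on the line $\operatorname{Im} z=0$ are defined by the Filippov convention. A limit cycle is an isolated periodic orbit. $\mathcal L_{n^+,n^-}\in\mathbb N\cup\{\infty\}$ denotes the maximum number of limit cycles that a PWHS with $\deg F^\pm=n^\pm$ can have. Averaging theory up to order two: in polar coordinates $z=re^{i\theta}$ the system becomes $\frac{dr}{d\theta}=\epsilon F_1^{\pm}(\theta,r)+\epsilon^2F_2^{\pm}(\theta,r)+O(\epsilon^3)$, with sign $+$ in the upper half-plane ($0\le\theta\le\pi$) and sign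 $-$ in the lower half-plane ($-\pi\le\theta\le 0$, equivalently $\pi\le\theta\le 2\pi$), $r>0$. Put $$y_1^\pm(t,r)=\int_0^tF_1^\pm(\theta,r)\,d\theta,\qquad y_2^\pm(t,r)=\int_0^t\left[2F_2^\pm(\theta,r)+2\,\partial_rF_1^\pm(\theta,r)\,y_1^\pm(\theta,r)\right]d\theta,$$ $M_j^\pm(r)=\frac1{j!}y_j^\pm(\pm\pi,r)$ and $M_j(r)=M_j^+(r)-M_j^-(r)$ for $j=1,2$. $M_j$ is the averaged function of order $j$. If $M_l$, $l\in\{1,2\}$, is the first not identically zero averaged function, each simple zero $r_0>0$ of $M_l$ provides, for $\epsilon$ small enough, a hyperbolic limit cycle tending to the circle $r=r_0$ as $\epsilon\to0$. ''The maximum number of limit cycles that bifurcate by using the averaging theory up to order two'' is the maximum number of limit cycles obtained in this way, i.e. from the simple positive zeros of the first not identically zero function among $M_1,M_2$, over all choices of $h^\pm$ with $\deg(h^\pm)=n^\pm$. *)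

(* Defs.v *)
From mathcomp Require Import all_boot all_order all_algebra.
From mathcomp Require Import all_classical all_reals all_analysis.
From mathcomp Require Export complex.

Set Implicit Arguments.
Unset Strict Implicit.
Unset Printing Implicit Defensive.

Import Order.TTheory GRing.Theory Num.Theory.
Import numFieldNormedType.Exports.

Local Open Scope classical_set_scope.
Local Open Scope ring_scope.
Local Open Scope complex_scope.

Section PiecewiseHolomorphic.
Variable R : realType.
Implicit Types (F h : {poly R[i]}) (G : set R[i]).

Local Notation mu := (@lebesgue_measure R).
Local Notation normc := (@ComplexField.Normc.normc R).

(** * Filippov dynamics of  z' = Fp(z) (Im z > 0),  z' = Fm(z) (Im z < 0) *)

(** On the line Im z = 0 the admissible velocities are the convex combinations
    of the two fields. This yields crossing where both fields point to the same
    side, and the Filippov sliding field where they point to opposite sides. *)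
Definition filippov_velocity Fp Fm (z : R[i]) : set R[i] :=
  [set v | [/\ 0 < complex.Im z -> v = Fp.[z],
               complex.Im z < 0 -> v = Fm.[z]
             & complex.Im z = 0 -> exists2 l : R, 0 <= l <= 1 &
                 v = l%:C * Fp.[z] + (1 - l)%:C * Fm.[z]]].

(** [z] is absolutely continuous on [0, T] (i.e. the indefinite integral of an
    integrable velocity [v]) and solves the differential inclusion a.e. *)
Definition filippov_solution Fp Fm (T : R) (z : R -> R[i]) : Prop :=
  exists v : R -> R[i],
    [/\ mu.-integrable `[0, T] (EFin \o (fun t => complex.Re (v t))),
        mu.-integrable `[0, T] (EFin \o (fun t => complex.Im (v t))),
        (forall t, 0 <= t <= T -> z t = z 0 +
           ((\int[mu]_(s in `[0, t]) complex.Re (v s)) +i*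
            (\int[mu]_(s in `[0, t]) complex.Im (v s))))
      & {ae mu, forall t, 0 <= t <= T -> filippov_velocity Fp Fm (z t) (v t)}].

(** The system being autonomous, a solution on [0, T] with [z 0 = z T] is the
    same thing as a [T]-periodic solution on the line. *)
Definition periodic_orbit Fp Fm G : Prop :=
  exists T (z : R -> R[i]),
    [/\ 0 < T, filippov_solution Fp Fm T z, z T = z 0,
        (exists2 t, 0 <= t <= T & z t != z 0)
      & G = z @` `[0, T]].

Definition limit_cycle Fp Fm G : Prop :=
  periodic_orbit Fp Fm G /\
  exists2 eta : R, 0 < eta &
    forall G', periodic_orbit Fp Fm G' ->
      (forall z, G' z -> exists2 w, G w & normc (z - w) < eta) -> G' = G.

(** Neighbourhood of [x0] in the line Im z = 0, used as a Poincare section. *)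
Definition section (x0 d : R) : set R[i] := [set x%:C | x in ball x0 d].

Definition first_return Fp Fm (S : set R[i]) (z0 z1 : R[i]) : Prop :=
  exists T (z : R -> R[i]),
    [/\ 0 < T, filippov_solution Fp Fm T z, z 0 = z0, z T = z1
      & S z1 /\ forall t, 0 < t < T -> ~ S (z t)].

(** A limit cycle all of whose intersections with the line are crossing points
    (so that solutions near it are unique), and whose Poincare return map [P]
    on the line has a multiplier of modulus different from 1. *)
Definition hyperbolic_limit_cycle Fp Fm G : Prop :=
  [/\ limit_cycle Fp Fm G,
      (forall x : R, G x%:C ->
         0 < complex.Im Fp.[x%:C] * complex.Im Fm.[x%:C])
    & exists (x0 d0 d : R) (P : R -> R),
        [/\ G x0%:C, 0 < d0 <= d,
            (forall x, ball x0 d0 x ->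
               first_return Fp Fm (section x0 d) x%:C (P x)%:C)
          & [/\ P x0 = x0, derivable P x0 1 & `|P^`()%classic x0| != 1]]].

(** Maximal number of limit cycles, with values in N or +oo, over all systems
    with deg Fp = np and deg Fm = nm. *)
Definition max_limit_cycles (np nm : nat) : \bar R :=
  ereal_sup [set k%:R%:E | k in [set k : nat |
    exists (Fp Fm : {poly R[i]}) (G : 'I_k -> set R[i]),
      [/\ size Fp = np.+1, size Fm = nm.+1, injective G
        & forall i, limit_cycle Fp Fm (G i)]]].

(** * Averaging theory for perturbations of the center z' = i z *)

Definition perturbed h (e : R) : {poly R[i]} := 'i%C *: 'X + e%:C *: h.

Definition cis (t : R) : R[i] := cos t +i* sin t.

(** Writing z = r cis(t), one has z' = (r' + i r t') cis(t). *)
Definition polar_velocity h (e t r : R) : R[i] :=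
  (perturbed h e).[r%:C * cis t] / cis t.

Definition drdtheta h (e t r : R) : R :=
  complex.Re (polar_velocity h e t r) / (complex.Im (polar_velocity h e t r) / r).

(** Taylor coefficients of [drdtheta] at e = 0. *)
Definition F1 h (t r : R) : R := ((fun e => drdtheta h e t r)^`()%classic) 0.
Definition F2 h (t r : R) : R := ((fun e => drdtheta h e t r)^`(2)%classic) 0 / 2.

Definition oriented_integral (f : R -> R) (a b : R) : R :=
  if a <= b then \int[mu]_(x in `[a, b]) f x else - \int[mu]_(x in `[b, a]) f x.

Definition y1 h (t r : R) : R :=
  oriented_integral (fun th => F1 h th r) 0 t.
Definition y2 h (t r : R) : R :=
  oriented_integral
    (fun th => 2 * F2 h th r + 2 * (F1 h th)^`()%classic r * y1 h th r) 0 t.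

Definition M1 hp hm (r : R) : R := y1 hp pi r - y1 hm (- pi) r.
Definition M2 hp hm (r : R) : R := y2 hp pi r / 2 - y2 hm (- pi) r / 2.

Definition vanishes (M : R -> R) : Prop := forall r, 0 < r -> M r = 0.

Definition first_averaged_function hp hm (M : R -> R) : Prop :=
  (M = M1 hp hm /\ ~ vanishes (M1 hp hm)) \/
  [/\ M = M2 hp hm, vanishes (M1 hp hm) & ~ vanishes (M2 hp hm)].

Definition simple_positive_zero (M : R -> R) (r : R) : Prop :=
  [/\ 0 < r, M r = 0, derivable M r 1 & M^`()%classic r != 0].

(** [s] lists distinct simple positive zeros of the first averaged function
    that is not identically zero. *)
Definition averaging_zeros hp hm (s : seq R) : Prop :=
  exists M, [/\ first_averaged_function hp hm M, uniq s
              & forall r, r \in s -> simple_positive_zero M r].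

(** Hausdorff convergence of [G e] to the circle of radius [r] as e -> 0. *)
Definition tends_to_circle (G : R -> set R[i]) (r : R) : Prop :=
  forall eta : R, 0 < eta -> exists2 d : R, 0 < d &
    forall e : R, 0 < `|e| < d ->
      (forall z, G e z -> `|normc z - r| < eta) /\
      (forall t : R, exists2 z, G e z & normc (z - r%:C * cis t) < eta).

(** For e small enough, to each radius in [s] corresponds a hyperbolic limit
    cycle of the perturbed system, distinct radii giving distinct cycles, and
    these cycles bifurcate from the periodic orbits |z| = r of the center. *)
Definition hyperbolic_bifurcation hp hm (s : seq R) : Prop :=
  exists (e0 : R) (G : R -> R -> set R[i]),
    [/\ 0 < e0,
        (forall e r, 0 < `|e| < e0 -> r \in s ->
           hyperbolic_limit_cycle (perturbed hp e) (perturbed hm e) (G r e)),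
        (forall e, 0 < `|e| < e0 -> {in s &, injective (fun r => G r e)})
      & forall r, r \in s -> tends_to_circle (G r) r].

End PiecewiseHolomorphic.

(* Main.v *)
Require Import Defs.
From mathcomp Require Import all_boot all_order all_algebra.
From mathcomp Require Import all_classical all_reals all_analysis.
From mathcomp Require Import measurable_realfun ring lra zify.
From mathcomp Require polyrcf.

(** In the coordinates [z = exp (s + i t)] the system [z' = i z + e h z] has, in an
    annulus, the first integral [V s t] equal to minus the imaginary part of the
    complex time [\int dz / (i z + e h z)]. Its half return map [s -> s'] is thus
    given by [V s' pi = V s 0]; conjugation with time reversal turns the lower
    half-plane into the upper one, with first integral [W], so that a crossing cycle
    is a common solution of [V s' pi = V s 0] and [W s' pi = W s 0]. Expanding both
    maps to second order in [e] gives the averaged functions, and a simple zero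
    yields a transversal common solution. Transversality provides a weight [la] for
    which the distance to the level sets, [|V - V s 0|] above the axis and
    [la |W - W s 0|] below it, is monotone along Filippov solutions: it is
    therefore constant on a periodic orbit, which isolates the cycle.

    Up to a power of [r], the first non-zero averaged function is a polynomial with
    at most [(3 n - 1) / 2 + 1] monomials, which bounds its positive zeros. For the
    converse these monomials are switched on one at a time, by increasing degree,
    with small coefficients of alternating effect. *)

Set Implicit Arguments.
Unset Strict Implicit.
Unset Printing Implicit Defensive.

Import Order.TTheory GRing.Theory Num.Theory.
Import numFieldNormedType.Exports.

Local Open Scope ring_scope.

(** * Real analysis *)

Section RealAnalysis.
Local Open Scope classical_set_scope.
Variable R : realType.
Implicit Types (f g df : R -> R) (x y a b l : R).

(** Holomorphy is what produces the first integral: in the coordinate [w = s + i t] one has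
    [dz / z = dw], and [1 / (i + e k(w))] with [k = h / z] satisfies the Cauchy-Riemann equations,
    so its imaginary part gives a closed form on a strip. For small [e] the slope of [V] in [s] lies
    between [1/2] and [2], so levels are graphs over the angle. Orbits are built from these graphs
    and a clock, and two points of one ray with equal level coincide; this replaces existence and
    uniqueness theorems for differential equations.

    The obstacle is isolation. A competing periodic orbit is any absolutely continuous solution of
    the inclusion, with a velocity known only almost everywhere, so no return map is at hand for it;
    the weighted distance only needs a one-sided comparison at each time. The weight exists as soon
    as the ratios of the slopes of [V] and [W] at the two crossings differ, and the quotient of
    these ratios is the multiplier of the return map: one inequality yields both isolation and
    hyperbolicity. *)

Lemma contP f x : {for x, continuous f} <->
  forall e, 0 < e -> exists2 d, 0 < d & forall y, `|y - x| < d -> `|f y - f x| < e.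
Proof.
split.
  move=> /cvgrPdist_lt H e /H [d /= d0 Hd]; exists d => // y yx.
  by rewrite distrC; apply: Hd; rewrite /= distrC.
move=> H; apply/cvgrPdist_lt => e /H [d d0 Hd]; exists d => //= y yx.
by rewrite distrC; apply: Hd; rewrite distrC.
Qed.

Lemma is_deriveP f x l : is_derive x 1 f l <->
  forall e, 0 < e -> exists2 d, 0 < d &
    forall y, `|y - x| < d -> `|f y - f x - l * (y - x)| <= e * `|y - x|.
Proof.
rewrite is_derive1_caratheodory; split.
  move=> [g [fE /contP gc gx]] e e0; have [d d0 Hd] := gc _ e0.
  exists d => // y yx; rewrite fE -mulrBl normrM -gx ler_wpM2r//.
  exact/ltW/Hd.
move=> H; exists (fun z => if z == x then l else (f z - f x) / (z - x)); split.
- move=> z; case: eqP => [->|/eqP]; first by rewrite !subrr mulr0.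
  by rewrite -subr_eq0 => /divfK->.
- apply/contP => e e0; have e20 : 0 < e / 2 by rewrite divr_gt0.
  have [d d0 Hd] := H _ e20; exists d => // y yx; rewrite eqxx.
  case: eqP => [_|/eqP]; first by rewrite subrr normr0.
  rewrite -subr_eq0 => yx0; rewrite -[l](mulfK yx0) -mulrBl normrM normfV.
  rewrite ltr_pdivrMr ?normr_gt0//; apply: le_lt_trans (Hd _ yx) _.
  by rewrite ltr_pM2r ?normr_gt0// ltr_pdivrMr// ltr_pMr// ltrDl.
- by rewrite eqxx.
Qed.

Lemma derive_eq f x l l' : is_derive x 1 f l -> l = l' -> is_derive x 1 f l'.
Proof. by move=> H <-. Qed.

Lemma derive_near f g x l d : 0 < d -> (forall y, `|y - x| < d -> f y = g y) ->
  is_derive x 1 f l -> is_derive x 1 g l.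
Proof.
move=> d0 fg /is_deriveP H; apply/is_deriveP => e /H [d' d'0 Hd].
exists (Num.min d d'); first by rewrite lt_min d0.
move=> y; rewrite lt_min => /andP[yd yd'].
by rewrite -!fg ?subrr ?normr0//; apply: Hd.
Qed.

Lemma derive_cont f x l : is_derive x 1 f l -> {for x, continuous f}.
Proof. by move=> [/derivable1_diffP /differentiable_continuous]. Qed.

Lemma derive1_val f x l : is_derive x 1 f l -> f^`() x = l.
Proof. by move=> H; rewrite derive1E; exact: derive_val. Qed.

Lemma mvt f df a b : (forall x, Num.min a b <= x <= Num.max a b -> is_derive x 1 f (df x)) ->
  exists2 c, Num.min a b <= c <= Num.max a b & f b - f a = df c * (b - a).
Proof.
wlog ab : a b / a <= b.
  move=> H Hd; case/orP: (le_total a b) => [ab|ba]; first exact: H ab Hd.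
  have [|c cab E] := H b a ba.
    by move=> x; rewrite minC maxC; exact: Hd.
  by exists c; [rewrite minC maxC|rewrite -opprB E -mulrN opprB].
rewrite (min_idPl ab) (max_idPr ab) => Hd.
have [||c cab E] := @MVT_segment R f df a b ab.
- by move=> x; rewrite in_itv/= => /andP[/ltW ? /ltW ?]; apply: Hd; apply/andP.
- apply: continuous_in_subspaceT => x; rewrite inE/= in_itv/= => /Hd.
  exact: derive_cont.
- by exists c => //; move: cab; rewrite in_itv.
Qed.

Lemma within_cont f a b :
  (forall x, a <= x <= b -> {for x, continuous f}) -> {within `[a, b], continuous f}.
Proof.
by move=> H; apply: continuous_in_subspaceT => x; rewrite inE/= in_itv/= => /H.
Qed.

Lemma ivt_incr f a b v : a <= b -> (forall x, a <= x <= b -> {for x, continuous f}) ->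
  f a <= v <= f b -> exists2 c, a <= c <= b & f c = v.
Proof.
move=> ab /within_cont cf /andP[av vb].
have [|c cab E] := @IVT R f a b v ab cf.
  by rewrite ge_min av /= le_max vb orbT.
by exists c => //; move: cab; rewrite in_itv.
Qed.

Local Notation mu := (@lebesgue_measure R).

Lemma cont_integrable f a b : (forall x, a <= x <= b -> {for x, continuous f}) ->
  mu.-integrable `[a, b] (EFin \o f).
Proof.
move=> /within_cont cf; apply: continuous_compact_integrable => //.
exact: segment_compact.
Qed.

Lemma ftc2 f df a b : a <= b ->
  (forall x, a <= x <= b -> is_derive x 1 f (df x)) ->
  (forall x, a <= x <= b -> {for x, continuous df}) ->
  (\int[mu]_(x in `[a, b]) df x) = f b - f a.
Proof.
rewrite le_eqVlt => /predU1P[<-|ab] Hd Hc.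
  by rewrite set_itv1 Rintegral_set1 subrr.
rewrite /Rintegral (@continuous_FTC2 R df f)//.
- exact: within_cont.
- split.
  + by move=> x; rewrite in_itv/= => /andP[/ltW ax /ltW xb]; have [|//] := Hd x; rewrite ax.
  + by apply: cvg_at_right_filter; apply: derive_cont (Hd _ _); rewrite lexx ltW.
  + by apply: cvg_at_left_filter; apply: derive_cont (Hd _ _); rewrite lexx ltW.
- move=> x; rewrite in_itv/= => /andP[/ltW ax /ltW xb]; apply: derive1_val.
  by apply: Hd; rewrite ax.
Qed.

Lemma ftc1 f a b x : a < x < b ->
  (forall y, a <= y <= b -> {for y, continuous f}) ->
  is_derive x 1 (fun y => \int[mu]_(t in `[a, y]) f t) (f x).
Proof.
move=> /andP[ax xb] cf.
have [|] := @continuous_FTC1_closed R f a x b xb (cont_integrable cf) ax _.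
  by apply: cf; rewrite !ltW.
by move=> dF <-; rewrite derive1E; split.
Qed.

Lemma derive_add f g x a b : is_derive x 1 f a -> is_derive x 1 g b ->
  is_derive x 1 (fun y => f y + g y) (a + b).
Proof. exact: is_deriveD. Qed.

Lemma derive_sub f g x a b : is_derive x 1 f a -> is_derive x 1 g b ->
  is_derive x 1 (fun y => f y - g y) (a - b).
Proof. exact: is_deriveB. Qed.

Lemma derive_mul f g x a b : is_derive x 1 f a -> is_derive x 1 g b ->
  is_derive x 1 (fun y => f y * g y) (a * g x + f x * b).
Proof.
move=> hf hg; apply: derive_eq (is_deriveM hf hg) _.
by rewrite /GRing.scale /=; ring.
Qed.

Lemma derive_scale f x a c : is_derive x 1 f a -> is_derive x 1 (fun y => c * f y) (c * a).
Proof. exact: is_deriveZ. Qed.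

Lemma derive_inv f x a : is_derive x 1 f a -> f x != 0 ->
  is_derive x 1 (fun y => (f y)^-1) (- a / f x ^+ 2).
Proof.
move=> hf f0; apply: derive_eq (is_deriveV f0 hf) _.
by rewrite /GRing.scale /=; field.
Qed.

Lemma derive_div f g x a b : is_derive x 1 f a -> is_derive x 1 g b -> g x != 0 ->
  is_derive x 1 (fun y => f y / g y) ((a * g x - f x * b) / g x ^+ 2).
Proof.
move=> hf hg g0; apply: derive_eq (derive_mul hf (derive_inv hg g0)) _.
by field.
Qed.

Lemma derive_sqr f x a : is_derive x 1 f a ->
  is_derive x 1 (fun y => f y ^+ 2) (2 * f x * a).
Proof. by move=> hf; apply: derive_eq (derive_mul hf hf) _; ring. Qed.

Lemma derive_comp f g x a b : is_derive (g x) 1 f a -> is_derive x 1 g b ->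
  is_derive x 1 (fun y => f (g y)) (a * b).
Proof. exact: (@is_derive1_comp R f g x a b). Qed.

Lemma derive_const c x : is_derive x 1 (fun=> c) (0 : R).
Proof. exact: is_derive_cst. Qed.

Lemma derive_id x : is_derive x 1 (fun y => y) (1 : R).
Proof. exact: is_derive_id. Qed.

End RealAnalysis.

(** * Primitives of closed forms, a chain rule, induction along an interval, implicit
    differentiation *)

Section Calculus2.
Local Open Scope classical_set_scope.
Variable R : realType.
Implicit Types (f g df : R -> R) (x y a b l : R).
Local Notation mu := (@lebesgue_measure R).

(** The form [P ds + Q dt] is closed, [Qs] being both the [s]-derivative of [Q] and the
    [t]-derivative of [P]. Its primitive integrates [P] along the line [t = t0], then [Q] in [t];
    the bound [C] dominates the differentiation under the second integral. Both integrals start at a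
    base point, whence the restriction to [s > lo'] and [t > t0]. *)
Lemma potential (P Q Qs : R -> R -> R) (lo lo' hi t0 C : R) : lo < lo' ->
  (forall (s t : R), lo < s < hi -> is_derive s 1 (Q^~ t) (Qs s t)) ->
  (forall (s t : R), lo < s < hi -> is_derive t 1 (P s) (Qs s t)) ->
  (forall (s t : R), lo < s < hi -> {for t, continuous (Q s)}) ->
  (forall (s t : R), lo < s < hi -> {for t, continuous (Qs s)}) ->
  (forall (s t : R), lo < s < hi -> {for s, continuous (P^~ t)}) ->
  (forall (s t : R), lo < s < hi -> `|Qs s t| <= C) ->
  exists V : R -> R -> R, forall (s t : R), lo' < s < hi -> t0 < t ->
    is_derive s 1 (V^~ t) (P s t) /\ is_derive t 1 (V s) (Q s t).
Proof.
move=> lolo' dQ dP cQ cQs cP bQs.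
pose V s t := \int[mu]_(x in `[lo', s]) P x t0 + \int[mu]_(x in `[t0, t]) Q s x.
exists V => s t sJ tt; have sJ' : lo < s < hi.
  by have /andP[? ->] := sJ; rewrite andbT (lt_trans lolo').
split.
- have dI : is_derive s 1 (fun s => \int[mu]_(x in `[t0, t]) Q s x) (P s t - P s t0).
    have m1 : measurable (`[t0, t] : set (measurableTypeR R)) by [].
    have Is : `]lo, hi[ s by rewrite /= in_itv.
    have i1 u : `]lo, hi[ u -> mu.-integrable `[t0, t] (EFin \o Q u).
      rewrite /= in_itv /= => uJ; apply: cont_integrable => z _; exact: cQ.
    have d1 u z : `]lo, hi[ u -> `[t0, t] z -> derivable (Q^~ z) u 1.
      by rewrite /= in_itv /= => uJ _; have [] := dQ u z uJ.
    have iG : mu.-integrable `[t0, t] (EFin \o (fun=> `|C|)).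
      by apply: cont_integrable => z _; exact: cst_continuous.
    have bG u z : `]lo, hi[ u -> `[t0, t] z -> `|partial1of2 Q u z| <= `|C|.
      rewrite /= in_itv /= => uJ _; rewrite /partial1of2 (derive1_val (dQ _ _ uJ)).
      exact: le_trans (bQs _ _ uJ) (ler_norm _).
    have dd := @derivable_under_integral R _ (measurableTypeR R) mu Q _ m1 s lo hi Is i1 d1 (fun=> `|C|) (fun=> normr_ge0 C) iG bG.
    have ee := @differentiation_under_integral R _ (measurableTypeR R) mu Q _ m1 s lo hi Is i1 d1 (fun=> `|C|) (fun=> normr_ge0 C) iG bG.
    apply: DeriveDef => //; rewrite -derive1E ee.
    rewrite (@eq_Rintegral _ _ _ mu _ (Qs s)); last first.
      by move=> z _; rewrite /partial1of2 (derive1_val (dQ _ _ sJ')).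
    apply: ftc2 => [|z _|z _]; [exact: ltW|exact: dP|exact: cQs].
  have dF : is_derive s 1 (fun y => \int[mu]_(x in `[lo', y]) P x t0) (P s t0).
    have /andP[lo's shi] := sJ.
    apply: (@ftc1 _ _ lo' ((s + hi) / 2)) => [|y /andP[y1 y2]]; first by lra.
    by apply: cP; lra.
  by apply: derive_eq (is_deriveD dF dI) _; rewrite addrC subrK.
- have dI : is_derive t 1 (fun y => \int[mu]_(x in `[t0, y]) Q s x) (Q s t).
    apply: (@ftc1 _ _ t0 (t + 1)) => [|y _]; first by lra.
    exact: cQ.
  by apply: derive_eq (is_deriveD (is_derive_cst _ _ _) dI) _; rewrite add0r.
Qed.

(* Only one of the partial derivatives has to be continuous along a line. *)
Lemma chain2 (V Vs Vt : R -> R -> R) (S T : R -> R) (x dS dT r : R) : 0 < r ->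
  (forall (s t : R), `|s - S x| < r -> `|t - T x| < r -> is_derive s 1 (V^~ t) (Vs s t)) ->
  is_derive (T x) 1 (V (S x)) (Vt (S x) (T x)) ->
  (forall e, 0 < e -> exists2 d, 0 < d & forall (s t : R), `|s - S x| < d -> `|t - T x| < d ->
     `|Vs s t - Vs (S x) (T x)| < e) ->
  is_derive x 1 S dS -> is_derive x 1 T dT ->
  is_derive x 1 (fun y => V (S y) (T y)) (Vs (S x) (T x) * dS + Vt (S x) (T x) * dT).
Proof.
move=> r0 dV dVt cVs hS hT.
have d2 : is_derive x 1 (fun y => V (S x) (T y)) (Vt (S x) (T x) * dT).
  exact: (@is_derive1_comp R (V (S x)) T).
suff d1 : is_derive x 1 (fun y => V (S y) (T y) - V (S x) (T y)) (Vs (S x) (T x) * dS).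
  have := is_deriveD d1 d2; apply: derive_near ltr01 _ => y _; rewrite /=.
  by rewrite -[LHS]/(V (S y) (T y) - V (S x) (T y) + V (S x) (T y)) subrK.
have /contP cS := derive_cont hS.
have /contP cT := derive_cont hT.
(* [c y] is a mean value slope of [V] between [S x] and [S y] at [T y], with the slope at the base
   point as default. It tends to that slope, so multiplied by the Caratheodory slope of [S] it gives
   the derivative of the part in [s]. *)
pose c y := xget (Vs (S x) (T x)) [set w | V (S y) (T y) - V (S x) (T y) = w * (S y - S x) /\
   exists2 s, Num.min (S x) (S y) <= s <= Num.max (S x) (S y) & w = Vs s (T y)].
have cE : exists2 d, 0 < d & forall y, `|y - x| < d -> 
   V (S y) (T y) - V (S x) (T y) = c y * (S y - S x) /\
   exists2 s, Num.min (S x) (S y) <= s <= Num.max (S x) (S y) & c y = Vs s (T y).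
  have [d d0 Hd] := cS _ r0; have [d' d'0 Hd'] := cT _ r0.
  exists (Num.min d d'); first by rewrite lt_min d0.
  move=> y; rewrite lt_min => /andP[/Hd y1 /Hd' y2]; rewrite /c.
  case: xgetP => [w _ []//|].
  have [|s sb E] := @mvt R (V^~ (T y)) (Vs^~ (T y)) (S x) (S y).
    move=> s /andP[s1 s2]; apply: dV => //; move: s1 s2 y1.
    by case: (ltP (S x) (S y)) => ?; rewrite !ltr_norml; lra.
  by move=> /(_ (Vs s (T y))) []; split => //; exists s.
have {}cE : exists2 d, 0 < d & forall y, `|y - x| < d -> 
   V (S y) (T y) - V (S x) (T y) = c y * (S y - S x) /\ 
   (forall e, 0 < e -> exists2 d, 0 < d & forall y, `|y - x| < d -> `|c y - Vs (S x) (T x)| < e).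
  have [d d0 Hd] := cE; exists d => // y yx; split; first by have [] := Hd _ yx.
  move=> e e0; have [d1 d10 Hd1] := cVs _ e0.
  have [d2' d20 Hd2] := cS _ d10; have [d3 d30 Hd3] := cT _ d10.
  exists (Num.min d (Num.min d2' d3)); first by rewrite !lt_min d0 d20.
  move=> z; rewrite !lt_min => /and3P[z1 z2 z3].
  have [_ [s sb ->]] := Hd _ z1; apply: Hd1; last exact: Hd3.
  move: sb (Hd2 _ z2).
  by case: (ltP (S x) (S z)) => ? /andP[? ?]; rewrite !ltr_norml; lra.
have [d d0 Hd] := cE.
have [g [gE /contP cg gx]] := (is_derive1_caratheodory _ _ _).1 hS.
have dd : is_derive x 1 (fun y => c y * (S y - S x)) (Vs (S x) (T x) * dS).
  apply/is_derive1_caratheodory; exists (fun y => c y * g y); split.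
  - by move=> z; rewrite subrr mulr0 subr0 gE mulrA.
  - apply: (@continuousM _ _ c g); last exact/contP.
    have [_ cc] := Hd x ltac:(by rewrite subrr normr0).
    apply/contP => e e0; have [d1 d10 Hd1] := cc _ (divr_gt0 e0 (ltr0n _ 2)).
    exists d1 => // y yx; have h1 := Hd1 _ yx.
    have h2 := Hd1 x ltac:(by rewrite subrr normr0).
    by move: h1 h2; rewrite !ltr_norml; lra.
  - rewrite gx; congr (_ * _); have [_ cc] := Hd x ltac:(by rewrite subrr normr0).
    apply/eqP; rewrite -subr_eq0 -normr_eq0; apply/negPn/negP => n0.
    have n1 : 0 < `|c x - Vs (S x) (T x)| by rewrite lt_def n0 normr_ge0.
    by have [d1 d10 /(_ x)] := cc _ n1; rewrite subrr normr0 ltxx => /(_ d10).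
apply: derive_near d0 _ dd => y /Hd[-> _] //.
Qed.

(** The supremum of the points reached from [a] is reached, from its left, and can be passed, to its
    right. Applied to an inequality between values of a function, this gives monotonicity from local
    one-sided comparisons without continuity. *)
Lemma real_induction (r : R -> R -> Prop) a b : a < b ->
  (forall x y z, a <= x -> x < y -> y < z -> z <= b -> r x y -> r y z -> r x z) ->
  (forall x, a <= x < b -> exists2 d, 0 < d & forall y, x < y < x + d -> y <= b -> r x y) ->
  (forall x, a < x <= b -> exists2 d, 0 < d & forall y, x - d < y < x -> a <= y -> r y x) ->
  r a b.
Proof.
move=> ab tr rt lt.
pose A := [set x | a < x <= b /\ r a x].
have [d d0 Hd] := rt a ltac:(by rewrite lexx).
have A0 : A (Num.min b (a + d / 2)).
  have h : a < Num.min b (a + d / 2) by rewrite lt_min ab ltrDl divr_gt0.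
  split; first by rewrite h ge_min lexx.
  apply: Hd; last by rewrite ge_min lexx.
  by rewrite h gt_min; apply/orP; right; lra.
have hA : has_sup A by split; [exists (Num.min b (a + d / 2))|exists b => x [/andP[]]].
set m := sup A.
have ub x : A x -> x <= m by move=> Ax; apply: sup_upper_bound.
have am : a < m by case: A0 (ub _ A0) => /andP[h _] _ /(lt_le_trans h).
have mb : m <= b by apply: ge_sup; [exists (Num.min b (a + d / 2))|move=> x [/andP[]]].
have [d1 d10 Hd1] := lt m ltac:(by rewrite am).
have [x Ax mx] := @sup_adherent R A d1 d10 hA.
have ram : r a m.
  have [xm|mx'] := ltP x m; last first.
    have -> : m = x by apply/eqP; rewrite eq_le mx' ub.
    by case: Ax.
  have [/andP[ax xb] rax] := Ax.
  by apply: tr rax (Hd1 x _ _) => //; rewrite ?mx ?ltW.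
have [mb'|bm] := ltP m b; last by have -> : b = m by apply/eqP; rewrite eq_le mb bm.
have [d2 d20 Hd2] := rt m ltac:(by rewrite mb' ltW).
have h : m < Num.min b (m + d2 / 2) by rewrite lt_min mb' ltrDl divr_gt0.
have : A (Num.min b (m + d2 / 2)).
  split; first by rewrite (lt_trans am h) ge_min lexx.
  apply: tr ram (Hd2 _ _ _) => //; rewrite ?ge_min ?lexx ?h //.
  by rewrite gt_min; apply/orP; right; lra.
by move=> /ub; rewrite leNgt h.
Qed.

(** The expansion bound with constant [c] makes [p] continuous at [x]; then the increment of [p] is
    the quotient of the Caratheodory slopes of [G] and [F], times [y - x]. *)
Lemma implicit_derive (F G p : R -> R) (x c dF dG r : R) : 0 < c -> 0 < r ->
  (forall y, `|y - x| < r -> F (p y) = G y) ->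
  (forall y, `|y - x| < r -> c * `|p y - p x| <= `|F (p y) - F (p x)|) ->
  is_derive (p x) 1 F dF -> dF != 0 -> is_derive x 1 G dG ->
  is_derive x 1 p (dG / dF).
Proof.
move=> c0 r0 E lb hF dF0 hG.
have [g [gE gc gx]] := (is_derive1_caratheodory _ _ _).1 hG.
have [f [fE fc fx]] := (is_derive1_caratheodory _ _ _).1 hF.
have /contP cG := derive_cont hG.
have cp : {for x, continuous p}.
  apply/contP => e e0; have [d d0 Hd] := cG _ (mulr_gt0 c0 e0).
  exists (Num.min d r); first by rewrite lt_min d0.
  move=> y; rewrite lt_min => /andP[yd yr].
  rewrite -(ltr_pM2l c0); apply: le_lt_trans (lb _ yr) _.
  by rewrite !E ?subrr ?normr0//; apply: Hd.
suff H : is_derive x 1 (fun y => (g y / f (p y)) * (y - x)) (dG / dF).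
  have h : exists2 d, 0 < d & forall y, `|y - x| < d -> f (p y) != 0.
    have /contP cf : {for x, continuous (f \o p)} by apply: continuous_comp.
    have n0 : 0 < `|dF| by rewrite normr_gt0.
    have [d d0 Hd] := cf _ n0; exists d => // y /Hd /=; rewrite fx => h.
    by apply: contraL h => /eqP ->; rewrite sub0r normrN ltxx.
  have [d d0 Hd] := h.
  have H' : is_derive x 1 (fun y => p x + (g y / f (p y)) * (y - x)) (dG / dF).
    by apply: derive_eq (is_deriveD (is_derive_cst _ _ _) H) _; rewrite add0r.
  apply: (@derive_near _ _ _ _ _ (Num.min d r)) H'; first by rewrite lt_min d0.
  move=> y; rewrite lt_min => /andP[yd yr].
  have h1 : f (p y) * (p y - p x) = g y * (y - x).
    by rewrite -fE -gE !E ?subrr ?normr0.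
  by rewrite -mulrA (mulrC (f (p y))^-1) mulrA -h1 mulrAC divff ?Hd// mul1r addrC subrK.
apply/is_derive1_caratheodory; exists (fun y => g y / f (p y)); split.
- by move=> z; rewrite subrr mulr0 subr0.
- apply: (@continuousM _ _ g (fun y => (f (p y))^-1)) => //.
  apply: continuousV; first by rewrite fx.
  exact: (@continuous_comp _ _ _ p f).
- by rewrite fx gx.
Qed.

End Calculus2.

(** * Averaged functions as polynomials *)

Section ExponentialSums.
Local Open Scope complex_scope.
Variable R : realType.
Implicit Types (c d m : nat -> R) (n : nat) (s t : R) (p : {poly R[i]}).

(* Real part of [\sum_j (c_j + i d_j) exp (m_j w)] at [w = s + i t]; the imaginary
   part is the same sum for the coefficients [d], [- c]. *)
Definition etrig m n c d s t : R :=
  \sum_(j < n) expR (m j * s) * (c j * cos (m j * t) - d j * sin (m j * t)).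

Lemma etrig_ds m n c d s t : is_derive s 1 (fun s => etrig m n c d s t)
  (etrig m n (fun j => m j * c j) (fun j => m j * d j) s t).
Proof.
have -> : (fun s => etrig m n c d s t) = \sum_(j < n) (fun s : R =>
   expR (m j * s) * (c j * cos (m j * t) - d j * sin (m j * t))).
  by apply/funext => x; rewrite fct_sumE.
apply: is_derive_sum => j.
have h : is_derive s 1 (fun s => m j * s) (m j).
  by apply: derive_eq (is_deriveZ _ _) _; rewrite /GRing.scale /= mulr1.
have h1 := @is_derive1_comp R expR (fun s => m j * s) s _ _ (is_derive_expR _) h.
have := is_deriveM h1 (is_derive_cst (c j * cos (m j * t) - d j * sin (m j * t)) s 1).
by move=> H; apply: derive_eq H _; rewrite /GRing.scale /=; ring.
Qed.

Lemma etrig_dt m n c d s t : is_derive t 1 (fun t => etrig m n c d s t)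
  (etrig m n (fun j => - (m j * d j)) (fun j => m j * c j) s t).
Proof.
have -> : (fun t => etrig m n c d s t) = \sum_(j < n) (fun t : R =>
   expR (m j * s) * (c j * cos (m j * t) - d j * sin (m j * t))).
  by apply/funext => x; rewrite fct_sumE.
apply: is_derive_sum => j.
have h : is_derive t 1 (fun s => m j * s) (m j).
  by apply: derive_eq (is_deriveZ _ _) _; rewrite /GRing.scale /= mulr1.
have h1 := @is_derive1_comp R cos (fun s => m j * s) t _ _ (is_derive_cos _) h.
have h2 := @is_derive1_comp R sin (fun s => m j * s) t _ _ (is_derive_sin _) h.
have := is_deriveZ (expR (m j * s)) (is_deriveB (is_deriveZ (c j) h1) (is_deriveZ (d j) h2)).
by move=> H; apply: derive_eq H _; rewrite /GRing.scale /=; ring.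
Qed.

Lemma etrig_bound m n c d s0 :
  exists2 K, 0 <= K & forall s t, `|s - s0| <= 1 -> `|etrig m n c d s t| <= K.
Proof.
exists (\sum_(j < n) expR (`|m j| * (`|s0| + 1)) * (`|c j| + `|d j|)).
  by apply: sumr_ge0 => j _; rewrite mulr_ge0 ?expR_ge0 ?addr_ge0.
move=> s t h; apply: le_trans (ler_norm_sum _ _ _) _; apply: ler_sum => j _.
rewrite normrM; apply: ler_pM => //.
  rewrite ger0_norm ?expR_ge0// ler_expR.
  apply: le_trans (ler_norm _) _; rewrite normrM ler_wpM2l//.
  by have := ler_normD (s - s0) s0; rewrite subrK; lra.
apply: le_trans (ler_normB _ _) _; rewrite !normrM; apply: lerD.
  by rewrite ler_piMr// ler_norml cos_geN1 cos_le1.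
by rewrite ler_piMr// ler_norml sin_geN1 sin_le1.
Qed.

Lemma etrigN m n c d s t :
  etrig m n (fun j => - c j) (fun j => - d j) s t = - etrig m n c d s t.
Proof. by rewrite /etrig -sumrN; apply: eq_bigr => j _; ring. Qed.

Lemma etrig_conj m n c d s t :
  etrig m n c d s (- t) = etrig m n c (fun j => - d j) s t.
Proof.
by apply: eq_bigr => j _; rewrite mulrN cosN sinN; ring.
Qed.

(** Real part of a primitive in [w = s + i t] of the sum of the terms [(c_j + i d_j) exp (m_j w)].
    Terms with [m_j = 0] vanish from the first sum since division by [0] gives [0]; they integrate
    to [(c_j + i d_j) w], the last two summands. *)
Definition eprim m n c d s t : R :=
  etrig m n (fun j => c j / m j) (fun j => d j / m j) s t
  + (\sum_(j < n | m j == 0) c j) * s - (\sum_(j < n | m j == 0) d j) * t.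

Lemma etrig_split m n c d s t : etrig m n c d s t =
  etrig m n (fun j => m j * (c j / m j)) (fun j => m j * (d j / m j)) s t
  + \sum_(j < n | m j == 0) c j.
Proof.
rewrite /etrig [X in _ = _ + X]big_mkcond -big_split; apply: eq_bigr => j _ /=.
case: eqVneq => [->|m0]; last by rewrite addr0 ![m j * (_ / _)]mulrC !divfK.
by rewrite !mul0r expR0 cos0 sin0; ring.
Qed.

Lemma eprim_ds m n c d s t : is_derive s 1 (fun s => eprim m n c d s t) (etrig m n c d s t).
Proof.
have h := etrig_ds m n (fun j => c j / m j) (fun j => d j / m j) s t.
have h1 := is_deriveZ (\sum_(j < n | m j == 0) c j) (is_derive_id s 1).
have := is_deriveB (is_deriveD h h1) (is_derive_cst ((\sum_(j < n | m j == 0) d j) * t) s 1).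
move=> H; apply: derive_eq H _; rewrite [RHS]etrig_split /GRing.scale /=.
by rewrite mulr1 subr0.
Qed.

Lemma eprim_dt m n c d s t :
  is_derive t 1 (fun t => eprim m n c d s t) (- etrig m n d (fun j => - c j) s t).
Proof.
have h := etrig_dt m n (fun j => c j / m j) (fun j => d j / m j) s t.
have h1 := is_deriveZ (\sum_(j < n | m j == 0) d j) (is_derive_id t 1).
have := is_deriveB (is_deriveD h (is_derive_cst ((\sum_(j < n | m j == 0) c j) * s) t 1)) h1.
move=> H; apply: derive_eq H _; rewrite [in RHS]etrig_split /GRing.scale /= opprD mulr1 addr0.
congr (_ - _); rewrite -etrigN /etrig; apply: eq_bigr => j _.
by rewrite !mulNr mulrN mulNr opprK.
Qed.

Lemma eprim_conj m n c d s t :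
  eprim m n c d s (- t) = eprim m n c (fun j => - d j) s t.
Proof.
rewrite /eprim etrig_conj sumrN mulNr mulrN !opprK; congr (_ + _ + _).
by apply: eq_bigr => j _; rewrite [- d j / _]mulNr.
Qed.

Lemma cis_mul (x y : R) : cis x * cis y = cis (x + y).
Proof.
by apply/eqP; rewrite eq_complex /= cosD sinD; apply/andP; split; apply/eqP; ring.
Qed.

Lemma cisX (x : R) k : cis x ^+ k = cis (k%:R * x).
Proof.
elim: k => [|k IH]; first by rewrite mul0r /cis cos0 sin0.
by rewrite exprS IH cis_mul -natr1; congr cis; ring.
Qed.

Lemma cis_neq0 (x : R) : cis x != 0.
Proof.
apply/eqP => /eqP; rewrite eq_complex /= => /andP[/eqP c0 /eqP s0].
by have := cos2Dsin2 x; rewrite c0 s0 expr0n addr0 => /eqP; rewrite eq_sym oner_eq0.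
Qed.

(** Dividing [p(z)] by [z ^ q] shifts every exponent by [q], so the quotient is an exponential sum
    in [s + i t]. It serves with [q = 1] for [h / z] and with [q = 2] for the square of [h / z]. *)
Lemma etrig_poly p q s t :
  let z := (expR s)%:C * cis t in
  let m j := j%:R - q%:R : R in
  let c j := complex.Re p`_j in let d j := complex.Im p`_j in
  p.[z] = z ^+ q * (etrig m (size p) c d s t +i* etrig m (size p) d (fun j => - c j) s t).
Proof.
move=> z m c d.
have -> : (etrig m (size p) c d s t +i* etrig m (size p) d (fun j => - c j) s t) =
   \sum_(j < size p) p`_j * ((expR (m j * s))%:C * cis (m j * t)).
  apply/eqP; rewrite eq_complex; apply/andP; split; apply/eqP;
    rewrite /= ?(raddf_sum (@complex.Re R)) ?(raddf_sum (@complex.Im R)) /=;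
    apply: eq_bigr => j _; rewrite /c /d; case: (p`_j) => x y /=; ring.
rewrite horner_coef big_distrr /=; apply: eq_bigr => j _.
rewrite mulrCA; congr (_ * _); rewrite /z !exprMn !cisX -!rmorphXn /= -!expRM_natl.
rewrite mulrACA cis_mul -rmorphM -expRD /=.
have e x : q%:R * x + m j * x = j%:R * x by rewrite /m; ring.
by rewrite !e.
Qed.

End ExponentialSums.

(** * The averaged functions in the coordinate [s = ln r] *)

Section Averaging.
Local Open Scope classical_set_scope.
Local Open Scope complex_scope.
Variable R : realType.
Implicit Types (h : {poly R[i]}) (e r s t : R).

Definition reC h j : R := complex.Re h`_j.
Definition imC h j : R := complex.Im h`_j.
Definition shift_exp (q : nat) (j : nat) : R := j%:R - q%:R.

(* [ka + i kb = h z / z] at [z = exp (s + i t)]; [kda + i kdb] is its derivative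
   in [s + i t], [prim1] the imaginary part of a primitive of it and [prim2] the
   real part of a primitive of its square. *)
Definition ka h := etrig (shift_exp 1) (size h) (reC h) (imC h).
Definition kb h := etrig (shift_exp 1) (size h) (imC h) (fun j => - reC h j).
Definition kda h := etrig (shift_exp 1) (size h)
  (fun j => shift_exp 1 j * reC h j) (fun j => shift_exp 1 j * imC h j).
Definition kdb h := etrig (shift_exp 1) (size h)
  (fun j => shift_exp 1 j * imC h j) (fun j => - (shift_exp 1 j * reC h j)).
Definition prim1 h := eprim (shift_exp 1) (size h) (imC h) (fun j => - reC h j).
Definition prim2 h := eprim (shift_exp 2) (size (h * h)) (reC (h * h)) (imC (h * h)).

Lemma ka_ds h s t : is_derive s 1 (fun s => ka h s t) (kda h s t).
Proof. exact: etrig_ds. Qed.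

Lemma kb_ds h s t : is_derive s 1 (fun s => kb h s t) (kdb h s t).
Proof.
apply: derive_eq (etrig_ds _ _ _ _ _ _) _.
by rewrite /kdb; congr (etrig _ _ _ _ s t); apply/funext => j; rewrite mulrN.
Qed.

Lemma ka_dt h s t : is_derive t 1 (ka h s) (- kdb h s t).
Proof.
apply: derive_eq (etrig_dt _ _ _ _ _ _) _; rewrite -etrigN.
by congr (etrig _ _ _ _ s t); apply/funext => j; rewrite opprK.
Qed.

Lemma kb_dt h s t : is_derive t 1 (kb h s) (kda h s t).
Proof.
apply: derive_eq (etrig_dt _ _ _ _ _ _) _.
by congr (etrig _ _ _ _ s t); apply/funext => j; rewrite mulrN opprK.
Qed.

Lemma prim1_ds h s t : is_derive s 1 (fun s => prim1 h s t) (kb h s t).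
Proof. exact: eprim_ds. Qed.

Lemma prim1_dt h s t : is_derive t 1 (prim1 h s) (ka h s t).
Proof.
apply: derive_eq (eprim_dt _ _ _ _ _ _) _; rewrite -etrigN.
by congr (etrig _ _ _ _ s t); apply/funext => j; rewrite opprK.
Qed.

Lemma kE h s t : let z := (expR s)%:C * cis t in
  h.[z] = z * (ka h s t +i* kb h s t).
Proof. by rewrite /= (etrig_poly h 1) expr1. Qed.

Lemma sqr_k h s t :
  etrig (shift_exp 2) (size (h * h)) (reC (h * h)) (imC (h * h)) s t
     = ka h s t ^+ 2 - kb h s t ^+ 2 /\
  etrig (shift_exp 2) (size (h * h)) (imC (h * h)) (fun j => - reC (h * h) j) s t
     = 2 * (ka h s t * kb h s t).
Proof.
have z0 : (expR s)%:C * cis t != 0.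
  rewrite mulf_neq0 ?cis_neq0//; apply/eqP => -[] /eqP.
  by rewrite gt_eqF// expR_gt0.
have := etrig_poly (h * h) 2 s t; rewrite /= hornerM kE mulrACA -expr2.
move/(mulfI (expf_neq0 2 z0)) => /eqP; rewrite eq_complex /= => /andP[/eqP E1 /eqP E2].
by rewrite -[LHS]E1 -[in X in _ /\ X]E2; split; ring.
Qed.

Lemma prim2_ds h s t : is_derive s 1 (fun s => prim2 h s t) (ka h s t ^+ 2 - kb h s t ^+ 2).
Proof. by rewrite -(sqr_k _ _ _).1; exact: eprim_ds. Qed.

Lemma prim2_dt h s t : is_derive t 1 (prim2 h s) (- (2 * (ka h s t * kb h s t))).
Proof. by rewrite -(sqr_k _ _ _).2; exact: eprim_dt. Qed.

(** [half1] and [half2] are the coefficients of [e] and [e ^ 2] in the upper half return map written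
    in the coordinate [s = ln r]; [half_map_exp] proves this. *)
Definition half1 h s := prim1 h s pi - prim1 h s 0.
Definition half2 h s := kb h s pi * half1 h s + (prim2 h s pi - prim2 h s 0).

(* The reversed conjugate of [z' = i z + e h z] is [z' = i z + e (mirror h) z],
   which carries the lower half-plane to the upper one. *)
Definition mirror h : {poly R[i]} := - map_poly conjc h.

Lemma size_mirror h : size (mirror h) = size h.
Proof. by rewrite size_polyN size_map_poly. Qed.

Lemma reC_mirror h j : reC (mirror h) j = - reC h j.
Proof. by rewrite /reC coefN coef_map /=; case: h`_j. Qed.

Lemma imC_mirror h j : imC (mirror h) j = imC h j.
Proof. by rewrite /imC coefN coef_map /=; case: h`_j => x y /=; rewrite opprK. Qed.

Lemma mirror_sqr h : mirror h * mirror h = map_poly conjc (h * h).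
Proof. by rewrite /mirror mulrNN rmorphM. Qed.

Lemma prim1_mirror h s t : prim1 h s (- t) = prim1 (mirror h) s t.
Proof.
rewrite /prim1 eprim_conj size_mirror; congr (eprim _ _ _ _ s t).
  by apply/funext => j; rewrite imC_mirror.
by apply/funext => j; rewrite reC_mirror.
Qed.

Lemma kb_mirror h s t : kb h s (- t) = kb (mirror h) s t.
Proof.
rewrite /kb etrig_conj size_mirror; congr (etrig _ _ _ _ s t).
  by apply/funext => j; rewrite imC_mirror.
by apply/funext => j; rewrite reC_mirror.
Qed.

Lemma prim2_mirror h s t : prim2 h s (- t) = prim2 (mirror h) s t.
Proof.
rewrite /prim2 eprim_conj mirror_sqr size_map_poly.
congr (eprim _ _ _ _ s t); apply/funext => j; rewrite /reC /imC coef_map /=.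
  by case: (_`_j).
by case: (_`_j).
Qed.

Lemma ln_expR_cis (r t : R) : 0 < r -> r%:C * cis t = (expR (ln r))%:C * cis t.
Proof. by move=> r0; rewrite lnK // posrE. Qed.

Lemma drdthetaE h e t r : 0 < r ->
  drdtheta h e t r = e * (r * ka h (ln r) t) / (1 + e * kb h (ln r) t).
Proof.
move=> r0; have rn0 : r != 0 by rewrite gt_eqF.
rewrite /drdtheta.
have -> : polar_velocity h e t r = (e * (r * ka h (ln r) t)) +i* (r * (1 + e * kb h (ln r) t)).
  rewrite /polar_velocity /perturbed hornerD !hornerZ hornerX {2}ln_expR_cis// kE -ln_expR_cis//.
  apply: (mulIf (cis_neq0 t)); rewrite divfK ?cis_neq0//.
  by apply/eqP; rewrite eq_complex /=; apply/andP; split; apply/eqP; ring.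
by rewrite /= [r * (1 + _)]mulrC mulfK.
Qed.

Let dlin (b e : R) : is_derive e 1 (fun e : R => 1 + e * b) b.
Proof.
by apply: derive_eq (derive_add (derive_const 1 e) (derive_mul (derive_id e) (derive_const b e))) _; ring.
Qed.

Let dquot (k b e : R) : 1 + e * b != 0 ->
  is_derive e 1 (fun e => e * k / (1 + e * b)) (k / (1 + e * b) ^+ 2).
Proof.
move=> n0.
apply: derive_eq (derive_div (derive_mul (derive_id e) (derive_const k e)) (dlin b e) n0) _.
by field.
Qed.

Let dquot2 (k b : R) : is_derive (0:R) 1 (fun e => k / (1 + e * b) ^+ 2) (- 2 * k * b).
Proof.
have n0 : (1 + 0 * b) ^+ 2 != 0 by rewrite mul0r addr0 expr1n oner_neq0.
apply: derive_eq (derive_div (derive_const k (0:R)) (derive_sqr (dlin b 0)) n0) _.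
by field; rewrite ?oner_neq0.
Qed.

Lemma F1E h t r : 0 < r -> F1 h t r = r * ka h (ln r) t.
Proof.
move=> r0; rewrite /F1; under eq_fun do rewrite drdthetaE//.
rewrite (derive1_val (dquot _ _)); first by rewrite mul0r addr0 expr1n divr1.
by rewrite mul0r addr0 oner_neq0.
Qed.

Lemma F2E h t r : 0 < r -> F2 h t r = - (r * ka h (ln r) t * kb h (ln r) t).
Proof.
move=> r0; rewrite /F2; under eq_fun do rewrite drdthetaE//.
rewrite derive1nS derive1n1.
set k := r * _; set b := kb _ _ _.
have H : is_derive (0:R) 1 ((fun e => e * k / (1 + e * b))^`()) (- 2 * k * b).
  have d0 : 0 < (1 + `|b|)^-1 by rewrite invr_gt0 ltr_pwDl.
  (* The formula for the first derivative is needed in a whole neighbourhood of [0]; this radius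
     keeps [1 + e * b] away from zero. *)
  apply: derive_near d0 _ (dquot2 k b) => e; rewrite subr0 => he.
  apply/esym/derive1_val/dquot/eqP => h0.
  have : `|e * b| < 1.
    rewrite normrM; apply: (@le_lt_trans _ _ (`|e| * (1 + `|b|))).
      by rewrite ler_wpM2l// lerDr.
    by rewrite -ltr_pdivlMr ?mul1r// ltr_pwDl.
  have -> : e * b = -1 by lra.
  by rewrite normrN normr1 ltxx.
by rewrite (derive1_val H); field.
Qed.

Lemma dF1E h t r : 0 < r -> (F1 h t)^`() r = ka h (ln r) t + kda h (ln r) t.
Proof.
move=> r0; have rn0 : r != 0 by rewrite gt_eqF.
have d1 := derive_comp (f := fun s => ka h s t) (g := @ln R) (ka_ds h (ln r) t) (is_derive1_ln r0).
have d2 := derive_mul (derive_id r) d1.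
apply: derive1_val; apply: derive_near r0 _ (derive_eq d2 _).
  move=> y; rewrite ltr_norml => /andP[y1 _]; rewrite F1E//; lra.
by field.
Qed.

Lemma oriented_ftc (f df : R -> R) (a b : R) : (forall x : R, is_derive x 1 f (df x)) ->
  (forall x : R, {for x, continuous df}) -> oriented_integral df a b = f b - f a.
Proof.
move=> hd hc; rewrite /oriented_integral; case: leP => [ab|/ltW ba].
  exact: ftc2.
by rewrite (ftc2 ba (fun x _ => hd x) (fun x _ => hc x)) opprB.
Qed.

Let cka h s t : {for t, continuous (ka h s)}.
Proof. exact: derive_cont (ka_dt h s t). Qed.

Let ckb h s t : {for t, continuous (kb h s)}.
Proof. exact: derive_cont (kb_dt h s t). Qed.

Let ckda h s t : {for t, continuous (kda h s)}.
Proof. exact: derive_cont (etrig_dt _ _ _ _ _ _). Qed.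

Lemma y1E h t r : 0 < r -> y1 h t r = r * (prim1 h (ln r) t - prim1 h (ln r) 0).
Proof.
move=> r0; rewrite /y1; under eq_fun do rewrite F1E//.
have d (x : R) : is_derive x 1 (fun t => r * prim1 h (ln r) t) (r * ka h (ln r) x).
  exact: derive_scale (prim1_dt h (ln r) x).
rewrite (oriented_ftc _ _ d) ?mulrBr//.
by move=> x; apply: (@continuousM _ _ (cst r)); [exact: cst_continuous|exact: cka].
Qed.

Lemma y2E h t r : 0 < r -> y2 h t r =
  let U := prim1 h (ln r) t - prim1 h (ln r) 0 in
  2 * r * (U ^+ 2 / 2 + kb h (ln r) t * U + (prim2 h (ln r) t - prim2 h (ln r) 0)).
Proof.
move=> r0 /=; rewrite /y2; set s := ln r.
under eq_fun do rewrite F2E// dF1E// y1E//.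
pose U t := prim1 h s t - prim1 h s 0.
have dU (x : R) : is_derive x 1 U (ka h s x).
  by apply: derive_eq (is_deriveB (prim1_dt h s x) (is_derive_cst _ x 1)) _; rewrite subr0.
(* The derivatives in the angle are [U' = ka], [kb' = kda] and [prim2' = - 2 ka kb]; the last one
   turns the [ka kb] coming from the product rule into the [- ka kb] of [F2]. *)
have d (x : R) : is_derive x 1 (fun t => 2 * r * (U t ^+ 2 / 2 + kb h s t * U t + prim2 h s t))
    (2 * - (r * ka h s x * kb h s x) + 2 * (ka h s x + kda h s x) * (r * U x)).
  have d1 := derive_mul (derive_sqr (dU x)) (derive_const (2^-1) x).
  have d2 := derive_mul (kb_dt h s x) (dU x).
  apply: derive_eq (derive_scale (2 * r) (derive_add (derive_add d1 d2) (prim2_dt h s x))) _.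
  by rewrite /U; field.
rewrite (oriented_ftc _ _ d); first by rewrite /U; field.
move=> x; apply: (@continuousD _ _ _ (fun x => 2 * - (r * ka h s x * kb h s x))
    (fun x => 2 * (ka h s x + kda h s x) * (r * U x))).
    apply: (@continuousM _ _ (cst 2)); first exact: cst_continuous.
    apply: (@continuousN _ _ _ (fun x => r * ka h s x * kb h s x)).
    apply: (@continuousM _ _ (fun x => r * ka h s x) (kb h s)); last exact: ckb.
    by apply: (@continuousM _ _ (cst r)); [exact: cst_continuous|exact: cka].
  apply: (@continuousM _ _ (fun x => 2 * (ka h s x + kda h s x)) (fun x => r * U x)).
    apply: (@continuousM _ _ (cst 2)); first exact: cst_continuous.
    by apply: (@continuousD _ _ _ (ka h s) (kda h s)); [exact: cka|exact: ckda].
  by apply: (@continuousM _ _ (cst r)); [exact: cst_continuous|exact: derive_cont (dU x)].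
Qed.

Lemma M1E hp hm r : 0 < r ->
  M1 hp hm r = r * (half1 hp (ln r) - half1 (mirror hm) (ln r)).
Proof.
move=> r0; rewrite /M1 !y1E// prim1_mirror /half1.
by rewrite -[in X in prim1 hm _ X]oppr0 prim1_mirror; ring.
Qed.

(** The terms [half1 ^ 2 / 2] come from the passage from [s] to [r = exp s]; they cancel once the
    first averaged function vanishes, leaving the difference of the [half2]. *)
Lemma M2E hp hm r : 0 < r ->
  M2 hp hm r = r * (half1 hp (ln r) ^+ 2 / 2 + half2 hp (ln r)
               - (half1 (mirror hm) (ln r) ^+ 2 / 2 + half2 (mirror hm) (ln r))).
Proof.
move=> r0; rewrite /M2 !y2E// prim1_mirror prim2_mirror kb_mirror /half2 /half1.
rewrite -[in X in prim1 hm _ X]oppr0 prim1_mirror.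
by rewrite -[in X in prim2 hm _ X]oppr0 prim2_mirror; field.
Qed.

End Averaging.

(** * Positive roots of polynomials with few monomials *)

Section FewRoots.
Variable R : realType.
Implicit Types (p : {poly R}) (L : seq nat) (s : seq R).

(** Rolle's theorem between consecutive roots. That the new roots avoid all the old ones is what
    detects multiple roots in [few_roots_simple]. *)
Lemma rolle_seq p x s : sorted <%R (x :: s) -> all (root p) (x :: s) ->
  exists s', [/\ size s' = size s, uniq s', all (root p^`()) s',
    all (> x) s' & ~~ has (mem s') (x :: s)].
Proof.
elim: s x => [|y s IH] x; first by move=> _ _; exists [::]; split.
move=> /= /andP[xy sy] /and3P[rx ry rs].
have [|s' [sz us rs' gs' ns']] := IH y sy; first by rewrite /= ry.
have [c cxy rc] := polyrcf.poly_rolle xy (etrans (eqP rx) (esym (eqP ry))).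
move: cxy; rewrite in_itv /= => /andP[xc cy].
have ys : all (> y) s by move: sy; rewrite (path_sortedE lt_trans) => /andP[].
exists (c :: s'); split.
- by rewrite /= sz.
- rewrite /= us andbT; apply/negP => /(allP gs') /= yc.
  by have := lt_trans yc cy; rewrite ltxx.
- by rewrite /= /root rc eqxx.
- by rewrite /= xc; apply/allP => z /(allP gs') /=; apply: lt_trans.
- rewrite -/(has _ (x :: y :: s)); apply/hasPn => z; rewrite !inE => zxs.
  apply/negP => /orP[/eqP zc|zs'].
    move: zxs; rewrite zc => /or3P[/eqP cx|/eqP cy'|cs].
    + by move: xc; rewrite cx ltxx.
    + by move: cy; rewrite cy' ltxx.
    + by have := lt_trans cy (allP ys _ cs); rewrite ltxx.
  case/orP: zxs => [/eqP zx|zys].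
    by have := lt_trans (lt_trans xc cy) (allP gs' _ zs'); rewrite zx ltxx.
  by move/hasPn: ns' => /(_ z zys) /=; apply/negP/negPn.
Qed.

(** Descartes' count without signs. A factor ['X] costs no positive root; once the constant term is
    non-zero, differentiating removes one monomial and, by Rolle, at most one root. *)
Lemma few_roots p L s : p != 0 -> (forall k, p`_k != 0 -> k \in L) -> uniq s ->
  (forall r, r \in s -> 0 < r /\ root p r) -> (size s < size L)%N.
Proof.
have [n] := ubnP (size p); elim: n p L s => // n IH p L s szp p0 pL us rs.
pose L' := [seq k.-1 | k <- L & (0 < k)%N].
have L'P q : (forall k, q`_k != 0 -> k.+1 \in L) -> forall k, q`_k != 0 -> k \in L'.
  by move=> H k /H kL; apply/mapP; exists k.+1; rewrite ?mem_filter.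
have [p00|p00] := eqVneq p`_0 0.
  have [q pq] : exists q, p = q * 'X.
    have /factor_theorem[q ->] : root p 0 by rewrite /root horner_coef0 p00.
    by exists q; rewrite subr0.
  have q0 : q != 0 by apply: contraNneq p0 => q0; rewrite pq q0 mul0r.
  apply: leq_trans (IH q L' s _ q0 _ us _) _.
  - by move: szp; rewrite pq size_mulX // ltnS.
  - by apply: L'P => k qk; apply: pL; rewrite pq coefMX.
  - move=> r /rs[r0]; rewrite pq rootM => /orP[//|].
    by rewrite /root hornerX gt_eqF.
  - by rewrite size_map size_filter count_size.
have szL' : (size L' < size L)%N.
  rewrite size_map size_filter -(count_predC (fun k => 0 < k)%N L) -[X in (X < _)%N]addn0 ltn_add2l.
  by rewrite -has_count; apply/hasP; exists 0%N => //; apply: pL.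
have [dp0|dp0] := eqVneq p^`() 0.
  case: s us rs => [_ _|r s _ /(_ r)]; first by apply: leq_ltn_trans szL'.
  rewrite inE eqxx => /(_ isT) [_].
  have /size1_polyC -> : (size p <= 1)%N.
    rewrite leqNgt; apply/negP => sz1.
    have := lead_coef_eq0 p; rewrite (negbTE p0) lead_coefE => /negP; apply.
    have := coef_deriv p (size p).-2; rewrite dp0 coef0 prednK -?subn1 ?subn_gt0//.
    move=> /esym/eqP; rewrite mulrn_eq0 => /orP[|//].
    by rewrite subn1 -(prednK (ltnW sz1)) /=; case: (size p) sz1 => [|[]].
  by rewrite rootC (negbTE p00).
have pr : perm_eq (sort <=%R s) s by rewrite perm_sort.
move: pr; case E : (sort <=%R s) => [|x t] pr.
  by rewrite -(perm_size pr); apply: leq_ltn_trans szL'.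
have st : sorted <%R (x :: t).
  by rewrite -E lt_sorted_uniq_le sort_uniq us sort_le_sorted.
have rt r : r \in x :: t -> 0 < r /\ root p r by rewrite (perm_mem pr); apply: rs.
have [|s' [sz us' rs' gs' _]] := @rolle_seq p x t st.
  by apply/allP => r /rt[].
rewrite -(perm_size pr) /= -sz.
apply: leq_ltn_trans (IH p^`() L' s' _ dp0 _ us' _) szL'.
- by apply: leq_trans (lt_size_deriv p0) _; rewrite -ltnS.
- by apply: L'P => k; rewrite coef_deriv mulrn_eq0 => pk; apply: pL.
- move=> r rs''; split; last exact: (allP rs').
  by apply: lt_trans (allP gs' _ rs''); have [] := rt x (mem_head _ _).
Qed.

(** Equality in [few_roots] forces simplicity: a multiple root would be a root of the derivative
    besides those given by Rolle, one more than the monomials of the derivative allow. *)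
Lemma few_roots_simple p L s : p != 0 -> (forall k, p`_k != 0 -> k \in L) -> uniq s ->
  (forall r, r \in s -> 0 < r /\ root p r) -> size L = (size s).+1 ->
  forall r, r \in s -> p^`().[r] != 0.
Proof.
have [n] := ubnP (size p); elim: n p L s => // n IH p L s szp p0 pL us rs szs r rin.
pose L' := [seq k.-1 | k <- L & (0 < k)%N].
have L'P q : (forall k, q`_k != 0 -> k.+1 \in L) -> forall k, q`_k != 0 -> k \in L'.
  by move=> H k /H kL; apply/mapP; exists k.+1; rewrite ?mem_filter.
have [p00|p00] := eqVneq p`_0 0.
  have [q pq] : exists q, p = q * 'X.
    have /factor_theorem[q ->] : root p 0 by rewrite /root horner_coef0 p00.
    by exists q; rewrite subr0.
  have q0 : q != 0 by apply: contraNneq p0 => q0; rewrite pq q0 mul0r.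
  have rq u : u \in s -> 0 < u /\ root q u.
    move=> /rs[r0]; rewrite pq rootM => /orP[//|].
    by rewrite /root hornerX gt_eqF.
  have [r0 /eqP qr] := rq r rin.
  rewrite pq derivM derivX mulr1 hornerD hornerM hornerX qr addr0 mulf_neq0 ?(gt_eqF r0)//.
  have qL : forall k, q`_k != 0 -> k \in L'.
    by apply: L'P => k qk; apply: pL; rewrite pq coefMX.
  have h1 := few_roots q0 qL us rq.
  apply: (IH q L' s _ q0 qL us rq _ r rin).
    by move: szp; rewrite pq size_mulX // ltnS.
  apply/eqP; rewrite eqn_leq h1 andbT -szs size_map size_filter count_size//.
have szL' : (size L' < size L)%N.
  rewrite size_map size_filter -(count_predC (fun k => 0 < k)%N L) -[X in (X < _)%N]addn0 ltn_add2l.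
  by rewrite -has_count; apply/hasP; exists 0%N => //; apply: pL.
apply/negP => /eqP dr.
have dp0 : p^`() != 0.
  apply/eqP => dp0; have [_ /eqP pr] := rs r rin.
  have [r0 _] := rs r rin.
  have [c _] := polyrcf.poly_mvt p r0; rewrite dp0 horner0 mul0r pr sub0r => /eqP.
  by rewrite oppr_eq0 horner_coef0 (negbTE p00).
have pr : perm_eq (sort <=%R s) s by rewrite perm_sort.
move: pr; case E : (sort <=%R s) => [|x t] pr.
  by move: rin; rewrite -(perm_mem pr).
have st : sorted <%R (x :: t).
  by rewrite -E lt_sorted_uniq_le sort_uniq us sort_le_sorted.
have rt u : u \in x :: t -> 0 < u /\ root p u by rewrite (perm_mem pr); apply: rs.
have [|s' [sz us' rs' gs' ns']] := @rolle_seq p x t st.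
  by apply/allP => u /rt[].
have : (size (r :: s') < size L')%N.
  apply: few_roots dp0 _ _ _.
  - by apply: L'P => k; rewrite coef_deriv mulrn_eq0 => pk; apply: pL.
  - rewrite cons_uniq us' andbT; move/hasPn: ns' => /(_ r) /=.
    by rewrite -/(r \in s'); apply; rewrite (perm_mem pr).
  - move=> u; rewrite inE => /orP[/eqP ->|us''].
      by split; [have [] := rs r rin|apply/eqP].
    split; last exact: (allP rs').
    by apply: lt_trans (allP gs' _ us''); have [] := rt x (mem_head _ _).
rewrite /= sz; have := perm_size pr; rewrite /= => ->.
by rewrite ltnNge -ltnS -szs szL'.
Qed.

End FewRoots.

(** * The averaged functions as polynomials in [r], and the upper bound *)

Section AveragedPolynomials.
Variable R : realType.
Implicit Types (h hp hm g : {poly R[i]}) (r : R).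

Lemma cos_natpi n : cos (n%:R * pi) = (-1) ^+ n :> R.
Proof.
elim: n => [|n IH]; first by rewrite mul0r cos0.
by rewrite -natr1 mulrDl mul1r cosDpi IH exprS mulN1r.
Qed.

Lemma sin_natpi n : sin (n%:R * pi) = 0 :> R.
Proof.
elim: n => [|n IH]; first by rewrite mul0r sin0.
by rewrite -natr1 mulrDl mul1r sinDpi IH oppr0.
Qed.

Lemma cos_shift_exp q j : cos (shift_exp R q j * pi) = (-1) ^+ (j + q).
Proof.
by rewrite /shift_exp mulrBl cosB !cos_natpi !sin_natpi mulr0 addr0 exprD.
Qed.

Lemma sin_shift_exp q j : sin (shift_exp R q j * pi) = 0.
Proof. by rewrite /shift_exp mulrBl sinB !sin_natpi !(mul0r, mulr0) subrr. Qed.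

Lemma expR_shift_exp q j r : 0 < r -> r ^+ q * expR (shift_exp R q j * ln r) = r ^+ j.
Proof.
move=> r0; have E k : expR (k%:R * ln r) = r ^+ k by rewrite expRM_natl lnK// posrE.
by rewrite -(E q) -expRD -(E j); congr expR; rewrite /shift_exp; ring.
Qed.

(* [0] at [j = q], where Rocq's division returns [0]. *)
Definition half_coef q j : R := ((-1) ^+ (j + q) - 1) / shift_exp R q j.

Lemma half_coef_odd q j : ~~ odd (j + q) -> half_coef q j = 0.
Proof. by move=> o; rewrite /half_coef -signr_odd (negbTE o) subrr mul0r. Qed.

Lemma half_coef_neq0 q j : odd (j + q) -> half_coef q j != 0.
Proof.
move=> o; rewrite /half_coef -signr_odd o /= expr1 mulf_neq0 //.
by rewrite invr_eq0 subr_eq0 eqr_nat; apply: contraTneq o => ->; rewrite addnn odd_double.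
Qed.

(** Each coefficient is the increment over a half turn of one term of the primitive, multiplied by
    [r ^ q]. The isolated coefficient at [j = q], with the factor [pi], comes from the part of
    [eprim] linear in the angle. *)
Definition half1p h : {poly R} :=
  \poly_(j < size h) (imC h j * half_coef 1 j + (pi * reC h j) *+ (j == 1)%N).
Definition kbp h : {poly R} := \poly_(j < size h) ((-1) ^+ j.+1 * imC h j).
Definition prim2p h : {poly R} := \poly_(j < size (h * h))
  (reC (h * h) j * half_coef 2 j - (pi * imC (h * h) j) *+ (j == 2)%N).

Lemma shift_exp_eq0 q j : (shift_exp R q j == 0) = (j == q).
Proof. by rewrite subr_eq0 eqr_nat. Qed.

Let eprim_diff q n (c d : nat -> R) r : 0 < r ->
  r ^+ q * (eprim (shift_exp R q) n c d (ln r) pi - eprim (shift_exp R q) n c d (ln r) 0)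
  = \sum_(j < n) (c j * half_coef q j - (pi * d j) *+ (nat_of_ord j == q)%N) * r ^+ j.
Proof.
move=> r0; rewrite /eprim.
set A := etrig _ _ _ _ _ _; set B := etrig _ _ _ _ _ _.
have -> : A + (\sum_(j < n | shift_exp R q j == 0) c j) * ln r -
    (\sum_(j < n | shift_exp R q j == 0) d j) * pi -
    (B + (\sum_(j < n | shift_exp R q j == 0) c j) * ln r -
    (\sum_(j < n | shift_exp R q j == 0) d j) * 0) =
    A - B - (\sum_(j < n | shift_exp R q j == 0) d j) * pi by ring.
rewrite /A /B /etrig -sumrB mulrBr [X in X - _]big_distrr /= [X in X * pi]big_mkcond /= mulrA.
rewrite big_distrr big_distrl /= -sumrB; apply: eq_bigr => j _.
rewrite mulr0 cos0 sin0 cos_shift_exp sin_shift_exp shift_exp_eq0.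
rewrite -mulrBr mulrA expR_shift_exp// /half_coef.
by case: eqVneq => [->|_]; rewrite ?mulr1n ?mulr0n; ring.
Qed.

Lemma half1pE h r : 0 < r -> (half1p h).[r] = r * half1 h (ln r).
Proof.
move=> r0; rewrite horner_poly /half1 -[X in X * _]expr1 eprim_diff//.
by apply: eq_bigr => j _; rewrite mulrN mulNrn opprK.
Qed.

Lemma prim2pE h r : 0 < r ->
  (prim2p h).[r] = r ^+ 2 * (prim2 h (ln r) pi - prim2 h (ln r) 0).
Proof. by move=> r0; rewrite horner_poly eprim_diff. Qed.

Lemma kbpE h r : 0 < r -> (kbp h).[r] = r * kb h (ln r) pi.
Proof.
move=> r0; rewrite horner_poly /kb /etrig big_distrr /=; apply: eq_bigr => j _.
rewrite mulrA -{2}(expr1 r) expR_shift_exp// cos_shift_exp sin_shift_exp addn1.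
by ring.
Qed.

Definition M1p h g : {poly R} := half1p h - half1p g.
(** This is [r ^ 2 * (half1 ^ 2 / 2 + half2)] at [s = ln r], square included; hence the division by
    [r] in [M2pE]. *)
Definition half2p h : {poly R} :=
  2^-1 *: (half1p h * half1p h) + kbp h * half1p h + prim2p h.
Definition M2p h g : {poly R} := half2p h - half2p g.

Lemma M1pE hp hm r : 0 < r -> M1 hp hm r = (M1p hp (mirror hm)).[r].
Proof. by move=> r0; rewrite M1E// hornerD hornerN !half1pE// -mulrBr. Qed.

Lemma M2pE hp hm r : 0 < r -> M2 hp hm r = (M2p hp (mirror hm)).[r] / r.
Proof.
move=> r0; have rn0 : r != 0 by rewrite gt_eqF.
rewrite M2E// /M2p /half2p !(hornerD, hornerN, hornerZ, hornerM) !half1pE// !kbpE// !prim2pE// /half2.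
by field.
Qed.

Lemma vanishing_poly (p : {poly R}) : (forall r, 0 < r -> p.[r] = 0) -> p = 0.
Proof.
move=> H; apply/eqP/negPn/negP => p0.
have := @max_poly_roots _ p [seq i.+1%:R | i <- iota 0 (size p)] p0.
rewrite size_map size_iota ltnn => /(_ _ _)/negP; apply => //.
- apply/allP => x /mapP[i _ ->]; rewrite /root H//.
- rewrite map_inj_uniq ?iota_uniq// => i j /eqP.
  by rewrite eqr_nat eqSS => /eqP.
Qed.

Lemma reC_default h j : (size h <= j)%N -> reC h j = 0.
Proof. by move=> hj; rewrite /reC nth_default. Qed.

Lemma imC_default h j : (size h <= j)%N -> imC h j = 0.
Proof. by move=> hj; rewrite /imC nth_default. Qed.

Lemma coef_half1p h j :
  (half1p h)`_j = imC h j * half_coef 1 j + (pi * reC h j) *+ (j == 1)%N.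
Proof.
rewrite coef_poly; case: ltnP => // hj.
by rewrite imC_default// reC_default// mul0r mulr0 mul0rn addr0.
Qed.

Lemma coef_kbp h j : (kbp h)`_j = (-1) ^+ j.+1 * imC h j.
Proof. by rewrite coef_poly; case: ltnP => // hj; rewrite imC_default// mulr0. Qed.

Lemma coef_prim2p h j : (prim2p h)`_j =
  reC (h * h) j * half_coef 2 j - (pi * imC (h * h) j) *+ (j == 2)%N.
Proof.
rewrite coef_poly; case: ltnP => // hj.
by rewrite imC_default// reC_default// mul0r mulr0 mul0rn subr0.
Qed.

(** The odd numbers up to [2 n - 1] and the even numbers from [2] to [n + 1]. *)
Definition averaged_exponents n : seq nat :=
  [seq (2 * i + 1)%N | i <- iota 0 n] ++ [seq (2 * i + 2)%N | i <- iota 0 ((n + 1) %/ 2)].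

Lemma size_averaged_exponents n : (1 <= n)%N ->
  size (averaged_exponents n) = ((3 * n - 1) %/ 2).+1.
Proof. by move=> n1; rewrite size_cat !size_map !size_iota; lia. Qed.

Lemma mem_averaged_exponents n k : (1 <= n)%N ->
  (odd k && (k <= 2 * n - 1)%N) || [&& ~~ odd k, (2 <= k)%N & (k <= n + 1)%N] ->
  k \in averaged_exponents n.
Proof.
move=> n1 /orP[/andP[ho kn]|/and3P[ho k2 kn]]; rewrite mem_cat; apply/orP; [left|right].
  by apply/mapP; exists (k./2); rewrite ?mem_iota; lia.
by apply/mapP; exists (k./2.-1); rewrite ?mem_iota; lia.
Qed.

(** When [M1p] vanishes the two [half1p] agree, so the imaginary coefficients of even index agree
    and [kbp h - kbp g] is odd of degree at most [n]. It multiplies [half1p h], made of ['X] and of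
    even powers up to [n]: the products have even exponents up to [n + 1], or odd ones up to
    [2 n - 1]. The squares of [h] and [g] contribute odd exponents up to [2 n - 1] and the exponent
    [2]. *)
Lemma M2p_support h g n : (1 <= n)%N -> (size h <= n.+1)%N -> (size g <= n.+1)%N ->
  M1p h g = 0 -> forall k, (M2p h g)`_k != 0 -> k \in averaged_exponents n.
Proof.
move=> n1 hn gn /eqP; rewrite subr_eq0 => /eqP u k.
have -> : M2p h g = (kbp h - kbp g) * half1p h + (prim2p h - prim2p g).
  by rewrite /M2p /half2p -u; ring.
have db j : (kbp h - kbp g)`_j != 0 -> odd j && (j <= n)%N.
  rewrite coefB !coef_kbp -mulrBr mulf_eq0 negb_or => /andP[_ d0].
  have jn : (j <= n)%N.
    rewrite leqNgt; apply: contra d0 => nj.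
    by rewrite !imC_default ?subrr//; lia.
  rewrite jn andbT; apply: contraNT d0 => o.
  have := congr1 (fun p : {poly R} => p`_j) u; rewrite !coef_half1p.
  have -> : (j == 1)%N = false by case: eqP o => // ->.
  rewrite !mulr0n !addr0 => /mulIf ->; rewrite ?subrr//.
  by apply: half_coef_neq0; rewrite addn1.
have du j : (half1p h)`_j != 0 -> (j == 1)%N || ~~ odd j && (j <= n)%N.
  rewrite coef_half1p; case: (j == 1)%N => //; rewrite mulr0n addr0 => d0 /=.
  have jn : (j <= n)%N.
    rewrite leqNgt; apply: contra d0 => nj.
    by rewrite !imC_default ?mul0r//; lia.
  rewrite jn andbT; apply: contraNN d0 => o.
  by rewrite half_coef_odd ?mulr0// addn1 /= negbK.
have dq (f : {poly R[i]}) : (size f <= n.+1)%N -> (prim2p f)`_k != 0 -> (k == 2)%N || odd k && (k <= 2 * n - 1)%N.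
  move=> fn; rewrite coef_prim2p; case: (k == 2)%N => //; rewrite mulr0n subr0 => d0 /=.
  have kn : (k < 2 * n + 1)%N.
    rewrite ltnNge; apply: contra d0 => nj.
    rewrite reC_default ?mul0r// (leq_trans (size_polyMleq _ _)) //; lia.
  have ok : odd k.
    by apply: contraNT d0 => o; rewrite half_coef_odd ?mulr0// addn2 /= negbK.
  by rewrite ok /=; lia.
rewrite coefD => nz; apply: mem_averaged_exponents => //.
have [z1|z1] := eqVneq ((kbp h - kbp g) * half1p h)`_k 0.
  move: nz; rewrite z1 add0r coefB => nz.
  have [z2|z2] := eqVneq (prim2p h)`_k 0.
    by have := dq g gn; rewrite z2 sub0r oppr_eq0 in nz; move=> /(_ nz); lia.
  by have := dq h hn z2; lia.
move: z1; rewrite coefM => z1.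
have [i iP] : exists i : 'I_k.+1, (kbp h - kbp g)`_i * (half1p h)`_(k - i) != 0.
  apply/existsP; apply: contraNT z1; rewrite negb_exists => /forallP H.
  by apply/eqP; apply: big1 => i _; apply/eqP; have := H i; rewrite negbK.
move: iP; rewrite mulf_eq0 negb_or => /andP[/db i1 /du i2].
have := ltn_ord i; move: i1 i2; move: (nat_of_ord i) => j; lia.
Qed.

Lemma M1p_support h g n : (size h <= n.+1)%N -> (size g <= n.+1)%N ->
  forall k, (M1p h g)`_k != 0 -> k \in 1%N :: [seq (2 * i)%N | i <- iota 0 (n %/ 2).+1].
Proof.
move=> hn gn k; rewrite coefB !coef_half1p in_cons; case: (k == 1)%N => //; rewrite orFb.
rewrite !mulr0n !addr0 => d0.
have kn : (k <= n)%N.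
  by rewrite leqNgt; apply: contra d0 => nj; rewrite !imC_default ?mul0r ?subrr//; lia.
have ok : ~~ odd k.
  by apply: contraNN d0 => o; rewrite half_coef_odd ?mulr0 ?subrr// addn1 /= negbK.
by apply/mapP; exists (k %/ 2)%N; rewrite ?mem_iota; lia.
Qed.

Lemma averaging_zeros_bound (np nm : nat) hp hm (s : seq R) : (1 <= np)%N -> (1 <= nm)%N ->
  size hp = np.+1 -> size hm = nm.+1 -> averaging_zeros hp hm s ->
  (size s <= (3 * maxn np nm - 1) %/ 2)%N.
Proof.
move=> np1 nm1 shp shm [M [fa us sz]]; set n := maxn np nm.
have n1 : (1 <= n)%N by rewrite /n; lia.
have hn : (size hp <= n.+1)%N by rewrite shp /n; lia.
have gn : (size (mirror hm) <= n.+1)%N by rewrite size_mirror shm /n; lia.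
case: fa => [[E nv]|[E v1 nv]].
  (* At first order the exponents are [1] and the even numbers up to [n]. This allows at most
     [n %/ 2 + 1] zeros, never more than the second order bound. *)
  have p0 : M1p hp (mirror hm) != 0.
    by apply: contra_notN nv => /eqP p0 r r0; rewrite M1pE// p0 horner0.
  have := few_roots p0 (M1p_support hn gn) us; rewrite /= size_map size_iota => H.
  have := H _; suff h : forall r, r \in s -> 0 < r /\ root (M1p hp (mirror hm)) r.
    by move=> /(_ h); lia.
  by move=> r /sz[r0 + _ _]; rewrite E M1pE// => ?; split=> //; apply/eqP.
have M10 : M1p hp (mirror hm) = 0.
  by apply: vanishing_poly => r r0; rewrite -M1pE// v1.
have p0 : M2p hp (mirror hm) != 0.
  by apply: contra_notN nv => /eqP p0 r r0; rewrite M2pE// p0 horner0 mul0r.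
rewrite -ltnS -size_averaged_exponents//.
apply: few_roots p0 (M2p_support n1 hn gn M10) us _ => r /sz[r0 + _ _].
rewrite E M2pE// => /eqP; rewrite mulf_eq0 invr_eq0 (gt_eqF r0) orbF => ?.
by split.
Qed.

End AveragedPolynomials.

(** * First integrals and half return maps *)

Section Order.
Variables (R : realType) (T : Type) (P : T -> Prop) (e : T -> R).
Hypothesis e1 : forall x, P x -> `|e x| <= 1.
Implicit Types (f g : T -> R) (k l : nat).

(** The small parameter is itself a function of the point [x], and one constant serves for the whole
    family [P]: no limit is taken, and remainders are uniform in the starting radius. *)
Definition bigO k f := exists C, forall x, P x -> `|f x| <= C * `|e x| ^+ k.
Definition eqO k f g := bigO k (fun x => f x - g x).

Lemma bigO_ext k f g : (forall x, P x -> f x = g x) -> bigO k f -> bigO k g.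
Proof. by move=> fg [C H]; exists C => x Px; rewrite -fg//; exact: H. Qed.

Lemma bigO_add k f g : bigO k f -> bigO k g -> bigO k (fun x => f x + g x).
Proof.
move=> [C H] [C' H']; exists (C + C') => x Px; rewrite mulrDl.
by apply: le_trans (ler_normD _ _) _; apply: lerD; [exact: H|exact: H'].
Qed.

Lemma bigO_opp k f : bigO k f -> bigO k (fun x => - f x).
Proof. by move=> [C H]; exists C => x Px; rewrite normrN; exact: H. Qed.

Lemma bigO_mul k l f g : bigO k f -> bigO l g -> bigO (k + l) (fun x => f x * g x).
Proof.
move=> [C H] [C' H']; exists (C * C') => x Px; rewrite normrM exprD mulrACA.
by apply: ler_pM => //; [exact: H|exact: H'].
Qed.

Lemma bigO_le k l f : (k <= l)%N -> bigO l f -> bigO k f.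
Proof.
move=> kl [C H]; exists `|C| => x Px; apply: le_trans (H x Px) _.
rewrite -(subnK kl) exprD mulrA; apply: ler_wpM2r; first exact: exprn_ge0.
apply: le_trans (ler_norm _) _; rewrite normrM ler_piMr//.
by rewrite normrX normr_id exprn_ile1// e1.
Qed.

Lemma bigO_e : bigO 1 e.
Proof. by exists 1 => x _; rewrite mul1r expr1. Qed.

Lemma bigO_const (c : R) : bigO 0 (fun=> c).
Proof. by exists `|c| => x _; rewrite expr0 mulr1. Qed.

Lemma bigO_inv f c : 0 < c -> (forall x, P x -> c <= `|f x|) -> bigO 0 (fun x => (f x)^-1).
Proof.
move=> c0 H; exists c^-1 => x Px; rewrite expr0 mulr1 normfV lef_pV2 ?posrE//; first exact: H.
exact: lt_le_trans c0 (H x Px).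
Qed.

Lemma eqO_e k f g : eqO k f g -> eqO k.+1 (fun x => e x * f x) (fun x => e x * g x).
Proof. by move=> /(bigO_mul bigO_e); apply: bigO_ext => x _; ring. Qed.

Lemma eqO_le k l f g : (k <= l)%N -> eqO l f g -> eqO k f g.
Proof. exact: bigO_le. Qed.

End Order.

(** * The first integral on a strip around [s0] *)

Section FirstIntegral.
Variable R : realType.
Variables (h : {poly R[i]}) (s0 : R).

Definition kden e s t : R := (e * ka h s t) ^+ 2 + (1 + e * kb h s t) ^+ 2.
Definition kre e s t : R := e * ka h s t / kden e s t.
Definition kim e s t : R := (1 + e * kb h s t) / kden e s t.

(* [- kim] and [kre] are the imaginary and real parts of [1 / (i + e k)], so [V] is
   minus the imaginary part of the complex time [\int dz / (i z + e h z)]. *)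
Definition first_integral e (V : R -> R -> R) := forall s t : R, `|s - s0| < 3 / 4 -> -1 < t ->
  is_derive s 1 (V^~ t) (kim e s t) /\ is_derive t 1 (V s) (- kre e s t).

Definition kbound K := 0 < K /\ forall s t, `|s - s0| <= 1 ->
  [/\ `|ka h s t| <= K, `|kb h s t| <= K, `|kda h s t| <= K & `|kdb h s t| <= K].

Lemma kbound_exists : exists K, kbound K.
Proof.
have [K1 K10 H1] := etrig_bound (shift_exp R 1) (size h) (reC h) (imC h) s0.
have [K2 K20 H2] := etrig_bound (shift_exp R 1) (size h) (imC h) (fun j => - reC h j) s0.
have [K3 K30 H3] := etrig_bound (shift_exp R 1) (size h)
  (fun j => shift_exp R 1 j * reC h j) (fun j => shift_exp R 1 j * imC h j) s0.
have [K4 K40 H4] := etrig_bound (shift_exp R 1) (size h)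
  (fun j => shift_exp R 1 j * imC h j) (fun j => - (shift_exp R 1 j * reC h j)) s0.
exists (K1 + K2 + K3 + K4 + 1); split; first by lra.
move=> s t hs; have := H1 s t hs; have := H2 s t hs; have := H3 s t hs; have := H4 s t hs.
by rewrite -/(ka h s t) -/(kb h s t) -/(kda h s t) -/(kdb h s t); split; lra.
Qed.

Variable K : R.
Hypothesis hK : kbound K.

Let K0 : 0 < K. Proof. by case: hK. Qed.

Lemma small_k e s t : `|e| * K <= 1 / 80 -> `|s - s0| <= 1 ->
  `|e * ka h s t| <= 1 / 80 /\ `|e * kb h s t| <= 1 / 80.
Proof.
move=> he hs; have [_ /(_ s t hs)[h1 h2 _ _]] := hK.
by rewrite !normrM; split; apply: le_trans he; apply: ler_wpM2l.
Qed.

Lemma kden_bounds e s t : `|e| * K <= 1 / 80 -> `|s - s0| <= 1 ->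
  3 / 4 <= kden e s t <= 4 / 3.
Proof.
move=> he hs; have [] := small_k t he hs.
rewrite /kden !ler_norml; nra.
Qed.

(** [kim] is the slope of the first integral in [s]; the lower bound makes its levels graphs over
    the angle, and the upper bound makes the half return map Lipschitz. *)
Lemma kim_bounds e s t : `|e| * K <= 1 / 80 -> `|s - s0| <= 1 ->
  1 / 2 <= kim e s t <= 2.
Proof.
move=> he hs; have [_] := small_k t he hs; have := kden_bounds t he hs.
rewrite /kim !ler_norml => /andP[h1 h2] /andP[h3 h4].
have D0 : 0 < kden e s t by lra.
by rewrite ler_pdivlMr// ler_pdivrMr//; lra.
Qed.

Lemma kre_bound e s t : `|e| * K <= 1 / 80 -> `|s - s0| <= 1 ->
  `|kre e s t| <= 2 * K * `|e|.
Proof.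
move=> he hs; have /andP[h1 h2] := kden_bounds t he hs.
have [_ /(_ s t hs)[ha _ _ _]] := hK.
have D0 : 0 < kden e s t by lra.
rewrite /kre normrM normfV (gtr0_norm D0) ler_pdivrMr// normrM.
have p0 : 0 <= `|e| * K by rewrite mulr_ge0// ltW.
have h3 : `|e| * `|ka h s t| <= `|e| * K by apply: ler_wpM2l.
have h4 : 0 <= `|e| * K * (kden e s t - 3 / 4) by rewrite mulr_ge0//; lra.
by apply: le_trans h3 _; lra.
Qed.

Lemma first_integral_exists e : `|e| * K <= 1 / 80 -> exists V, first_integral e V.
Proof.
move=> he.
pose A := ka h; pose B := kb h; pose A' := kda h; pose B' := kdb h.
have D0 s t : s0 - 1 < s < s0 + 1 -> kden e s t != 0 /\ `|s - s0| <= 1.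
  move=> hs; have hs' : `|s - s0| <= 1 by rewrite ler_norml; lra.
  by split => //; have := kden_bounds t he hs'; lra.
have dDs s t : is_derive (s:R) 1 (fun s => kden e s t)
    (2 * (e * A s t) * (e * A' s t) + 2 * (1 + e * B s t) * (e * B' s t)).
  have d1 := derive_sqr (derive_scale e (ka_ds h s t)).
  have d2 := derive_sqr (derive_add (derive_const 1 s) (derive_scale e (kb_ds h s t))).
  by apply: derive_eq (derive_add d1 d2) _; rewrite add0r.
have dDt s t : is_derive (t:R) 1 (fun t => kden e s t)
    (2 * (e * A s t) * (e * - B' s t) + 2 * (1 + e * B s t) * (e * A' s t)).
  have d1 := derive_sqr (derive_scale e (ka_dt h s t)).
  have d2 := derive_sqr (derive_add (derive_const 1 t) (derive_scale e (kb_dt h s t))).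
  by apply: derive_eq (derive_add d1 d2) _; rewrite add0r.
(* The [s]-derivative of [kre]. That its opposite is the [t]-derivative of [kim] is a Cauchy-Riemann
   equation for [1 / (i + e k)], and is the closedness required by [potential]. *)
pose Q's s t := ((e * A' s t) * kden e s t - (e * A s t) *
   (2 * (e * A s t) * (e * A' s t) + 2 * (1 + e * B s t) * (e * B' s t))) / kden e s t ^+ 2.
have dre s t : s0 - 1 < s < s0 + 1 -> is_derive (s:R) 1 (fun s => kre e s t) (Q's s t).
  by move=> hs; apply: derive_div (derive_scale e (ka_ds h s t)) (dDs s t) (D0 s t hs).1.
have dim s t : s0 - 1 < s < s0 + 1 -> is_derive (t:R) 1 (kim e s) (- Q's s t).
  move=> hs; have d1 := derive_add (derive_const 1 t) (derive_scale e (kb_dt h s t)).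
  apply: derive_eq (derive_div d1 (dDt s t) (D0 s t hs).1) _.
  have := (D0 s t hs).1; rewrite /Q's /kden /A /B /A' /B' => ?; by field.
have cim s t : s0 - 1 < s < s0 + 1 -> {for (s:R), continuous (fun s => kim e s t)}.
  move=> hs; have d1 := derive_add (derive_const 1 s) (derive_scale e (kb_ds h s t)).
  exact: derive_cont (derive_div d1 (dDs s t) (D0 s t hs).1).
have cre s t : s0 - 1 < s < s0 + 1 -> {for (t:R), continuous (kre e s)}.
  move=> hs; exact: derive_cont (derive_div (derive_scale e (ka_dt h s t)) (dDt s t) (D0 s t hs).1).
have cQ s t : s0 - 1 < s < s0 + 1 -> {for (t:R), continuous (Q's s)}.
  move=> hs; have dA := etrig_dt (shift_exp R 1) (size h) (fun j => shift_exp R 1 j * reC h j)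
    (fun j => shift_exp R 1 j * imC h j) s t.
  have dB := etrig_dt (shift_exp R 1) (size h) (fun j => shift_exp R 1 j * imC h j)
    (fun j => - (shift_exp R 1 j * reC h j)) s t.
  rewrite -/(kda h s) in dA; rewrite -/(kdb h s) in dB.
  have D20 : kden e s t ^+ 2 != 0 by rewrite expf_neq0// (D0 s t hs).1.
  have d1 := derive_scale e (ka_dt h s t).
  have d2 := derive_add (derive_const 1 t) (derive_scale e (kb_dt h s t)).
  have d3 := derive_mul (derive_scale 2 d1) (derive_scale e dA).
  have d4 := derive_mul (derive_scale 2 d2) (derive_scale e dB).
  have d5 := derive_sub (derive_mul (derive_scale e dA) (dDt s t)) (derive_mul d1 (derive_add d3 d4)).
  exact: derive_cont (derive_div d5 (derive_sqr (dDt s t)) D20).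
have bQ s t : s0 - 1 < s < s0 + 1 -> `|- Q's s t| <= 8 * (`|e| * K).
  move=> hs; have hs' := (D0 s t hs).2; have /andP[D1 D2] := kden_bounds t he hs'.
  have [a1 b1] := small_k t he hs'.
  have [_ /(_ s t hs')[_ _ a'1 b'1]] := hK.
  have ea : `|e * A' s t| <= `|e| * K by rewrite normrM ler_wpM2l.
  have eb : `|e * B' s t| <= `|e| * K by rewrite normrM ler_wpM2l.
  have D20 : 0 < kden e s t ^+ 2 by rewrite exprn_gt0//; lra.
  rewrite normrN /Q's normrM normfV (gtr0_norm D20) ler_pdivrMr//.
  have h0 : kden e s t ^+ 2 >= 9 / 16 by nra.
  have k80 : 0 <= `|e| * K <= 1 / 80 by rewrite he mulr_ge0// ltW.
  move: ea eb k80; set kk := `|e| * K; set x := e * A' s t; set y := e * B' s t.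
  move: a1 b1; rewrite -/A -/B; set a := e * A s t; set b := e * B s t => a1 b1 ea eb k80.
  apply: le_trans (_ : kk * (4/3) + (1/80) * (2 * (1/80) * kk + 4 * kk) <= _); last by nra.
  apply: le_trans (ler_normB _ _) _; apply: lerD.
    by rewrite normrM; apply: ler_pM => //; rewrite ger0_norm; lra.
  rewrite normrM; apply: ler_pM => //.
  apply: le_trans (ler_normD _ _) _; apply: lerD; rewrite normrM; apply: ler_pM => //.
    by move: a1; rewrite !ler_norml; lra.
  by move: b1; rewrite !ler_norml; lra.
have dN (s t : R) : s0 - 1 < s < s0 + 1 -> is_derive s 1 (fun s => - kre e s t) (- Q's s t).
  by move=> hs; exact: is_deriveN (dre s t hs).
have cN (s t : R) : s0 - 1 < s < s0 + 1 -> {for t, continuous (fun t => - kre e s t)}.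
  by move=> hs; exact: (@continuousN _ _ _ (kre e s) t (cre s t hs)).
have cQN (s t : R) : s0 - 1 < s < s0 + 1 -> {for t, continuous (fun t => - Q's s t)}.
  by move=> hs; exact: (@continuousN _ _ _ (Q's s) t (cQ s t hs)).
have lt1 : s0 - 1 < s0 - 3 / 4 by lra.
have [V HV] := potential (-1) lt1 dN dim cN cQN cim bQ.
exists V => s t hs ht; apply: HV => //; move: hs; rewrite ltr_norml; lra.
Qed.
End FirstIntegral.

(** * Second order expansion of the half return map *)

Section HalfMap.
Variable R : realType.
Variables (h : {poly R[i]}) (s0 K : R).
Hypothesis hK : kbound h s0 K.

Let K0 : 0 < K. Proof. by case: hK. Qed.

Section Level.
Variables (e : R) (V : R -> R -> R).
Hypotheses (he : `|e| * K <= 1 / 80) (hV : first_integral h s0 e V).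

Lemma level_mvt s s' t : `|s - s0| < 3 / 4 -> `|s' - s0| < 3 / 4 -> -1 < t ->
  exists2 c, Num.min s s' <= c <= Num.max s s' & V s' t - V s t = kim h e c t * (s' - s).
Proof.
move=> hs hs' ht; have [|c cb E] := @mvt R (V^~ t) (fun s => kim h e s t) s s'; last by exists c.
move=> x hx; apply: (hV _ ht).1; move: hs hs' hx; rewrite !ltr_norml.
by case: (ltP s s') => ?; lra.
Qed.

Let between s s' c : `|s - s0| < 3 / 4 -> `|s' - s0| < 3 / 4 ->
  Num.min s s' <= c <= Num.max s s' -> `|c - s0| <= 1.
Proof. by rewrite !ltr_norml ler_norml; case: (ltP s s') => ?; lra. Qed.

Lemma level_expand s s' t : `|s - s0| < 3 / 4 -> `|s' - s0| < 3 / 4 -> -1 < t ->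
  1 / 2 * `|s' - s| <= `|V s' t - V s t|.
Proof.
move=> hs hs' ht; have [c cb ->] := level_mvt hs hs' ht.
have /andP[h1 _] := kim_bounds hK t he (between hs hs' cb).
by rewrite normrM ler_wpM2r// (le_trans h1)// ler_norm.
Qed.

Lemma level_lt s s' t : `|s - s0| < 3 / 4 -> `|s' - s0| < 3 / 4 -> -1 < t ->
  s <= s' -> V s t + 1 / 2 * (s' - s) <= V s' t.
Proof.
move=> hs hs' ht ss; have [c cb E] := level_mvt hs hs' ht.
have /andP[h1 _] := kim_bounds hK t he (between hs hs' cb).
have : 0 <= (kim h e c t - 1 / 2) * (s' - s) by rewrite mulr_ge0 ?subr_ge0.
by lra.
Qed.

Lemma level_inj s s' t : `|s - s0| < 3 / 4 -> `|s' - s0| < 3 / 4 -> -1 < t ->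
  V s t = V s' t -> s = s'.
Proof.
move=> hs hs' ht E; have := level_expand hs hs' ht; rewrite E subrr normr0.
by rewrite pmulr_rle0 ?divr_gt0// normr_le0 subr_eq0 => /eqP.
Qed.

Lemma level_angle s t t' : `|s - s0| < 3 / 4 -> -1 < t -> -1 < t' ->
  `|V s t' - V s t| <= 2 * K * `|e| * `|t' - t|.
Proof.
move=> hs ht ht'; have [|c cb ->] := @mvt R (V s) (fun t => - kre h e s t) t t'.
  by move=> x hx; apply: (hV hs _).2; move: hx; case: (ltP t t') => ?; lra.
rewrite normrM normrN ler_wpM2r//; apply: (kre_bound hK c he).
by move: hs; rewrite ltr_norml ler_norml; lra.
Qed.

(** Turning by an angle at most [5] changes [V] by at most [2 K |e| * 5], and [V] grows in [s] at
    rate at least [1/2]: hence the factor [20]. The threshold [1 / 80] keeps the displacement below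
    [1/4], inside the strip where [V] is controlled. *)
Lemma level_exists s t t' : `|s - s0| < 1 / 2 -> -1 < t -> -1 < t' -> `|t' - t| <= 5 ->
  exists2 s', `|s' - s| <= 20 * K * `|e| & V s' t' = V s t.
Proof.
move=> hs ht ht' htt; set d := 20 * K * `|e|.
have d0 : 0 <= d by rewrite /d !mulr_ge0// ltW.
have d1 : d <= 1 / 4.
  by rewrite /d (_ : 20 * K * `|e| = 20 * (`|e| * K)); [move: he; lra|ring].
have hs1 x : `|x - s| <= d -> `|x - s0| < 3 / 4.
  by move: hs; rewrite ler_norml !ltr_norml; lra.
have [|x hx||c cb E] := @ivt_incr R (V^~ t') (s - d) (s + d) (V s t); first by lra.
- by apply: derive_cont (hV (hs1 x _) ht').1; rewrite ler_norml; lra.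
- have hss : `|s - s0| < 3 / 4 by apply: hs1; rewrite subrr normr0.
  have hm : `|s - d - s0| < 3 / 4 by apply: hs1; rewrite ler_norml; lra.
  have hp : `|s + d - s0| < 3 / 4 by apply: hs1; rewrite ler_norml; lra.
  have sm : s - d <= s by lra.
  have sp : s <= s + d by lra.
  have h1 := level_lt hm hss ht' sm.
  have h2 := level_lt hss hp ht' sp.
  have h3 := level_angle hss ht ht'.
  have h4 : 2 * K * `|e| * `|t' - t| <= 2 * K * `|e| * 5.
    by apply: ler_wpM2l => //; rewrite !mulr_ge0// ltW.
  by move: h3; rewrite ler_norml; move: h1 h2 h4; rewrite /d; lra.
- by exists c => //; rewrite ler_norml; lra.
Qed.

End Level.

Definition dhalf1 (s : R) : R := kb h s pi - kb h s 0.
Definition dhalf2 (s : R) : R := kdb h s pi * half1 h s + kb h s pi * dhalf1 s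
  + ((ka h s pi ^+ 2 - kb h s pi ^+ 2) - (ka h s 0 ^+ 2 - kb h s 0 ^+ 2)).

Lemma half1_derive (s : R) : is_derive s 1 (half1 h) (dhalf1 s).
Proof. exact: derive_sub (prim1_ds h s pi) (prim1_ds h s 0). Qed.

Lemma half2_derive (s : R) : is_derive s 1 (half2 h) (dhalf2 s).
Proof.
have d1 := derive_mul (kb_ds h s pi) (half1_derive s).
by apply: derive_eq (derive_add d1 (derive_sub (prim2_ds h s pi) (prim2_ds h s 0))) _.
Qed.

Let T : Type := R * R * R.
Let ee (x : T) := x.1.1.
Let ss (x : T) := x.1.2.
Let sg (x : T) := x.2.

(** A relation instead of a function: the expansions hold for every triple [(e, s, s')] in it, with
    constants independent of the first integral that witnesses it. *)
Definition half_map_graph e s s' := exists2 V, first_integral h s0 e V & V s' pi = V s 0.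

Let P (x : T) := [/\ `|ee x| * K <= 1 / 80, `|ee x| <= 1, `|ss x - s0| <= 1 / 4,
   `|sg x - s0| <= 1 / 2 & half_map_graph (ee x) (ss x) (sg x)].

Let Pe x : P x -> `|ee x| <= 1. Proof. by case. Qed.

Local Notation O := (@bigO R T P ee).
Local Notation EQ := (@eqO R T P ee).

Let inS x : P x -> `|ss x - s0| <= 1. Proof. by case=> _ _; rewrite !ler_norml; lra. Qed.
Let inG x : P x -> `|sg x - s0| <= 1. Proof. by case=> _ _ _; rewrite !ler_norml; lra. Qed.

Let bO (f : R -> R -> R) (t : R) (u : T -> R) : (forall x, P x -> `|u x - s0| <= 1) ->
  (exists C, forall s t : R, `|s - s0| <= 1 -> `|f s t| <= C) -> O 0 (fun x => f (u x) t).
Proof.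
by move=> hu [C H]; exists C => x Px; rewrite expr0 mulr1; apply: H; apply: hu.
Qed.

Let bka : exists C, forall s t : R, `|s - s0| <= 1 -> `|ka h s t| <= C.
Proof. by exists K => s t /(hK.2 _ t)[]. Qed.
Let bkb : exists C, forall s t : R, `|s - s0| <= 1 -> `|kb h s t| <= C.
Proof. by exists K => s t /(hK.2 _ t)[]. Qed.
Let bkda : exists C, forall s t : R, `|s - s0| <= 1 -> `|kda h s t| <= C.
Proof. by exists K => s t /(hK.2 _ t)[]. Qed.
Let bkdb : exists C, forall s t : R, `|s - s0| <= 1 -> `|kdb h s t| <= C.
Proof. by exists K => s t /(hK.2 _ t)[]. Qed.

Let invD t (u : T -> R) : (forall x, P x -> `|u x - s0| <= 1) ->
  O 0 (fun x => (kden h (ee x) (u x) t)^-1).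
Proof.
move=> hu; apply: (@bigO_inv R T P ee _ (3 / 4)); first by lra.
move=> x Px; have [he _ _ _ _] := Px.
by have /andP[h1 _] := kden_bounds hK t he (hu x Px); rewrite (le_trans h1)// ler_norm.
Qed.

(** Minus the imaginary part of [1 / (i + e k) = - i + e k + i e ^ 2 k ^ 2 + O(e ^ 3)]. *)
Let kim_exp t (u : T -> R) : (forall x, P x -> `|u x - s0| <= 1) ->
  EQ 3 (fun x => kim h (ee x) (u x) t)
       (fun x => 1 - ee x * kb h (u x) t - ee x ^+ 2 * (ka h (u x) t ^+ 2 - kb h (u x) t ^+ 2)).
Proof.
move=> hu; have a0 := bO t hu bka; have b0 := bO t hu bkb.
have m0 := bigO_add (bigO_mul a0 a0) (bigO_mul b0 b0).
have c0 := bigO_add (bigO_mul a0 a0) (bigO_opp (bigO_mul b0 b0)).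
(* The remainder is exactly [e ^ 3 * (b m + 2 b c + e c m) / kden], where [b = kb],
   [m = ka ^ 2 + kb ^ 2] and [c = ka ^ 2 - kb ^ 2]. *)
have n0 := bigO_add (bigO_add (bigO_mul b0 m0) (bigO_mul (bigO_const P ee 2) (bigO_mul b0 c0)))
   (bigO_le Pe (leq0n _) (bigO_mul (bigO_e P ee) (bigO_mul c0 m0))).
have := bigO_mul (bigO_mul (bigO_mul (bigO_e P ee) (bigO_mul (bigO_e P ee) (bigO_e P ee))) n0) (invD t hu).
apply: bigO_ext => x Px.
have D0 : kden h (ee x) (u x) t != 0.
  by have [he _ _ _ _] := Px; have := kden_bounds hK t he (hu x Px); lra.
by move: D0; rewrite /kim /kden => D0; field.
Qed.

Let lip (f df : R -> R -> R) (t : R) : (forall s t : R, is_derive s 1 (f^~ t) (df s t)) ->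
  (exists C, forall s t : R, `|s - s0| <= 1 -> `|df s t| <= C) ->
  exists C, forall s s' : R, `|s - s0| <= 1 -> `|s' - s0| <= 1 -> `|f s' t - f s t| <= C * `|s' - s|.
Proof.
move=> hd [C HC]; exists C => s s' hs hs'.
have [c cb ->] := @mvt R (f^~ t) (df^~ t) s s' (fun x _ => hd x t).
rewrite normrM ler_wpM2r//; apply: HC.
by move: hs hs' cb; rewrite !ler_norml; case: (ltP s s') => ?; lra.
Qed.

Lemma kre_exp : exists C, forall e s t : R, `|e| * K <= 1 / 80 -> `|e| <= 1 -> `|s - s0| <= 1 ->
  `|kre h e s t - (e * ka h s t - e ^+ 2 * (2 * (ka h s t * kb h s t)))| <= C * `|e| ^+ 3.
Proof.
(* The third component of the triple now stands for the angle, on which nothing is assumed. *)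
pose Q (x : T) := [/\ `|ee x| * K <= 1 / 80, `|ee x| <= 1 & `|ss x - s0| <= 1].
have Qe x : Q x -> `|ee x| <= 1 by case.
have a0 : bigO Q ee 0 (fun x => ka h (ss x) (sg x)).
  by exists K => x [_ _ /(hK.2 _ (sg x))[]]; rewrite expr0 mulr1.
have b0 : bigO Q ee 0 (fun x => kb h (ss x) (sg x)).
  by exists K => x [_ _ /(hK.2 _ (sg x))[]]; rewrite expr0 mulr1.
have iD : bigO Q ee 0 (fun x => (kden h (ee x) (ss x) (sg x))^-1).
  apply: (@bigO_inv R T Q ee _ (3 / 4)); first by lra.
  move=> x [he _ hs].
  by have /andP[h1 _] := kden_bounds hK (sg x) he hs; rewrite (le_trans h1)// ler_norm.
have m0 := bigO_add (bigO_mul a0 a0) (bigO_mul b0 b0).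
have n0 := bigO_mul a0 (bigO_add (bigO_add (bigO_mul (bigO_const Q ee 4) (bigO_mul b0 b0))
   (bigO_opp m0)) (bigO_mul (bigO_const Q ee 2)
     (bigO_le Qe (leq0n _) (bigO_mul (bigO_e Q ee) (bigO_mul b0 m0))))).
have [C H] := bigO_mul (bigO_mul (bigO_mul (bigO_e Q ee) (bigO_mul (bigO_e Q ee) (bigO_e Q ee))) n0) iD.
exists C => e s t he he1 hs; have := H (e, s, t) (And3 he he1 hs).
congr (`|_| <= _).
have D0 : kden h e s t != 0 by have := kden_bounds hK t he hs; lra.
by move: D0; rewrite /kre /kden /ee /ss /sg /= => D0; field.
Qed.

Let dprim2 s := prim2 h s pi - prim2 h s 0.

(** At fixed [s], the function [V + e * prim1 + e ^ 2 * prim2] has an angular derivative of order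
    [e ^ 3], so its increment over a half turn has that order too. *)
Lemma level_turn_exp : exists C, forall e s V, `|e| * K <= 1 / 80 -> `|e| <= 1 -> `|s - s0| <= 1 / 4 ->
  first_integral h s0 e V ->
  `|V s 0 - V s pi - (e * half1 h s + e ^+ 2 * dprim2 s)| <= C * `|e| ^+ 3.
Proof.
have [C HC] := kre_exp; exists (C * pi) => e s V he he1 hs hV.
have hs' : `|s - s0| < 3 / 4 by move: hs; rewrite ler_norml ltr_norml; lra.
have hs1 : `|s - s0| <= 1 by move: hs; rewrite !ler_norml; lra.
have p0 := pi_gt0 R.
pose F t := V s t + (e * prim1 h s t + e ^+ 2 * prim2 h s t).
have dF (t : R) : -1 < t -> is_derive t 1 F
    (- (kre h e s t - (e * ka h s t - e ^+ 2 * (2 * (ka h s t * kb h s t))))).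
  move=> ht; have d1 := derive_add (derive_scale e (prim1_dt h s t)) (derive_scale (e ^+ 2) (prim2_dt h s t)).
  by apply: derive_eq (derive_add (hV s t hs' ht).2 d1) _; ring.
have [|c cb E] := @mvt R F (fun t =>
   - (kre h e s t - (e * ka h s t - e ^+ 2 * (2 * (ka h s t * kb h s t))))) 0 pi.
  by move=> t; rewrite (min_idPl (ltW p0)) => /andP[t0 _]; apply: dF; lra.
have -> : V s 0 - V s pi - (e * half1 h s + e ^+ 2 * dprim2 s) = - (F pi - F 0).
  by rewrite /F /half1 /dprim2; ring.
rewrite E subr0 normrN normrM normrN (gtr0_norm p0) [C * pi * _]mulrAC; apply: ler_wpM2r; first exact: ltW.
exact: HC.
Qed.

Let sgS : O 1 (fun x => sg x - ss x).
Proof.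
exists (4 * K * pi) => x [he he1 hs hg [V hV E]].
have hs' : `|ss x - s0| < 3 / 4 by move: hs; rewrite ler_norml ltr_norml; lra.
have hg' : `|sg x - s0| < 3 / 4 by move: hg; rewrite ler_norml ltr_norml; lra.
have p0 := pi_gt0 R; have p1 : -1 < pi :> R by lra.
have n1 : -1 < 0 :> R by lra.
have := level_expand he hV hs' hg' p1; rewrite E.
have := level_angle he hV hs' p1 n1; rewrite sub0r normrN (gtr0_norm p0) expr1.
by lra.
Qed.

Let bprim1 (t : R) : exists C, forall s : R, `|s - s0| <= 1 -> `|prim1 h s t| <= C.
Proof.
have [|C H] := @lip (prim1 h) (kb h) t _ bkb; first by move=> *; exact: prim1_ds.
exists (`|C| + `|prim1 h s0 t|) => s hs.
rewrite -[prim1 h s t](subrK (prim1 h s0 t)); apply: le_trans (ler_normD _ _) _; rewrite lerD2r.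
apply: le_trans (H _ _ _ hs) _; first by rewrite subrr normr0.
by apply: le_trans (ler_wpM2r (normr_ge0 _) (ler_norm C)) _; rewrite ler_piMr.
Qed.

Let bprim2 (t : R) : exists C, forall s : R, `|s - s0| <= 1 -> `|prim2 h s t| <= C.
Proof.
have [||C H] := @lip (prim2 h) (fun s t => ka h s t ^+ 2 - kb h s t ^+ 2) t.
- by move=> *; exact: prim2_ds.
- exists (K ^+ 2 + K ^+ 2) => s u /(hK.2 _ u)[ha hb _ _].
  apply: le_trans (ler_normB _ _) _; rewrite !normrX.
  by apply: lerD; apply: lerXn2r => //; rewrite nnegrE ltW.
exists (`|C| + `|prim2 h s0 t|) => s hs.
rewrite -[prim2 h s t](subrK (prim2 h s0 t)); apply: le_trans (ler_normD _ _) _; rewrite lerD2r.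
apply: le_trans (H _ _ _ hs) _; first by rewrite subrr normr0.
by apply: le_trans (ler_wpM2r (normr_ge0 _) (ler_norm C)) _; rewrite ler_piMr.
Qed.

Let bdiff (f : R -> R -> R) : (forall t, exists C, forall s : R, `|s - s0| <= 1 -> `|f s t| <= C) ->
  O 0 (fun x => f (ss x) pi - f (ss x) 0).
Proof.
move=> H; have [C HC] := H pi; have [C' HC'] := H 0.
by apply: bigO_add; [exists C|apply: bigO_opp; exists C'] => x Px;
   rewrite expr0 mulr1; [apply: HC|apply: HC']; exact: inS.
Qed.

Let kddb := etrig (shift_exp R 1) (size h)
  (fun j => shift_exp R 1 j * (shift_exp R 1 j * imC h j))
  (fun j => shift_exp R 1 j * (- (shift_exp R 1 j * reC h j))).

Let kdb_ds (s t : R) : is_derive s 1 (fun s => kdb h s t) (kddb s t).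
Proof. exact: etrig_ds. Qed.

Let bkddb : exists C, forall s t : R, `|s - s0| <= 1 -> `|kddb s t| <= C.
Proof. by have [C _ H] := etrig_bound (shift_exp R 1) (size h) (fun j => shift_exp R 1 j * (shift_exp R 1 j * imC h j))
  (fun j => shift_exp R 1 j * (- (shift_exp R 1 j * reC h j))) s0; exists C. Qed.

(** The quotient [kim s 0 / kim s' pi] is the derivative of the half return map, by implicit
    differentiation of [V s' pi = V s 0]. Both expansions are needed: values locate the intersection
    of the two graphs, derivatives show that it is transversal. *)
Lemma half_map_exp : exists C, forall e s s', `|e| * K <= 1 / 80 -> `|e| <= 1 ->
  `|s - s0| <= 1 / 4 -> `|s' - s0| <= 1 / 2 -> half_map_graph e s s' ->
  `|s' - s - (e * half1 h s + e ^+ 2 * half2 h s)| <= C * `|e| ^+ 3 /\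
  `|kim h e s 0 / kim h e s' pi - (1 + e * dhalf1 s + e ^+ 2 * dhalf2 s)| <= C * `|e| ^+ 3.
Proof.
have p0 := pi_gt0 R; have p1 : -1 < pi :> R by lra.
have inc (x : T) c : P x -> Num.min (ss x) (sg x) <= c <= Num.max (ss x) (sg x) ->
    `|c - s0| <= 1 /\ `|c - ss x| <= `|sg x - ss x|.
  move=> [_ _ hs hg _] cb; split.
    by move: hs hg cb; rewrite !ler_norml; case: (ltP (ss x) (sg x)) => ?; lra.
  move: cb; case: (ltP (ss x) (sg x)) => hlt cb.
    by rewrite !ger0_norm; lra.
  by rewrite !ler0_norm; lra.
(* The mean value point between [s] and [s'] is chosen as a function of the triple, so that the
   remainder calculus applies to it. *)
have [c cP] : exists c : T -> R, forall x, P x -> [/\ `|c x - s0| <= 1, `|c x - ss x| <= `|sg x - ss x| &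
   exists V, [/\ first_integral h s0 (ee x) V, V (sg x) pi = V (ss x) 0 &
     V (sg x) pi - V (ss x) pi = kim h (ee x) (c x) pi * (sg x - ss x)]].
  suff /choice[c H] : forall x : T, exists c, P x -> [/\ `|c - s0| <= 1, `|c - ss x| <= `|sg x - ss x| &
     exists V, [/\ first_integral h s0 (ee x) V, V (sg x) pi = V (ss x) 0 &
     V (sg x) pi - V (ss x) pi = kim h (ee x) c pi * (sg x - ss x)]] by exists c.
  move=> x; have [Px|nPx] := pselect (P x); last by exists 0.
  have [he he1 hs hg [V hV E]] := Px.
  have hs' : `|ss x - s0| < 3 / 4 by move: hs; rewrite ler_norml ltr_norml; lra.
  have hg' : `|sg x - s0| < 3 / 4 by move: hg; rewrite ler_norml ltr_norml; lra.
  have [c cb Ec] := level_mvt hV hs' hg' p1.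
  by exists c => _; have [c1 c2] := inc x c Px cb; split => //; exists V.
have inC x : P x -> `|c x - s0| <= 1 by move=> /cP[].
have b0 := bO pi inS bkb; have db0 := bO pi inS bkdb; have a0 := bO pi inS bka.
have b00 := bO 0 inS bkb; have a00 := bO 0 inS bka.
have cS : O 1 (fun x => c x - ss x).
  have [C H] := sgS; exists C => x Px; have [_ h1 _] := cP x Px.
  exact: le_trans h1 (H x Px).
have lipO (f df : R -> R -> R) (u : T -> R) : (forall s t : R, is_derive s 1 (f^~ t) (df s t)) ->
    (exists C, forall s t : R, `|s - s0| <= 1 -> `|df s t| <= C) ->
    (forall x, P x -> `|u x - s0| <= 1) -> O 1 (fun x => u x - ss x) ->
    EQ 1 (fun x => f (u x) pi) (fun x => f (ss x) pi).
  move=> hd hb hu [C HC]; have [C' HC'] := @lip f df pi hd hb.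
  exists (`|C'| * C) => x Px; apply: le_trans (HC' _ _ (inS Px) (hu x Px)) _.
  apply: le_trans (ler_wpM2r (normr_ge0 _) (ler_norm C')) _.
  by rewrite -mulrA ler_wpM2l//; exact: HC.
have b1c := lipO _ _ c (fun s t => kb_ds h s t) bkdb inC cS.
have kc : EQ 2 (fun x => kim h (ee x) (c x) pi) (fun x => 1 - ee x * kb h (ss x) pi).
  have k1 := eqO_le Pe (ltnW (leqnn 3)) (kim_exp pi inC).
  have ac := bO pi inC bka; have bc := bO pi inC bkb.
  have q1 : O 2 (fun x => ee x ^+ 2 * (ka h (c x) pi ^+ 2 - kb h (c x) pi ^+ 2)).
    have := bigO_mul (bigO_mul (bigO_e P ee) (bigO_e P ee))
      (bigO_add (bigO_mul ac ac) (bigO_opp (bigO_mul bc bc))).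
    by apply: bigO_ext => x _; ring.
  have := bigO_add (bigO_add k1 (bigO_opp q1)) (bigO_opp (eqO_e b1c)).
  by apply: bigO_ext => x _; ring.
have turn : EQ 3 (fun x => kim h (ee x) (c x) pi * (sg x - ss x))
    (fun x => ee x * half1 h (ss x) + ee x ^+ 2 * dprim2 (ss x)).
  have [C HC] := level_turn_exp; exists C => x Px; have [he he1 hs hg _] := Px.
  have [_ _ [V [hV E <-]]] := cP x Px; rewrite E; exact: HC.
(* Replacing the slope at [c] by its first order value at [s] leaves an error [O(e ^ 2)], and the
   factor [s' - s = O(e)] supplies the missing order. The equation is then solved for [s' - s], to
   order two in [sg2] and to order three in [val]. *)
have sg3 : EQ 3 (fun x => (1 - ee x * kb h (ss x) pi) * (sg x - ss x))
    (fun x => ee x * half1 h (ss x) + ee x ^+ 2 * dprim2 (ss x)).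
  have := bigO_add (bigO_opp (bigO_mul kc sgS)) turn.
  by apply: bigO_ext => x _; ring.
have q0 : O 0 (fun x => dprim2 (ss x)) := bdiff bprim2.
have sg2 : EQ 2 (fun x => sg x - ss x) (fun x => ee x * half1 h (ss x)).
  have := bigO_add (bigO_add (bigO_le Pe (ltnW (leqnn 3)) sg3) (bigO_mul (bigO_mul (bigO_e P ee) b0) sgS))
    (bigO_mul (bigO_mul (bigO_e P ee) (bigO_e P ee)) q0).
  by apply: bigO_ext => x _; ring.
have val : EQ 3 (fun x => sg x - ss x)
   (fun x => ee x * half1 h (ss x) + ee x ^+ 2 * half2 h (ss x)).
  have := bigO_add sg3 (bigO_mul (bigO_mul (bigO_e P ee) b0) sg2).
  by apply: bigO_ext => x _; rewrite /half2 -/(dprim2 (ss x)); ring.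
have cO : O 0 (fun x => ka h (ss x) pi ^+ 2 - kb h (ss x) pi ^+ 2).
  by have := bigO_add (bigO_mul a0 a0) (bigO_opp (bigO_mul b0 b0)); apply: bigO_ext => x _; ring.
have c0O : O 0 (fun x => ka h (ss x) 0 ^+ 2 - kb h (ss x) 0 ^+ 2).
  by have := bigO_add (bigO_mul a00 a00) (bigO_opp (bigO_mul b00 b00)); apply: bigO_ext => x _; ring.
have uO : O 0 (fun x => half1 h (ss x)) := bdiff bprim1.
have u'O : O 0 (fun x => dhalf1 (ss x)) by exact: bigO_add b0 (bigO_opp b00).
have v'O : O 0 (fun x => dhalf2 (ss x)).
  exact: bigO_add (bigO_add (bigO_mul db0 uO) (bigO_mul b0 u'O)) (bigO_add cO (bigO_opp c0O)).
(* In the slope at [s'], [kb] is multiplied by [e] and so needs its first correction, whereas the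
   squares are multiplied by [e ^ 2] and are needed only at leading order. *)
have b2 : EQ 2 (fun x => kb h (sg x) pi)
   (fun x => kb h (ss x) pi + ee x * (kdb h (ss x) pi * half1 h (ss x))).
  have t2 : EQ 2 (fun x => kb h (sg x) pi)
     (fun x => kb h (ss x) pi + kdb h (ss x) pi * (sg x - ss x)).
    have [C1 H1] := @lip (kdb h) (kddb) pi kdb_ds bkddb.
    have [C2 H2] := sgS; exists (`|C1| * (C2 * C2)) => x Px.
    have [c' cb E] := @mvt R (fun s => kb h s pi) (fun s => kdb h s pi) (ss x) (sg x)
      (fun s _ => kb_ds h s pi).
    have [c1 c2] := inc x c' Px cb.
    rewrite opprD addrA E -mulrBl normrM.
    have h1 : `|kdb h c' pi - kdb h (ss x) pi| <= `|C1| * `|sg x - ss x|.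
      apply: le_trans (H1 _ _ (inS Px) c1) _.
      apply: le_trans (ler_wpM2r (normr_ge0 _) (ler_norm C1)) _.
      by apply: ler_wpM2l.
    apply: le_trans (ler_wpM2r (normr_ge0 _) h1) _.
    rewrite -!mulrA ler_wpM2l// mulrA expr2 mulrACA.
    by have := H2 x Px; rewrite expr1 => h2; apply: ler_pM.
  have := bigO_add t2 (bigO_mul db0 sg2); apply: bigO_ext => x _; ring.
have a1 := lipO _ _ sg (fun s t => ka_ds h s t) bkda inG sgS.
have b1 := lipO _ _ sg (fun s t => kb_ds h s t) bkdb inG sgS.
have ag := bO pi inG bka; have bg := bO pi inG bkb.
have c1 : EQ 1 (fun x => ka h (sg x) pi ^+ 2 - kb h (sg x) pi ^+ 2)
    (fun x => ka h (ss x) pi ^+ 2 - kb h (ss x) pi ^+ 2).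
  have := bigO_add (bigO_mul (bigO_add ag a0) a1) (bigO_opp (bigO_mul (bigO_add bg b0) b1)).
  by apply: bigO_ext => x _; ring.
pose w x := kdb h (ss x) pi * half1 h (ss x) + (ka h (ss x) pi ^+ 2 - kb h (ss x) pi ^+ 2).
have wO : O 0 w by exact: bigO_add (bigO_mul db0 uO) cO.
have kg : EQ 3 (fun x => kim h (ee x) (sg x) pi)
    (fun x => 1 - ee x * kb h (ss x) pi - ee x ^+ 2 * w x).
  have := bigO_add (bigO_add (kim_exp pi inG) (bigO_opp (eqO_e b2))) (bigO_opp (eqO_e (eqO_e c1))).
  by apply: bigO_ext => x _; rewrite /w; ring.
have YO : O 0 (fun x => 1 + ee x * dhalf1 (ss x) + ee x ^+ 2 * dhalf2 (ss x)).
  have := bigO_add (bigO_add (bigO_const P ee 1) (bigO_le Pe (leq0n _) (bigO_mul (bigO_e P ee) u'O)))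
    (bigO_le Pe (leq0n _) (bigO_mul (bigO_mul (bigO_e P ee) (bigO_e P ee)) v'O)).
  by apply: bigO_ext => x _; ring.
have ik : O 0 (fun x => (kim h (ee x) (sg x) pi)^-1).
  apply: (@bigO_inv R T P ee _ (1 / 2)); first by lra.
  move=> x Px; have [he _ _ _ _] := Px.
  by have /andP[h1 _] := kim_bounds hK pi he (inG Px); rewrite (le_trans h1)// ler_norm.
(* The comparison is made after clearing the denominator, which is at least [1/2]; [r3] collects the
   terms of order three and more in the product of the two expansions. *)
have num : O 3 (fun x => kim h (ee x) (ss x) 0 -
    kim h (ee x) (sg x) pi * (1 + ee x * dhalf1 (ss x) + ee x ^+ 2 * dhalf2 (ss x))).
  have r3 : O 3 (fun x => ee x ^+ 3 * (kb h (ss x) pi * dhalf2 (ss x) + w x * dhalf1 (ss x)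
      + ee x * (w x * dhalf2 (ss x)))).
    have := bigO_mul (bigO_mul (bigO_e P ee) (bigO_mul (bigO_e P ee) (bigO_e P ee)))
      (bigO_add (bigO_add (bigO_mul b0 v'O) (bigO_mul wO u'O))
        (bigO_le Pe (leq0n _) (bigO_mul (bigO_e P ee) (bigO_mul wO v'O)))).
    by apply: bigO_ext => x _; ring.
  have := bigO_add (bigO_add (kim_exp 0 inS) (bigO_opp (bigO_mul kg YO))) r3.
  by apply: bigO_ext => x _; rewrite /w /dhalf2 /dhalf1; ring.
have der : EQ 3 (fun x => kim h (ee x) (ss x) 0 / kim h (ee x) (sg x) pi)
    (fun x => 1 + ee x * dhalf1 (ss x) + ee x ^+ 2 * dhalf2 (ss x)).
  have := bigO_mul num ik; apply: bigO_ext => x Px; have [he _ _ _ _] := Px.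
  have k0 : kim h (ee x) (sg x) pi != 0 by have := kim_bounds hK pi he (inG Px); lra.
  by field.
have [C1 H1] := val; have [C2 H2] := der.
exists (Num.max C1 C2) => e s s' he he1 hs hs' hg.
have Px : P (e, s, s') by split.
split; [apply: le_trans (H1 _ Px) _|apply: le_trans (H2 _ Px) _];
  by apply: ler_wpM2r; rewrite ?exprn_ge0// le_max lexx ?orbT.
Qed.

End HalfMap.

Section HalfMapFunction.
Variable R : realType.
Variables (h : {poly R[i]}) (s0 K : R).
Hypothesis hK : kbound h s0 K.
Variables (e : R) (V : R -> R -> R).
Hypotheses (he : `|e| * K <= 1 / 80) (hV : first_integral h s0 e V).

Let K0 : 0 < K. Proof. by case: hK. Qed.

Lemma pi_le5 : pi <= 5 :> R.
Proof. by have /andP[_ h1] := pihalf_02 R; lra. Qed.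

Lemma half_map_exists : exists sg : R -> R, forall s, `|s - s0| <= 1 / 4 ->
  [/\ `|sg s - s| <= 20 * K * `|e|, `|sg s - s0| <= 1 / 2 & V (sg s) pi = V s 0].
Proof.
suff /choice[sg H] : forall s : R, exists s', `|s - s0| <= 1 / 4 ->
  [/\ `|s' - s| <= 20 * K * `|e|, `|s' - s0| <= 1 / 2 & V s' pi = V s 0] by exists sg.
move=> s; have [hs|] := leP `|s - s0| (1 / 4); last by exists 0.
have p0 := pi_gt0 R; have p5 := pi_le5.
have [||||s' h1 h2] := @level_exists R h s0 K hK e V he hV s 0 pi.
- by move: hs; rewrite ler_norml ltr_norml; lra.
- lra.
- lra.
- by rewrite subr0 gtr0_norm.
exists s' => _; split=> //.
have d1 : 20 * K * `|e| <= 1 / 4.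
  by rewrite (_ : 20 * K * `|e| = 20 * (`|e| * K)); [move: he; lra|ring].
by move: h1 hs; rewrite !ler_norml; lra.
Qed.

Lemma half_map_lip (sg : R -> R) : (forall s, `|s - s0| <= 1 / 4 ->
    [/\ `|sg s - s| <= 20 * K * `|e|, `|sg s - s0| <= 1 / 2 & V (sg s) pi = V s 0]) ->
  forall s s', `|s - s0| <= 1 / 4 -> `|s' - s0| <= 1 / 4 ->
  `|sg s' - sg s| <= 4 * `|s' - s|.
Proof.
move=> H s s' hs hs'; have [_ g1 E1] := H s hs; have [_ g2 E2] := H s' hs'.
have p0 := pi_gt0 R; have p1 : -1 < pi :> R by lra.
have n1 : -1 < 0 :> R by lra.
have i1 x : `|x - s0| <= 1 / 2 -> `|x - s0| < 3 / 4 by lra.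
have i2 x : `|x - s0| <= 1 / 4 -> `|x - s0| < 3 / 4 by lra.
have := level_expand hK he hV (i1 _ g1) (i1 _ g2) p1; rewrite E1 E2.
have [c cb ->] := level_mvt hV (i2 _ hs) (i2 _ hs') n1.
have hc : `|c - s0| <= 1.
  by move: hs hs' cb; rewrite !ler_norml; case: (ltP s s') => ?; lra.
have /andP[k1 k2] := kim_bounds hK 0 he hc.
have : `|kim h e c 0 * (s' - s)| <= 2 * `|s' - s|.
  by rewrite normrM ler_wpM2r// ger0_norm//; lra.
by lra.
Qed.

End HalfMapFunction.

Lemma lip_cont (R : realType) (f : R -> R) (x r C : R) : 0 < r ->
  (forall y, `|y - x| < r -> `|f y - f x| <= C * `|y - x|) -> {for x, continuous f}.
Proof.
move=> r0 H; apply/contP => e e0.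
have c0 : 0 < `|C| + 1 by rewrite ltr_pwDr.
exists (Num.min r (e / (`|C| + 1))); first by rewrite lt_min r0 divr_gt0.
move=> y; rewrite lt_min ltr_pdivlMr// => /andP[y1 y2].
apply: le_lt_trans (H y y1) _; apply: le_lt_trans y2.
rewrite [leRHS]mulrC ler_wpM2r//; have := ler_norm C; lra.
Qed.

Lemma sqr_absr (R : realType) (x : R) : `|x| ^+ 2 = x ^+ 2.
Proof. by rewrite real_normK// num_real. Qed.

(** * Transversal intersection of the two half return maps near a simple zero *)

Section FixedPoint.
Variable R : realType.
Variables (h g : {poly R[i]}) (s0 K : R).
Hypotheses (hK : kbound h s0 K) (gK : kbound g s0 K).

Let K0 : 0 < K. Proof. by case: hK. Qed.

Lemma kbound_le (f : {poly R[i]}) K1 K2 : K1 <= K2 -> kbound f s0 K1 -> kbound f s0 K2.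
Proof.
move=> K12 [K10 H]; split=> [|s t /(H s t)[]]; first exact: lt_le_trans K12.
by split; apply: le_trans K12.
Qed.

Lemma fixed_point l (m dm : R -> R) C : (forall s, is_derive (s : R) 1 m (dm s)) ->
  {for s0, continuous dm} -> m s0 = 0 -> dm s0 != 0 ->
  (forall e s s1 s2, `|e| * K <= 1 / 80 -> `|e| <= 1 -> `|s - s0| <= 1 / 4 ->
    `|s1 - s0| <= 1 / 2 -> `|s2 - s0| <= 1 / 2 ->
    half_map_graph h s0 e s s1 -> half_map_graph g s0 e s s2 ->
    `|s1 - s2 - e ^+ l * m s| <= C * `|e| ^+ l.+1 /\
    `|kim h e s 0 / kim h e s1 pi - kim g e s 0 / kim g e s2 pi - e ^+ l * dm s|
       <= C * `|e| ^+ l.+1) ->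
  exists2 e1, 0 < e1 & exists C', forall e, 0 < `|e| < e1 -> `|e| * K <= 1 / 80 /\
    forall V W, first_integral h s0 e V -> first_integral g s0 e W ->
    exists s s', [/\ `|s - s0| <= C' * `|e|, `|s' - s| <= C' * `|e|,
      V s' pi = V s 0, W s' pi = W s 0 &
      kim h e s 0 * kim g e s' pi != kim g e s 0 * kim h e s' pi].
Proof.
move=> dmP cm m0 dm0 HC.
pose c := `|dm s0| / 2; have c0 : 0 < c by rewrite divr_gt0 ?normr_gt0.
have /contP/(_ _ c0)[k k0 Hk] := cm.
pose C1 := `|C| + 1; have C10 : 0 < C1 by rewrite ltr_pwDr.
have CC1 : C <= C1 by rewrite /C1; have := ler_norm C; lra.
(* At distance [D * |e|] from [s0] the size of [m] is at least [c * D * |e| = C1 * |e|], which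
   compensates the remainder; [c] is half of [|dm s0|], and [dm] keeps at least that size within
   distance [k]. *)
pose D := C1 / c; have D0 : 0 < D by rewrite divr_gt0.
exists (Num.min (Num.min 1 (1 / 80 / K)) (Num.min (k / D) (Num.min (1 / 8 / D) (c / C1)))).
  have p1 : 0 < 1 / 80 / K by rewrite divr_gt0.
  have p2 : 0 < k / D by rewrite divr_gt0.
  have p3 : 0 < 1 / 8 / D by rewrite divr_gt0.
  have p4 : 0 < c / C1 by rewrite divr_gt0.
  by rewrite !lt_min ltr01 p1 p2 p3.
exists (D + 20 * K) => e; rewrite !lt_min => /andP[e0 /and3P[/andP[e1 eK] ek /andP[e8 ec]]].
have heK : `|e| * K <= 1 / 80 by rewrite -ler_pdivlMr// ltW.
split=> // V W hV hW; have he1 := ltW e1.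
have {}ek : D * `|e| < k by rewrite mulrC -ltr_pdivlMr.
have {}e8 : D * `|e| < 1 / 8 by rewrite mulrC -ltr_pdivlMr.
have {}ec : C1 * `|e| < c by rewrite mulrC -ltr_pdivlMr.
have De0 : 0 < D * `|e| by rewrite mulr_gt0.
have cD : c * (D * `|e|) = C1 * `|e| by rewrite /D; field; rewrite gt_eqF.
have [sg sgP] := half_map_exists hK heK hV.
have [tg tgP] := half_map_exists gK heK hW.
have sgL := half_map_lip hK heK hV sgP.
have tgL := half_map_lip gK heK hW tgP.
have HE s : `|s - s0| <= 1 / 4 -> `|sg s - tg s - e ^+ l * m s| <= C1 * `|e| ^+ l.+1 /\
    `|kim h e s 0 / kim h e (sg s) pi - kim g e s 0 / kim g e (tg s) pi - e ^+ l * dm s|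
       <= C1 * `|e| ^+ l.+1.
  move=> hs; have [_ g1 E1] := sgP s hs; have [_ g2 E2] := tgP s hs.
  have [h1 h2] := HC e s (sg s) (tg s) heK he1 hs g1 g2 (ex_intro2 _ _ V hV E1) (ex_intro2 _ _ W hW E2).
  by split; [apply: le_trans h1 _|apply: le_trans h2 _]; rewrite ler_wpM2r// exprn_ge0.
have [s hs Es] : exists2 s, `|s - s0| <= D * `|e| & sg s = tg s.
  pose q := e ^+ l * dm s0.
  have q2 : q * q = `|e| ^+ l * `|e| ^+ l * (dm s0 * dm s0).
    by rewrite -normrX -[`|_| * `|_|]expr2 sqr_absr /q; ring.
  have nq : `|q| = `|e| ^+ l * `|dm s0| by rewrite normrM normrX.
  have main s : `|s - s0| = D * `|e| -> 0 <= q * (sg s - tg s) * (s - s0).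
    move=> hs; have hs4 : `|s - s0| <= 1 / 4 by rewrite hs; lra.
    have [h1 _] := HE s hs4.
    have [x xb Ex] := @mvt R m dm s0 s (fun x _ => dmP x).
    rewrite m0 subr0 in Ex.
    have hx : `|x - s0| < k.
      apply: le_lt_trans ek; rewrite -hs.
      move: xb; case: (ltP s0 s) => hlt xb; first by rewrite !ger0_norm; lra.
      by rewrite !ler0_norm; lra.
    have hdm := Hk _ hx.
    pose E := sg s - tg s - e ^+ l * m s.
    have -> : q * (sg s - tg s) * (s - s0) = e ^+ l * e ^+ l * (dm s0 * dm x) * (s - s0) ^+ 2
        + q * E * (s - s0) by rewrite /E Ex /q; ring.
    have ddx : 2 * c * c <= dm s0 * dm x.
      have h2 : `|dm s0 * (dm x - dm s0)| <= 2 * c * c.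
        by rewrite normrM /c; apply: ler_pM => //; [lra|exact: ltW].
      have h3 : dm s0 * dm s0 = 4 * c * c.
        by rewrite /c -expr2 -sqr_absr; field.
      by move: h2; rewrite ler_norml; lra.
    have -> : e ^+ l * e ^+ l = `|e| ^+ l * `|e| ^+ l.
      by rewrite -normrX -[RHS]expr2 sqr_absr expr2.
    have -> : (s - s0) ^+ 2 = (D * `|e|) * (D * `|e|) by rewrite -expr2 -hs sqr_absr.
    have L0 : 0 < `|e| ^+ l by rewrite exprn_gt0.
    have h4 : `|q * E * (s - s0)| <= `|e| ^+ l * (2 * c) * (C1 * (`|e| * `|e| ^+ l)) * (D * `|e|).
      rewrite [leLHS]normrM [`|q * E|]normrM hs; apply: ler_wpM2r; first exact: ltW.
      apply: ler_pM => //; last by rewrite -exprS.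
      by rewrite nq ler_wpM2l ?exprn_ge0// /c; lra.
    have h5 : `|e| ^+ l * `|e| ^+ l * (2 * c * c) * (D * `|e| * (D * `|e|)) <=
        `|e| ^+ l * `|e| ^+ l * (dm s0 * dm x) * (D * `|e| * (D * `|e|)).
      rewrite ler_wpM2r//; first by rewrite mulr_ge0// ltW.
      by rewrite ler_wpM2l// mulr_ge0// ltW.
    have h6 : `|e| ^+ l * `|e| ^+ l * (2 * c * c) * (D * `|e| * (D * `|e|)) =
      `|e| ^+ l * (2 * c) * (C1 * (`|e| * `|e| ^+ l)) * (D * `|e|).
      have -> : C1 * (`|e| * `|e| ^+ l) = c * (D * `|e|) * `|e| ^+ l by rewrite cD; ring.
      by ring.
    by move: h4; rewrite ler_norml; lra.
  pose F s := q * (sg s - tg s).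
  have cF s : s0 - D * `|e| <= s <= s0 + D * `|e| -> {for s, continuous F}.
    move=> hs.
    have near y : `|y - s| < 1 / 8 -> `|y - s0| <= 1 / 4.
      by rewrite ltr_norml ler_norml; lra.
    have hs4 : `|s - s0| <= 1 / 4 by apply: near; rewrite subrr normr0; lra.
    apply: (@lip_cont R F s (1 / 8) (`|q| * 8)); first by lra.
    move=> y /near hy; have h1 := sgL _ _ hs4 hy; have h2 := tgL _ _ hs4 hy.
    rewrite /F -mulrBr normrM -mulrA ler_wpM2l//.
    have -> : sg y - tg y - (sg s - tg s) = (sg y - sg s) - (tg y - tg s) by ring.
    by apply: le_trans (ler_normB _ _) _; lra.
  have [|||s hs Fs] := @ivt_incr R F (s0 - D * `|e|) (s0 + D * `|e|) 0.
  - by lra.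
  - exact: cF.
  - have m1 := main (s0 - D * `|e|); have m2 := main (s0 + D * `|e|).
    move: m1 m2; rewrite ![s0 + _]addrC !addrK normrN gtr0_norm// => /(_ erefl) m1 /(_ erefl) m2.
    apply/andP; split.
      by move: m1; rewrite addrC mulrN oppr_ge0 pmulr_lle0.
    by move: m2; rewrite pmulr_lge0// addrC.
  exists s; first by rewrite ler_norml; lra.
  have q0 : q != 0 by rewrite mulf_neq0// expf_neq0// -normr_gt0.
  by move: Fs => /eqP; rewrite mulf_eq0 (negbTE q0) subr_eq0 => /eqP.
have hs4 : `|s - s0| <= 1 / 4 by lra.
have [g0 g1 E1] := sgP s hs4; have [_ g2 E2] := tgP s hs4.
exists s, (sg s); split=> //.
- by apply: le_trans hs _; rewrite ler_wpM2r// lerDl mulr_ge0// ltW.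
- by apply: le_trans g0 _; rewrite ler_wpM2r// lerDr ltW.
- by rewrite Es.
(* Equal derivatives would leave [|dm s| <= C1 * |e| < c], whereas [|dm s| > c] this close to
   [s0]. *)
have [_] := HE s hs4; rewrite -Es.
have in1 : `|sg s - s0| <= 1 by lra.
have hk := kim_bounds hK pi heK in1; have gk := kim_bounds gK pi heK in1.
have hk0 : kim h e (sg s) pi != 0 by lra.
have gk0 : kim g e (sg s) pi != 0 by lra.
move=> h1; apply/eqP => h2; move: h1.
have -> : kim h e s 0 / kim h e (sg s) pi = kim g e s 0 / kim g e (sg s) pi.
  by apply: (mulIf hk0); rewrite divfK// mulrAC; apply: (mulIf gk0); rewrite divfK.
rewrite subrr sub0r normrN normrM normrX exprS.
have L0 : 0 < `|e| ^+ l by rewrite exprn_gt0.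
rewrite mulrA [leLHS]mulrC ler_pM2r// leNgt => /negP; apply.
apply: lt_trans ec _.
have hk' : `|s - s0| < k by apply: le_lt_trans hs ek.
have := Hk _ hk'; have := ler_normD (dm s) (dm s0 - dm s).
by rewrite addrC subrK (distrC (dm s)) /c; lra.
Qed.

End FixedPoint.

(** * Filippov solutions in an annulus *)

Section Polar.
Local Open Scope classical_set_scope.
Local Open Scope complex_scope.
Variable R : realType.
Implicit Types (z w : R[i]).
Local Notation normc := (@ComplexField.Normc.normc R).
Local Notation Re := (@complex.Re R).
Local Notation Im := (@complex.Im R).

Lemma normcE z : normc z = Num.sqrt (Re z ^+ 2 + Im z ^+ 2).
Proof. by case: z. Qed.

Lemma normc_ge0 z : 0 <= normc z.
Proof. by rewrite normcE sqrtr_ge0. Qed.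

Lemma normc_sqr z : normc z ^+ 2 = Re z ^+ 2 + Im z ^+ 2.
Proof. by rewrite normcE sqr_sqrtr// addr_ge0 ?sqr_ge0. Qed.

Lemma normc_Re z : `|Re z| <= normc z.
Proof. by rewrite normcE -sqrtr_sqr ler_wsqrtr// lerDl sqr_ge0. Qed.

Lemma normc_conj z : normc z^* = normc z.
Proof. by rewrite !normcE; case: z => x y /=; rewrite sqrrN. Qed.

Lemma normc_polar (r t : R) : 0 <= r -> normc (r%:C * cis t) = r.
Proof.
move=> r0; rewrite normcE /= !mul0r subr0 addr0 !exprMn -mulrDr cos2Dsin2 mulr1.
by rewrite sqrtr_sqr ger0_norm.
Qed.

(** The argument with values in [[0, pi]], correct in the closed upper half-plane only; points below
    the axis are conjugated first. *)
Definition argz z := acos (Re z / normc z).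

Lemma argz_dom z : -1 <= Re z / normc z <= 1.
Proof.
have [->|z0] := eqVneq (normc z) 0; first by rewrite invr0 mulr0; lra.
have zp : 0 < normc z by rewrite lt_def z0 normc_ge0.
by rewrite ler_pdivlMr// ler_pdivrMr// mulN1r mul1r -ler_norml normc_Re.
Qed.

Lemma polarE z : 0 < normc z -> 0 <= Im z -> z = (normc z)%:C * cis (argz z).
Proof.
move=> z0 y0; have zn : normc z != 0 by rewrite gt_eqF.
apply/eqP; rewrite eq_complex /= !mul0r subr0 addr0 /argz acosK ?in_itv ?argz_dom//=.
rewrite sin_acos ?argz_dom// mulrCA mulfV// mulr1 eqxx /=; apply/eqP.
rewrite -[LHS]ger0_norm// -{1}(ger0_norm (normc_ge0 z)) -!sqrtr_sqr -sqrtrM ?sqr_ge0//.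
by congr Num.sqrt; rewrite exprMn exprVn mulrBr mulr1 mulrCA mulfV ?expf_neq0// mulr1 normc_sqr; ring.
Qed.

Lemma argz_bounds z : 0 <= argz z <= pi.
Proof. by rewrite acos_ge0 ?argz_dom// acos_lepi ?argz_dom. Qed.

(** Continuity relative to [[-1, 1]]. The endpoints are the crossings of the real axis; there the
    bound comes from the monotonicity of the cosine, the endpoint [-1] being reflected to [1]. *)
Lemma acos_within (u0 : R) : -1 <= u0 <= 1 -> forall e, 0 < e -> exists2 d, 0 < d &
  forall u, -1 <= u <= 1 -> `|u - u0| < d -> `|acos u - acos u0| < e.
Proof.
have right e : 0 < e -> exists2 d, 0 < d & forall u : R, -1 <= u <= 1 -> 1 - d < u -> acos u < e.
  move=> e0; have p0 := pi_gt0 R.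
  pose e' := Num.min e (pi / 2).
  have e'0 : 0 < e' by rewrite lt_min e0 divr_gt0.
  have e'p : e' <= pi by apply: le_trans (_ : pi / 2 <= _); [rewrite ge_min lexx orbT|lra].
  exists (1 - cos e').
    rewrite subr_gt0 -cos0 ltr_cos// in_itv /=; first by rewrite lexx ltW.
    by rewrite ltW.
  move=> u hu; rewrite opprB addrC subrK => hc.
  suff : acos u < e' by rewrite lt_min => /andP[].
  rewrite -ltr_cos ?in_itv /= ?acosK ?acos_ge0 ?acos_lepi ?(ltW e'0)//.
move=> hu0 e e0; have [u1|u1] := eqVneq u0 1.
  have [d d0 Hd] := right e e0; exists d => // u hu; rewrite u1 acos1 subr0 ltr_norml => /andP[h1 _].
  by rewrite ger0_norm ?acos_ge0//; apply: Hd => //; lra.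
have [u2|u2] := eqVneq u0 (-1).
  have [d d0 Hd] := right e e0; exists d => // u hu; rewrite u2 acosN1 ltr_norml => /andP[_ h1].
  rewrite distrC -acosN// ger0_norm ?acos_ge0//; [by apply: Hd; lra|by rewrite lerN2 lerNl andbC; lra].
have hu : -1 < u0 < 1.
  by move: hu0; rewrite !le_eqVlt eq_sym (negbTE u2) (negbTE u1).
have /contP/(_ _ e0)[d d0 Hd] := continuous_acos hu.
by exists d => // u _; exact: Hd.
Qed.

End Polar.

Section JointContinuity.
Variable R : realType.
Implicit Types (f g : R -> R -> R).

Definition jcont f s t := forall e, 0 < e -> exists2 d, 0 < d & forall s' t',
  `|s' - s| < d -> `|t' - t| < d -> `|f s' t' - f s t| < e.

Lemma jcontP f s t : jcont f s t <-> {for (s, t), continuous (fun p : R * R => f p.1 p.2)}.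
Proof.
split.
  move=> H; apply/cvgrPdist_lt => e /H[d d0 Hd].
  exists (ball s d, ball t d); first by split; exact: nbhsx_ballx.
  by move=> [s' t'] /= [h1 h2]; rewrite distrC; apply: Hd; rewrite distrC.
move=> /cvgrPdist_lt H e /H [[A B] /= [/nbhs_ballP[d1 d10 H1] /nbhs_ballP[d2 d20 H2]] AB].
exists (Num.min d1 d2); first by rewrite lt_min d10.
move=> s' t'; rewrite !lt_min => /andP[h1 _] /andP[_ h2].
rewrite distrC; apply: (AB (s', t')); split => /=.
  by apply: H1; rewrite /ball/= distrC.
by apply: H2; rewrite /ball/= distrC.
Qed.

Lemma jcont_lip f s t C d : 0 < d -> (forall s' t', `|s' - s| < d -> `|t' - t| < d ->
  `|f s' t' - f s t| <= C * (`|s' - s| + `|t' - t|)) -> jcont f s t.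
Proof.
move=> d0 H e e0; have c0 : 0 < `|C| + 1 by rewrite ltr_pwDr.
exists (Num.min d (e / 2 / (`|C| + 1))); first by rewrite lt_min d0 !divr_gt0.
move=> s' t'; rewrite !lt_min !ltr_pdivlMr// => /andP[h1 h2] /andP[h3 h4].
apply: le_lt_trans (H _ _ h1 h3) _.
apply: (@le_lt_trans _ _ ((`|C| + 1) * (`|s' - s| + `|t' - t|))).
  by rewrite ler_wpM2r ?addr_ge0//; have := ler_norm C; lra.
by lra.
Qed.

End JointContinuity.

(** * Constancy of the level along orbit arcs *)

Section Conservation.
Local Open Scope classical_set_scope.
Local Open Scope complex_scope.
Variable R : realType.
Local Notation normc := (@ComplexField.Normc.normc R).
Local Notation Re := (@complex.Re R).
Local Notation Im := (@complex.Im R).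
Variables (h : {poly R[i]}) (s0 K : R).
Hypothesis hK : kbound h s0 K.
Variables (e : R).
Hypotheses (he : `|e| * K <= 1 / 80).

Let K0 : 0 < K. Proof. by case: hK. Qed.

Lemma k_lip (f fs ft : R -> R -> R) C s t s' t' : `|s - s0| <= 1 -> `|s' - s0| <= 1 ->
  (forall s t : R, is_derive s 1 (f^~ t) (fs s t)) -> (forall s t : R, is_derive t 1 (f s) (ft s t)) ->
  (forall s t : R, `|s - s0| <= 1 -> `|fs s t| <= C /\ `|ft s t| <= C) ->
  `|f s' t' - f s t| <= C * (`|s' - s| + `|t' - t|).
Proof.
move=> hs hs' df1 df2 H.
have [c cb E1] := @mvt R (f^~ t') (fs^~ t') s s' (fun x _ => df1 x t').
have [c' _ E2] := @mvt R (f s) (ft s) t t' (fun x _ => df2 s x).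
have hc : `|c - s0| <= 1.
  by move: hs hs' cb; rewrite !ler_norml; case: (ltP s s') => ?; lra.
have -> : f s' t' - f s t = (f s' t' - f s t') + (f s t' - f s t) by ring.
apply: le_trans (ler_normD _ _) _; rewrite E1 E2 !normrM mulrDr.
by apply: lerD; apply: ler_wpM2r => //; [have [] := H c t' hc|have [] := H s c' hs].
Qed.

Lemma ka_lip s t s' t' : `|s - s0| <= 1 -> `|s' - s0| <= 1 ->
  `|ka h s' t' - ka h s t| <= K * (`|s' - s| + `|t' - t|).
Proof.
move=> hs hs'; apply: (@k_lip (ka h) (kda h) (fun s t => - kdb h s t) K _ _ _ _ hs hs' (ka_ds h) (ka_dt h)).
by move=> x y hx; rewrite normrN; have [_ /(_ x y hx)[]] := hK.
Qed.

Lemma kb_lip s t s' t' : `|s - s0| <= 1 -> `|s' - s0| <= 1 ->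
  `|kb h s' t' - kb h s t| <= K * (`|s' - s| + `|t' - t|).
Proof.
move=> hs hs'; apply: (@k_lip (kb h) (kdb h) (kda h) K _ _ _ _ hs hs' (kb_ds h) (kb_dt h)).
by move=> x y hx; have [_ /(_ x y hx)[]] := hK.
Qed.

Lemma kim_jcont s t : `|s - s0| < 1 -> jcont (kim h e) s t.
Proof.
move=> hs; have d0 : 0 < 1 - `|s - s0| by rewrite subr_gt0.
have hs1 := ltW hs.
have in1 s' : `|s' - s| < 1 - `|s - s0| -> `|s' - s0| <= 1.
  by move=> h1; have := ler_normD (s' - s) (s - s0); rewrite addrA subrK; lra.
have /jcontP ca : jcont (ka h) s t.
  by apply: (jcont_lip d0) => s' t' /in1 h1 _; apply: ka_lip.
have /jcontP cb : jcont (kb h) s t.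
  by apply: (jcont_lip d0) => s' t' /in1 h1 _; apply: kb_lip.
apply/jcontP.
have cM (f : R * R -> R) : {for (s, t), continuous f} -> {for (s, t), continuous (fun p => e * f p)}.
  by move=> cf; apply: (@continuousM _ _ (cst e) f) => //; exact: cst_continuous.
have c1 : {for (s, t), continuous (fun p : R * R => 1 + e * kb h p.1 p.2)}.
  have c0 : {for (s, t), continuous (fun _ : R * R => 1 : R)} by exact: cst_continuous.
  exact: continuousD c0 (cM _ cb).
have ce := cM _ ca.
have -> : (fun p : R * R => kim h e p.1 p.2) = (fun p => (1 + e * kb h p.1 p.2) *
   (e * ka h p.1 p.2 * (e * ka h p.1 p.2) + (1 + e * kb h p.1 p.2) * (1 + e * kb h p.1 p.2))^-1).
  by apply/funext => p; rewrite /kim /kden !expr2.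
apply: (@continuousM _ _ (fun p : R * R => 1 + e * kb h p.1 p.2) (fun p : R * R =>
  (e * ka h p.1 p.2 * (e * ka h p.1 p.2) + (1 + e * kb h p.1 p.2) * (1 + e * kb h p.1 p.2))^-1)) => //.
apply: continuousV.
  by have := kden_bounds hK t he hs1; rewrite /kden !expr2 /=; lra.
apply: (@continuousD _ _ _ (fun p : R * R => e * ka h p.1 p.2 * (e * ka h p.1 p.2))
  (fun p => (1 + e * kb h p.1 p.2) * (1 + e * kb h p.1 p.2))).
  exact: (@continuousM _ _ (fun p : R * R => e * ka h p.1 p.2) (fun p : R * R => e * ka h p.1 p.2)).
exact: (@continuousM _ _ (fun p : R * R => 1 + e * kb h p.1 p.2) (fun p : R * R => 1 + e * kb h p.1 p.2)).
Qed.

Lemma fieldE (s t : R) : let z := (expR s)%:C * cis t in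
  (perturbed h e).[z] = z * ((e * ka h s t) +i* (1 + e * kb h s t)).
Proof.
rewrite /perturbed hornerD !hornerZ hornerX kE.
by apply/eqP; rewrite eq_complex /=; apply/andP; split; apply/eqP; ring.
Qed.

Definition annulus r (z : R[i]) := expR (s0 - r) < normc z < expR (s0 + r).

Lemma annulus_gt0 r z : annulus r z -> 0 < normc z.
Proof. by move=> /andP[h1 _]; exact: lt_trans (expR_gt0 _) h1. Qed.

Lemma annulus_ln r z : annulus r z <-> 0 < normc z /\ `|ln (normc z) - s0| < r.
Proof.
rewrite /annulus; split=> [/andP[h1 h2]|[z0]].
  have z0 := lt_trans (expR_gt0 _) h1; split=> //.
  have [L EL] : exists L, normc z = expR L by exists (ln (normc z)); rewrite lnK.
  by move: h1 h2; rewrite EL expRK !ltr_expR ltr_norml; lra.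
have [L EL] : exists L, normc z = expR L by exists (ln (normc z)); rewrite lnK.
by rewrite EL expRK !ltr_expR ltr_norml; lra.
Qed.

Lemma annulus_conj r z : annulus r z^* <-> annulus r z.
Proof. by rewrite /annulus normc_conj. Qed.

Variable V : R -> R -> R.
Hypothesis hV : first_integral h s0 e V.

Definition levelz (z : R[i]) := V (ln (normc z)) (argz z).

(* [sp] allows for time reversal. *)
Lemma levelz_derive (z : R -> R[i]) (t sp : R) : 0 < Im (z t) -> annulus (3 / 4) (z t) ->
  is_derive t 1 (Re \o z) (sp * Re (perturbed h e).[z t]) ->
  is_derive t 1 (Im \o z) (sp * Im (perturbed h e).[z t]) ->
  is_derive t 1 (levelz \o z) 0.
Proof.
move=> y0 /annulus_ln[n0 hs] dx dy.
set N := normc (z t) in n0 hs *; set s := ln N in hs *.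
set th := argz (z t).
have zE : z t = (expR s)%:C * cis th by rewrite lnK//; apply: polarE => //; exact: ltW.
set x := Re (z t) in dx dy *; set y := Im (z t) in y0 dx dy *.
have N2 : N ^+ 2 = x ^+ 2 + y ^+ 2 by rewrite normc_sqr.
have Nn : N != 0 by rewrite gt_eqF.
have yn : y != 0 by rewrite gt_eqF.
set A := e * ka h s th; set B := 1 + e * kb h s th.
have FE : (perturbed h e).[z t] = (x * A - y * B) +i* (y * A + x * B).
  rewrite {1}zE fieldE -zE; apply/eqP; rewrite eq_complex /x /y.
  by case: (z t) => a b /=; apply/andP; split; apply/eqP; rewrite /A /B; ring.
rewrite FE /= in dx dy.
have dN2 : is_derive t 1 (fun t => Re (z t) ^+ 2 + Im (z t) ^+ 2) (2 * sp * A * N ^+ 2).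
  apply: derive_eq (derive_add (derive_sqr dx) (derive_sqr dy)) _.
  by rewrite N2 -/x -/y /=; ring.
have dN : is_derive t 1 (fun t => normc (z t)) (sp * A * N).
  have g0 : 0 < Re (z t) ^+ 2 + Im (z t) ^+ 2 by rewrite -N2 exprn_gt0.
  have := derive_comp (f := @Num.sqrt R) (g := fun t => Re (z t) ^+ 2 + Im (z t) ^+ 2)
    (is_derive1_sqrt g0) dN2.
  have -> : (fun t => Num.sqrt (Re (z t) ^+ 2 + Im (z t) ^+ 2)) = (fun t => normc (z t)).
    by apply/funext => u; rewrite normcE.
  by move=> H; apply: derive_eq H _; rewrite -normcE -/N; field.
have dS : is_derive t 1 (fun t => ln (normc (z t))) (sp * A).
  by apply: derive_eq (derive_comp (f := @ln R) (g := fun t => normc (z t)) (is_derive1_ln n0) dN) _; rewrite -/N; field.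
have u1 : -1 < x / N < 1.
  rewrite ltr_pdivlMr// ltr_pdivrMr// mulN1r mul1r -ltr_norml.
  rewrite -(@ltr_pXn2r _ 2)// ?nnegrE// ?(ltW n0)// sqr_absr N2 ltrDl exprn_gt0//.
have dT : is_derive t 1 (fun t => argz (z t)) (sp * B).
  apply: derive_eq (derive_comp (f := @acos R)
    (g := fun t => Re (z t) / normc (z t)) (is_derive1_acos u1) (derive_div dx dN Nn)) _.
  have -> : Num.sqrt (1 - (x / N) ^+ 2) = y / N.
    rewrite -[RHS]ger0_norm ?divr_ge0 ?ltW// -sqrtr_sqr; congr Num.sqrt.
    by rewrite !exprMn exprVn -[1](@mulfV _ (N ^+ 2)) ?expf_neq0// -mulrBl N2; congr (_ / _); ring.
  rewrite -/N -/x /=.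
  have -> : (sp * (x * A - y * B) * N - x * (sp * A * N)) = - (sp * y * B * N) by ring.
  by field; rewrite Nn.
have p0 := pi_gt0 R.
have th0 : -1 < th by have := argz_bounds (z t); rewrite -/th; lra.
have r0 : 0 < Num.min (3 / 4 - `|s - s0|) (th + 1) by rewrite lt_min subr_gt0 hs; lra.
have := @chain2 R V (kim h e) (fun s t => - kre h e s t) (fun t => ln (normc (z t)))
  (fun t => argz (z t)) t (sp * A) (sp * B) _ r0 _ _ _ dS dT.
rewrite /= -/N -/s -/th => H; apply: derive_eq (H _ _ _) _.
- move=> s' t'; rewrite !lt_min => /andP[h1 _] /andP[_ h2]; apply: (hV _ _).1.
    by have := ler_normD (s' - s) (s - s0); rewrite addrA subrK; lra.
  by move: h2; rewrite ltr_norml; lra.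
- exact: (hV hs th0).2.
- by apply: kim_jcont; lra.
(* [kim * A = kre * B]: the field [A + i B = i + e k] is tangent to the levels, since
   [(i + e k) / (i + e k)] is real. *)
- by rewrite /kim /kre -/A -/B; ring.
Qed.

Lemma level_jcont s t : `|s - s0| < 3 / 4 -> -1 < t -> jcont V s t.
Proof.
move=> hs ht.
have d0 : 0 < Num.min (3 / 4 - `|s - s0|) (t + 1) by rewrite lt_min subr_gt0 hs; lra.
apply: (@jcont_lip R V s t (2 + 2 * K * `|e|) _ d0) => s' t'.
rewrite !lt_min => /andP[h1 _] /andP[_ h2].
have hs' : `|s' - s0| < 3 / 4.
  by have := ler_normD (s' - s) (s - s0); rewrite addrA subrK; lra.
have ht' : -1 < t' by move: h2; rewrite ltr_norml; lra.
have [c cb E] := level_mvt hV hs hs' ht'.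
have E2 := level_angle hK he hV hs ht ht'.
have hc : `|c - s0| <= 1.
  by move: hs hs' cb; rewrite !ltr_norml ler_norml; case: (ltP s s') => ?; lra.
have /andP[k1 k2] := kim_bounds hK t' he hc.
have -> : V s' t' - V s t = (V s' t' - V s t') + (V s t' - V s t) by ring.
apply: le_trans (ler_normD _ _) _; rewrite E normrM.
have h3 : `|kim h e c t'| * `|s' - s| <= 2 * `|s' - s|.
  by rewrite ler_wpM2r// ger0_norm//; lra.
have h4 : 0 <= 2 * K * `|e| * `|s' - s| by rewrite !mulr_ge0// ltW.
have h5 := normr_ge0 (t' - t).
by lra.
Qed.

Lemma levelz_cont (z : R -> R[i]) (t : R) :
  {for t, continuous (Re \o z)} -> {for t, continuous (Im \o z)} ->
  annulus (3 / 4) (z t) -> forall e', 0 < e' -> exists2 d, 0 < d &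
  forall t', `|t' - t| < d -> `|levelz (z t') - levelz (z t)| < e'.
Proof.
move=> cx cy /annulus_ln[n0 hs].
have cN : {for t, continuous (fun t => normc (z t))}.
  have -> : (fun t => normc (z t)) = (fun t => Num.sqrt (Re (z t) * Re (z t) + Im (z t) * Im (z t))).
    by apply/funext => u; rewrite normcE !expr2.
  apply: (@continuous_comp _ _ _ (fun t => Re (z t) * Re (z t) + Im (z t) * Im (z t)) Num.sqrt).
    apply: (@continuousD _ _ _ (fun t => Re (z t) * Re (z t)) (fun t => Im (z t) * Im (z t))).
      exact: (@continuousM _ _ (Re \o z) (Re \o z)).
    exact: (@continuousM _ _ (Im \o z) (Im \o z)).
  exact: sqrt_continuous.
have /contP cL : {for t, continuous (fun t => ln (normc (z t)))}.
  apply: (@continuous_comp _ _ _ (fun t => normc (z t)) (@ln R)) => //.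
  exact: continuous_ln.
have /contP cU : {for t, continuous (fun t => Re (z t) / normc (z t))}.
  apply: (@continuousM _ _ (Re \o z) (fun t => (normc (z t))^-1)) => //.
  by apply: continuousV => //; rewrite gt_eqF.
have p0 := pi_gt0 R; have th0 : -1 < argz (z t) by have := argz_bounds (z t); lra.
move=> e' e0; have [d d0 Hd] := level_jcont hs th0 e0.
have [d1 d10 H1] := cL _ d0.
have [d2' d20 H2] := acos_within (argz_dom (z t)) d0.
have [d3 d30 H3] := cU _ d20.
exists (Num.min d1 d3); first by rewrite lt_min d10.
move=> t'; rewrite lt_min => /andP[h1 h2]; apply: Hd; first exact: H1.
by apply: H2; [exact: argz_dom|exact: H3].
Qed.

(** The ends of the arc may lie on the axis, where [argz] is not differentiable; differentiability
    inside and continuity up to the ends suffice. *)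
Lemma levelz_const (z : R -> R[i]) (a b sp : R) : a <= b ->
  (forall t : R, {for t, continuous (Re \o z)}) -> (forall t : R, {for t, continuous (Im \o z)}) ->
  (forall t, a <= t <= b -> annulus (3 / 4) (z t)) ->
  (forall t, a < t < b -> [/\ 0 < Im (z t),
    is_derive t 1 (Re \o z) (sp * Re (perturbed h e).[z t]) &
    is_derive t 1 (Im \o z) (sp * Im (perturbed h e).[z t])]) ->
  levelz (z b) = levelz (z a).
Proof.
move=> ab cx cy hann hd.
have d0 (x : R) : x \in `]a, b[%R -> is_derive x 1 (levelz \o z) 0.
  rewrite in_itv /= => xab; have [y0 dx dy] := hd x xab.
  by apply: levelz_derive y0 _ dx dy; apply: hann; move/andP: xab => [? ?]; rewrite !ltW.
have c0 : {within `[a, b], continuous (levelz \o z)}.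
  by apply: within_cont => x hx; apply/contP; exact: levelz_cont (cx x) (cy x) (hann x hx).
have [c _] := @MVT_segment R (levelz \o z) (fun=> 0) a b ab d0 c0.
by rewrite mul0r => /eqP; rewrite subr_eq0 => /eqP.
Qed.

End Conservation.

(** * Integrated form of the differential inclusion *)

Section Filippov.
Local Open Scope classical_set_scope.
Local Open Scope complex_scope.
Variable R : realType.
Local Notation mu := (@lebesgue_measure R).
Local Notation normc := (@ComplexField.Normc.normc R).
Local Notation Re := (@complex.Re R).
Local Notation Im := (@complex.Im R).
Implicit Types (Fp Fm : {poly R[i]}) (z v : R -> R[i]) (T : R).

(* A Filippov solution on [0, T], extended by constants outside [0, T] so that
   it is continuous everywhere. *)
Definition fsol Fp Fm T z := [/\ forall t : R, {for t, continuous (Re \o z)},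
  forall t : R, {for t, continuous (Im \o z)} &
  forall (al be c a b : R), 0 <= a -> a <= b -> b <= T ->
    (forall t w, a <= t <= b -> filippov_velocity Fp Fm (z t) w -> c <= al * Re w + be * Im w) ->
    c * (b - a) <= al * (Re (z b) - Re (z a)) + be * (Im (z b) - Im (z a))].

Lemma clamp_lip T (u u' : R) : 0 <= T ->
  `|Num.max 0 (Num.min u T) - Num.max 0 (Num.min u' T)| <= `|u - u'|.
Proof.
move=> T0; rewrite !minElt !maxElt ler_norml.
have := ler_norm (u - u'); have := ler_norm (u' - u); rewrite distrC.
by case: (ltP u T) => h1; case: (ltP u' T) => h2; case: ltP => h4; case: ltP => h5; lra.
Qed.

Lemma clamp_continuous (f : R -> R) T : 0 <= T -> {within `[0, T], continuous f} ->
  forall t : R, {for t, continuous (fun t => f (Num.max 0 (Num.min t T)))}.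
Proof.
move=> T0 /subspace_continuousP cf t; apply/contP => e e0.
pose cl (t : R) := Num.max 0 (Num.min t T).
have clI u : `[0, T] (cl u).
  by rewrite /= in_itv /= /cl le_max lexx /= ge_max T0 ge_min lexx orbT.
have cl1 u u' : `|cl u - cl u'| <= `|u - u'| by exact: clamp_lip.
have := cf (cl t) (clI t); move=> /cvgrPdist_lt /(_ e e0).
rewrite near_withinE => /nbhs_ballP[d /= d0 Hd]; exists d => // y yt.
rewrite distrC; apply: Hd; last exact: clI.
by rewrite /ball /= distrC; apply: le_lt_trans (cl1 _ _) yt.
Qed.

Lemma ae_ge_Rintegral (g : R -> R) (a b : R) : mu.-integrable `[a, b] (EFin \o g) ->
  {ae mu, forall t, a <= t <= b -> 0 <= g t} -> 0 <= \int[mu]_(t in `[a, b]) g t.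
Proof.
move=> ig aeg; rewrite /Rintegral fine_ge0//.
have mg := measurable_int mu ig.
rewrite (@ae_eq_integral _ _ _ mu _ (abse \o (EFin \o g))) //.
- by apply: integral_ge0 => x _; exact: abse_ge0.
- exact: (measurableT_comp (@abse_measurable R setT)) mg.
- apply: negligibleS aeg => t /= H H'; apply: H => ht; rewrite ger0_norm//.
  by apply: H'; move: ht; rewrite in_itv.
Qed.

(** A linear inequality satisfied by all admissible velocities can be integrated, which eliminates
    the velocity and the almost everywhere clause. The extension by constants is composition with
    the projection of the line onto [[0, T]]. *)
Lemma fsol_of Fp Fm T z : 0 < T -> filippov_solution Fp Fm T z ->
  exists2 z', fsol Fp Fm T z' & forall t, 0 <= t <= T -> z' t = z t.
Proof.
move=> T0 [v [iR iI zE aev]].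
pose cl (t : R) := Num.max 0 (Num.min t T).
have clE t : 0 <= t <= T -> cl t = t.
  by move=> /andP[h1 h2]; rewrite /cl (min_idPl h2) (max_idPr h1).
have clI t : 0 <= cl t <= T.
  by rewrite /cl le_max lexx /= ge_max (ltW T0) ge_min lexx orbT.
exists (z \o cl); last by move=> t ht /=; rewrite clE.
have sub a b : 0 <= a -> b <= T -> `[a, b] `<=` `[0, T].
  by move=> a0 bT t; rewrite /= !in_itv /= => /andP[? ?]; lra.
have cont (u : R -> R) (w0 : R) : mu.-integrable `[0, T] (EFin \o u) ->
    forall t : R, {for t, continuous (fun t => w0 + \int[mu]_(s in `[0, cl t]) u s)}.
  move=> iu t; apply: (@continuousD _ _ _ (fun=> w0)); first exact: cst_continuous.
  have := @parameterized_integral_continuous R 0 T u (ltW T0) iu.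
  by move=> /(clamp_continuous (ltW T0)) /(_ t).
have diff (u : R -> R) a b : mu.-integrable `[0, T] (EFin \o u) -> 0 <= a -> a <= b -> b <= T ->
    \int[mu]_(s in `[0, b]) u s - \int[mu]_(s in `[0, a]) u s = \int[mu]_(s in `[a, b]) u s.
  move=> iu a0 ab bT; rewrite Rintegral_itvB ?bnd_simp//; last first.
    by apply: integrableS iu => //; exact: sub.
  rewrite Rintegral_itv_obnd_cbnd//; apply: integrableS iu => //.
  by apply: subset_trans (sub a b a0 bT); apply: subset_itvr; rewrite bnd_simp.
have zRe : Re \o (z \o cl) = (fun t => Re (z 0) + \int[mu]_(s in `[0, cl t]) Re (v s)).
  by apply/funext => s; apply: etrans (congr1 Re (zE _ (clI s))) _; case: (z 0).
have zIm : Im \o (z \o cl) = (fun t => Im (z 0) + \int[mu]_(s in `[0, cl t]) Im (v s)).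
  by apply/funext => s; apply: etrans (congr1 Im (zE _ (clI s))) _; case: (z 0).
split; first by rewrite zRe; exact: cont.
  by rewrite zIm; exact: cont.
move=> al be c a b a0 ab bT H.
  have ia : 0 <= a <= T by lra.
  have ib : 0 <= b <= T by lra.
  have iRab : mu.-integrable `[a, b] (EFin \o (fun t => Re (v t))).
    by apply: integrableS iR => //; exact: sub.
  have iIab : mu.-integrable `[a, b] (EFin \o (fun t => Im (v t))).
    by apply: integrableS iI => //; exact: sub.
  have i1 : mu.-integrable `[a, b] (EFin \o (fun t => al * Re (v t))).
    by rewrite (_ : _ \o _ = fun t => (al%:E * (EFin \o (fun t => Re (v t))) t)%E) //; apply: integrableZl.
  have i2 : mu.-integrable `[a, b] (EFin \o (fun t => be * Im (v t))).
    by rewrite (_ : _ \o _ = fun t => (be%:E * (EFin \o (fun t => Im (v t))) t)%E) //; apply: integrableZl.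
  have ic : mu.-integrable `[a, b] (EFin \o (fun=> c)).
    by apply: cont_integrable => t _; exact: cst_continuous.
  have i12 : mu.-integrable `[a, b] (EFin \o (fun t => al * Re (v t) + be * Im (v t))).
    by rewrite (_ : _ \o _ = (EFin \o (fun t => al * Re (v t))) \+ (EFin \o (fun t => be * Im (v t)))) //; apply: integrableD.
  have ig : mu.-integrable `[a, b] (EFin \o (fun t => al * Re (v t) + be * Im (v t) - c)).
    pose g1 t := al * Re (v t) + be * Im (v t).
    by rewrite (_ : _ \o _ = ((EFin \o g1) \- (EFin \o (fun=> c)))%E) //; apply: integrableB.
  have := ae_ge_Rintegral ig; rewrite RintegralB// RintegralD// !RintegralZl// Rintegral_cst//.
  have -> : fine (mu `[a, b]) = b - a.
    rewrite lebesgue_measure_itv /= lte_fin; case: ltP => // ba.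
    by have -> : b = a by [apply/eqP; rewrite eq_le ab ba]; rewrite subrr.
  rewrite -(diff _ a b iR a0 ab bT) -(diff _ a b iI a0 ab bT) => HH.
  have rr t : Re (z (cl t)) = Re (z 0) + \int[mu]_(s in `[0, cl t]) Re (v s).
    by have := congr1 (fun f : R -> R => f t) zRe.
  have ii t : Im (z (cl t)) = Im (z 0) + \int[mu]_(s in `[0, cl t]) Im (v s).
    by have := congr1 (fun f : R -> R => f t) zIm.
  rewrite /= !rr !ii (clE a)// (clE b)//.
  have /HH : {ae mu, forall t, a <= t <= b -> 0 <= al * Re (v t) + be * Im (v t) - c}.
    apply: negligibleS aev => t /= H1 H2; apply: H1 => ht; rewrite subr_ge0.
    apply: (H t) => //; have ht' : 0 <= t <= T by lra.
    by rewrite /= clE//; exact: H2.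
  by lra.
Qed.

End Filippov.

(** * Differentiability off the axis and rotation around the origin *)

Section FilippovDynamics.
Local Open Scope classical_set_scope.
Local Open Scope complex_scope.
Variable R : realType.
Local Notation normc := (@ComplexField.Normc.normc R).
Local Notation Re := (@complex.Re R).
Local Notation Im := (@complex.Im R).

Lemma horner_continuous (p : {poly R[i]}) (z : R -> R[i]) (t : R) :
  {for t, continuous (Re \o z)} -> {for t, continuous (Im \o z)} ->
  {for t, continuous (fun t => Re p.[z t])} /\ {for t, continuous (fun t => Im p.[z t])}.
Proof.
move=> cx cy; elim/poly_ind: p => [|p c [IH1 IH2]].
  have E : (fun t => (0 : {poly R[i]}).[z t]) = fun=> 0 by apply/funext => u; rewrite horner0.
  have -> : (fun t => Re (0 : {poly R[i]}).[z t]) = fun=> 0 by apply/funext => u; rewrite horner0.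
  have -> : (fun t => Im (0 : {poly R[i]}).[z t]) = fun=> 0 by apply/funext => u; rewrite horner0.
  by split; exact: cst_continuous.
have -> : (fun t => Re (p * 'X + c%:P).[z t]) =
   (fun t => Re p.[z t] * Re (z t) - Im p.[z t] * Im (z t) + Re c).
  by apply/funext => u; rewrite hornerMXaddC; case: (p.[z u]) => a b; case: (z u); case: c.
have -> : (fun t => Im (p * 'X + c%:P).[z t]) =
   (fun t => Re p.[z t] * Im (z t) + Im p.[z t] * Re (z t) + Im c).
  by apply/funext => u; rewrite hornerMXaddC; case: (p.[z u]) => a b; case: (z u); case: c.
have M (f g : R -> R) : {for t, continuous f} -> {for t, continuous g} ->
  {for t, continuous (fun t => f t * g t)} by move=> cf cg; exact: (@continuousM _ _ f g).
have D (f g : R -> R) : {for t, continuous f} -> {for t, continuous g} ->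
  {for t, continuous (fun t => f t + g t)} by move=> cf cg; exact: (@continuousD _ _ _ f g).
have N (f : R -> R) : {for t, continuous f} ->
  {for t, continuous (fun t => - f t)} by move=> cf; exact: (@continuousN _ _ _ f).
have C (k : R) : {for t, continuous (fun _ : R => k)} by exact: cst_continuous.
split; first exact: (D _ _ (D _ _ (M _ _ IH1 cx) (N _ (M _ _ IH2 cy))) (C _)).
exact: (D _ _ (D _ _ (M _ _ IH1 cy) (M _ _ IH2 cx)) (C _)).
Qed.

(** When the inclusion determines the velocity, the integrated inequalities for a linear form and
    for its opposite squeeze the difference quotient. *)
Lemma fsol_derive_lin (Fp Fm F : {poly R[i]}) T z a b t (al be : R) : fsol Fp Fm T z ->
  0 <= a -> b <= T -> a < t < b ->
  (forall t w, a < t < b -> filippov_velocity Fp Fm (z t) w -> w = F.[z t]) ->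
  is_derive t 1 (fun t => al * Re (z t) + be * Im (z t)) (al * Re F.[z t] + be * Im F.[z t]).
Proof.
move=> [cx cy H] a0 bT /andP[at_ tb] HF.
have [cR cI] := horner_continuous F (cx t) (cy t).
pose f t := al * Re (z t) + be * Im (z t).
pose g t := al * Re F.[z t] + be * Im F.[z t].
have /contP cg : {for t, continuous g}.
  apply: (@continuousD _ _ _ (fun t => al * Re F.[z t]) (fun t => be * Im F.[z t])).
    by apply: (@continuousM _ _ (fun=> al)) => //; exact: cst_continuous.
  by apply: (@continuousM _ _ (fun=> be)) => //; exact: cst_continuous.
apply/is_deriveP => e e0.
have [d d0 Hd] := cg _ e0; exists (Num.min d (Num.min (t - a) (b - t))).
  by rewrite !lt_min d0 !subr_gt0 at_ tb.
move=> y; rewrite !lt_min => /and3P[yd y1 y2].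
have main u v : u <= v -> (u = t /\ v = y) \/ (u = y /\ v = t) ->
    `|f v - f u - g t * (v - u)| <= e * (v - u).
  move=> uv ut.
  have w1 : a < u by move: y1; rewrite ltr_norml; case: ut => -[E E']; lra.
  have w2 : v < b by move: y2; rewrite ltr_norml; case: ut => -[E E']; lra.
  have near x : u <= x <= v -> [/\ g t - e <= g x, g x <= g t + e & a < x < b].
    move=> hx; have : `|x - t| < d.
      by move: yd; rewrite !ltr_norml; case: ut => -[E E']; lra.
    by move=> /Hd; rewrite ltr_norml => ?; split; lra.
  have h1 : (g t - e) * (v - u) <= al * (Re (z v) - Re (z u)) + be * (Im (z v) - Im (z u)).
    apply: H => //; [lra|lra|] => x w /near[n1 n2 n3] /HF -> //.
  have h2 : (- g t - e) * (v - u) <= - al * (Re (z v) - Re (z u)) + - be * (Im (z v) - Im (z u)).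
    apply: H => //; [lra|lra|] => x w /near[n1 n2 n3] /HF -> //.
    by move: n2; rewrite /g; lra.
  by rewrite ler_norml /f; lra.
rewrite /= -/(f y) -/(f t) -/(g t); case: (leP t y) => ty.
  by rewrite (ger0_norm (_ : 0 <= y - t)) ?subr_ge0//; apply: main; [|left].
have := main y t (ltW ty) (or_intror (conj erefl erefl)).
rewrite distrC (ltr0_norm (_ : y - t < 0)) ?subr_lt0// opprB.
by congr (`|_| <= _); ring.
Qed.

Lemma fsol_derive (Fp Fm F : {poly R[i]}) T z a b t : fsol Fp Fm T z -> 0 <= a -> b <= T ->
  a < t < b ->
  (forall t w, a < t < b -> filippov_velocity Fp Fm (z t) w -> w = F.[z t]) ->
  is_derive t 1 (Re \o z) (Re F.[z t]) /\ is_derive t 1 (Im \o z) (Im F.[z t]).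
Proof.
move=> fz a0 bT tab HF.
have d1 := fsol_derive_lin 1 0 fz a0 bT tab HF.
have d2 := fsol_derive_lin 0 1 fz a0 bT tab HF.
split; [apply: derive_eq (derive_near ltr01 _ d1) _|apply: derive_eq (derive_near ltr01 _ d2) _];
  by move=> *; rewrite /= ?mul1r ?mul0r ?addr0 ?add0r.
Qed.

Variables (s0 K e : R).
Hypothesis he : `|e| * K <= 1 / 80.

Lemma polar_exists (z : R[i]) : 0 < normc z -> exists t, z = (normc z)%:C * cis t.
Proof.
move=> z0; have [y0|y0] := leP 0 (Im z); first by exists (argz z); exact: polarE.
exists (- argz z^*); have := @polarE R z^*; rewrite normc_conj => H.
have {H} := H z0 _; rewrite (_ : Im z^* = - Im z); last by case: (z).
rewrite oppr_ge0 => /(_ (ltW y0)) /(congr1 conjc); rewrite conjcK rmorphM /= => E.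
rewrite {1}E; congr (_ * _); last by rewrite /cis cosN sinN.
by rewrite /= oppr0.
Qed.

(** The angular momentum of the field is [(1 + e * kb) * |z| ^ 2], and [|e * kb| <= 1 / 80]. On the
    axis it gives the vertical component the sign of [Re z] for both fields, so there is no
    sliding. *)
Lemma field_rotates (h : {poly R[i]}) (z : R[i]) : kbound h s0 K -> annulus s0 (3 / 4) z ->
  79 / 80 * normc z ^+ 2 <= Re z * Im (perturbed h e).[z] - Im z * Re (perturbed h e).[z].
Proof.
move=> hK /annulus_ln[z0 hs]; have [t E] := polar_exists z0.
set s := ln (normc z) in hs; have {}E : z = (expR s)%:C * cis t by rewrite lnK.
have hs1 : `|s - s0| <= 1 by lra.
have [_ h2] := small_k hK t he hs1.
have FE : (perturbed h e).[z] = z * ((e * ka h s t) +i* (1 + e * kb h s t)).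
  by rewrite {1}E fieldE -E.
have -> : Re z * Im (perturbed h e).[z] - Im z * Re (perturbed h e).[z] =
    (1 + e * kb h s t) * normc z ^+ 2.
  by rewrite FE normc_sqr; case: (z) => x y /=; ring.
by rewrite ler_wpM2r ?sqr_ge0//; move: h2; rewrite ler_norml; lra.
Qed.

Lemma field_crosses (h : {poly R[i]}) (z : R[i]) : kbound h s0 K -> annulus s0 (3 / 4) z ->
  Im z = 0 -> 0 < Re z * Im (perturbed h e).[z].
Proof.
move=> hK hz y0; have := field_rotates hK hz; rewrite y0 mul0r subr0; apply: lt_le_trans.
by rewrite mulr_gt0// exprn_gt0// (annulus_gt0 hz).
Qed.

Variables (hp hm : {poly R[i]}).
Hypotheses (hpK : kbound hp s0 K) (hmK : kbound hm s0 K).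
Local Notation Fp := (perturbed hp e).
Local Notation Fm := (perturbed hm e).

(** Positivity of the angular momentum is a linear condition on the velocity once the base point is
    frozen at [z t0], so it passes to the convex combinations on the axis and can be integrated. *)
Lemma fsol_rotates T z t0 : fsol Fp Fm T z -> annulus s0 (3 / 4) (z t0) ->
  exists2 d, 0 < d & forall t1 t2, 0 <= t1 -> t1 < t2 -> t2 <= T ->
    `|t1 - t0| < d -> `|t2 - t0| < d ->
    0 < Re (z t0) * (Im (z t2) - Im (z t1)) - Im (z t0) * (Re (z t2) - Re (z t1)).
Proof.
move=> [cx cy H] ann; pose x0 := Re (z t0); pose y0 := Im (z t0).
have N0 : 0 < normc (z t0) ^+ 2 by rewrite exprn_gt0// (annulus_gt0 ann).
pose c := normc (z t0) ^+ 2 / 2; have c0 : 0 < c by rewrite divr_gt0.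
have loc h : kbound h s0 K -> exists2 d, 0 < d & forall t, `|t - t0| < d ->
    c <= x0 * Im (perturbed h e).[z t] - y0 * Re (perturbed h e).[z t].
  move=> hK; have [cR cI] := horner_continuous (perturbed h e) (cx t0) (cy t0).
  have /contP cc : {for t0, continuous (fun t => x0 * Im (perturbed h e).[z t] - y0 * Re (perturbed h e).[z t])}.
    apply: (@continuousD _ _ _ (fun t => x0 * Im (perturbed h e).[z t])).
      by apply: (@continuousM _ _ (fun=> x0)) => //; exact: cst_continuous.
    apply: (@continuousN _ _ _ (fun t => y0 * Re (perturbed h e).[z t])).
    by apply: (@continuousM _ _ (fun=> y0)) => //; exact: cst_continuous.
  have c40 : 0 < normc (z t0) ^+ 2 / 4 by rewrite divr_gt0.
  have [d d0 Hd] := cc _ c40; exists d => // t /Hd.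
  have := field_rotates hK ann; rewrite -/x0 -/y0 ltr_norml /c; lra.
have [d1 d10 H1] := loc hp hpK; have [d2 d20 H2] := loc hm hmK.
exists (Num.min d1 d2); first by rewrite lt_min d10.
move=> t1 t2 t10 t12 t2T; rewrite !lt_min => /andP[a1 a2] /andP[b1 b2].
have := H (- y0) x0 c t1 t2 t10 (ltW t12) t2T.
suff vel : forall t w, t1 <= t <= t2 -> filippov_velocity Fp Fm (z t) w -> c <= - y0 * Re w + x0 * Im w.
  move=> /(_ vel); have : 0 < c * (t2 - t1) by rewrite mulr_gt0// subr_gt0.
  by rewrite -/x0 -/y0; lra.
move=> t w ht [wp wm w0].
have h1 := H1 t; have h2 := H2 t.
have n1 : `|t - t0| < d1 by move: a1 b1; rewrite !ltr_norml; lra.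
have n2 : `|t - t0| < d2 by move: a2 b2; rewrite !ltr_norml; lra.
move: h1 h2 => /(_ n1) h1 /(_ n2) h2.
case: (ltrgt0P (Im (z t))) => yt.
- by rewrite wp//; lra.
- by rewrite wm//; lra.
- have [l /andP[l0 l1] ->] := w0 yt.
  move: h1 h2; case: (Fp.[z t]) => a b; case: (Fm.[z t]) => a' b' /= h1 h2.
  have k1 : l * c <= l * (x0 * b - y0 * a) by rewrite ler_wpM2l.
  have k2 : (1 - l) * c <= (1 - l) * (x0 * b' - y0 * a') by rewrite ler_wpM2l// subr_ge0.
  by lra.
Qed.

(** [Y / (N + X)] is the tangent of half the angle of [(X, Y)]. With [m = N + X] and [m' = N' + X']
    the cross product equals [m m' (1 + q q') (q' - q) / 2]; the last hypothesis holds for nearby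
    values. *)
Lemma half_angle_lt (N X Y N' X' Y' : R) : N ^+ 2 = X ^+ 2 + Y ^+ 2 -> N' ^+ 2 = X' ^+ 2 + Y' ^+ 2 ->
  0 < N + X -> 0 < N' + X' -> 0 < X * Y' - Y * X' ->
  0 < 1 + Y / (N + X) * (Y' / (N' + X')) -> Y / (N + X) < Y' / (N' + X').
Proof.
move=> E E' m0 m'0 cr; set q := Y / (N + X); set q' := Y' / (N' + X') => h.
have mn : N + X != 0 by rewrite gt_eqF.
have m'n : N' + X' != 0 by rewrite gt_eqF.
have Yq : Y = (N + X) * q by rewrite /q mulrC divfK.
have Y'q : Y' = (N' + X') * q' by rewrite /q' mulrC divfK.
have Xq : X = (N + X) * (1 - q ^+ 2) / 2.
  apply: (mulfI mn); have -> : (N + X) * ((N + X) * (1 - q ^+ 2) / 2) = ((N + X) ^+ 2 - ((N + X) * q) ^+ 2) / 2 by field.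
  have YN : Y ^+ 2 = N ^+ 2 - X ^+ 2 by rewrite E; ring.
  by rewrite -Yq YN; field.
have X'q : X' = (N' + X') * (1 - q' ^+ 2) / 2.
  apply: (mulfI m'n); have -> : (N' + X') * ((N' + X') * (1 - q' ^+ 2) / 2) = ((N' + X') ^+ 2 - ((N' + X') * q') ^+ 2) / 2 by field.
  have YN : Y' ^+ 2 = N' ^+ 2 - X' ^+ 2 by rewrite E'; ring.
  by rewrite -Y'q YN; field.
have : 0 < ((N + X) * (N' + X') / 2 * (1 + q * q')) * (q' - q).
  suff <- : X * Y' - Y * X' = (N + X) * (N' + X') / 2 * (1 + q * q') * (q' - q) by [].
  have -> : X * Y' - Y * X' = ((N + X) * (1 - q ^+ 2) / 2) * ((N' + X') * q')
     - ((N + X) * q) * ((N' + X') * (1 - q' ^+ 2) / 2) by rewrite -Xq -Y'q -Yq -X'q.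
  by field.
by rewrite pmulr_rgt0 ?subr_gt0// !mulr_gt0.
Qed.

(** If the ray of angle [phi] were missed, the half-angle tangent measured from the opposite ray
    would be defined all along the solution and strictly increasing, against periodicity. Here
    [X + i Y = - z exp (- i phi)], so [N + X] vanishes exactly on that ray. *)
Lemma fsol_angle T z phi : 0 < T -> fsol Fp Fm T z -> z T = z 0 ->
  (forall t, 0 <= t <= T -> annulus s0 (3 / 4) (z t)) ->
  exists2 t, 0 <= t <= T & z t = (normc (z t))%:C * cis phi.
Proof.
move=> T0 fz zT ann; apply: contrapT => noT.
pose c := cos phi; pose s := sin phi.
have cs : c ^+ 2 + s ^+ 2 = 1 by exact: cos2Dsin2.
pose N t := normc (z t).
pose X t := - (Re (z t) * c + Im (z t) * s).
pose Y t := - (Im (z t) * c - Re (z t) * s).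
have NE t : N t ^+ 2 = X t ^+ 2 + Y t ^+ 2.
  rewrite normc_sqr -[LHS]mulr1 -cs /X /Y; ring.
have m0 t : 0 <= t <= T -> 0 < N t + X t.
  move=> ht; have X1 : - N t <= X t.
    have : `|X t| <= N t.
      rewrite -(@ler_pXn2r _ 2)// ?nnegrE ?normc_ge0// sqr_absr NE lerDl sqr_ge0//.
    by rewrite ler_norml => /andP[].
  rewrite lt_def; apply/andP; split; last by lra.
  apply/eqP => E; apply: noT; exists t => //.
  have XN : X t = - N t by lra.
  have Y0 : Y t = 0.
    by apply/eqP; rewrite -sqrf_eq0; apply/eqP; have := NE t; rewrite XN sqrrN; lra.
  have hx : Re (z t) = N t * c.
    have -> : Re (z t) = - (X t) * c + Y t * s by rewrite /X /Y -[LHS]mulr1 -cs; ring.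
    by rewrite XN Y0; ring.
  have hy : Im (z t) = N t * s.
    have -> : Im (z t) = - (X t) * s - Y t * c by rewrite /X /Y -[LHS]mulr1 -cs; ring.
    by rewrite XN Y0; ring.
  by apply/eqP; rewrite eq_complex /= hx hy /N /c /s; apply/andP; split; apply/eqP; ring.
pose q t := Y t / (N t + X t).
have [cx cy _] := fz.
have cq t : 0 <= t <= T -> {for t, continuous q}.
  move=> ht.
  have M (f g : R -> R) : {for t, continuous f} -> {for t, continuous g} ->
    {for t, continuous (fun t => f t * g t)} by move=> cf cg; exact: (@continuousM _ _ f g).
  have D (f g : R -> R) : {for t, continuous f} -> {for t, continuous g} ->
    {for t, continuous (fun t => f t + g t)} by move=> cf cg; exact: (@continuousD _ _ _ f g).
  have Ne (f : R -> R) : {for t, continuous f} ->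
    {for t, continuous (fun t => - f t)} by move=> cf; exact: (@continuousN _ _ _ f).
  have C (k : R) : {for t, continuous (fun _ : R => k)} by exact: cst_continuous.
  have cX : {for t, continuous X}.
    exact: (Ne _ (D _ _ (M _ _ (cx t) (C c)) (M _ _ (cy t) (C s)))).
  have cY : {for t, continuous Y}.
    exact: (Ne _ (D _ _ (M _ _ (cy t) (C c)) (Ne _ (M _ _ (cx t) (C s))))).
  have cN : {for t, continuous N}.
    have -> : N = (fun t => Num.sqrt (Re (z t) * Re (z t) + Im (z t) * Im (z t))).
      by apply/funext => u; rewrite /N normcE !expr2.
    apply: (@continuous_comp _ _ _ (fun t => Re (z t) * Re (z t) + Im (z t) * Im (z t)) Num.sqrt).
      exact: (D _ _ (M _ _ (cx t) (cx t)) (M _ _ (cy t) (cy t))).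
    exact: sqrt_continuous.
  apply: (M _ _ cY); apply: continuousV; last exact: (D _ _ cN cX).
  by rewrite gt_eqF// m0.
have pos t t0 : `|q t - q t0| < (1 + `|q t0|)^-1 -> 0 < 1 + q t * q t0.
  move=> h; have b0 : 0 < 1 + `|q t0| by rewrite ltr_pwDl.
  have h1 : `|(q t - q t0) * q t0| < 1.
    rewrite normrM; apply: (@le_lt_trans _ _ (`|q t - q t0| * (1 + `|q t0|))).
      by rewrite ler_wpM2l// lerDr.
    by rewrite -ltr_pdivlMr// mul1r.
  by have := sqr_ge0 (q t0); move: h1; rewrite ltr_norml expr2; lra.
have : q 0 < q T.
  apply: (@real_induction R (fun t t' => q t < q t') 0 T T0).
  - by move=> ? ? ? _ _ _ _; exact: lt_trans.
  - move=> t0 /andP[t00 t0T]; have ht0 : 0 <= t0 <= T by lra.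
    have [d d0 Hd] := fsol_rotates fz (ann t0 ht0).
    have i0 : 0 < (1 + `|q t0|)^-1 by rewrite invr_gt0 ltr_pwDl.
    have /contP/(_ _ i0)[d' d'0 Hd'] := cq t0 ht0.
    exists (Num.min d d'); first by rewrite lt_min d0.
    move=> t /andP[t1 t2] tT.
    have t3 : t < t0 + d by apply: lt_le_trans t2 _; rewrite lerD2l ge_min lexx.
    have t4 : t < t0 + d' by apply: lt_le_trans t2 _; rewrite lerD2l ge_min lexx orbT.
    have ht : 0 <= t <= T by lra.
    apply: half_angle_lt (NE t0) (NE t) (m0 _ ht0) (m0 _ ht) _ _.
      have -> : X t0 * Y t - Y t0 * X t = (c ^+ 2 + s ^+ 2) *
         (Re (z t0) * (Im (z t) - Im (z t0)) - Im (z t0) * (Re (z t) - Re (z t0))).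
        by rewrite /X /Y; ring.
      rewrite cs mul1r; apply: Hd => //; first by rewrite subrr normr0.
      by rewrite gtr0_norm; lra.
    rewrite mulrC; apply: pos; apply: Hd'; rewrite gtr0_norm; lra.
  - move=> t0 /andP[t00 t0T]; have ht0 : 0 <= t0 <= T by lra.
    have [d d0 Hd] := fsol_rotates fz (ann t0 ht0).
    have i0 : 0 < (1 + `|q t0|)^-1 by rewrite invr_gt0 ltr_pwDl.
    have /contP/(_ _ i0)[d' d'0 Hd'] := cq t0 ht0.
    exists (Num.min d d'); first by rewrite lt_min d0.
    move=> t /andP[t2 t1] tT.
    have t3 : t0 - d < t by apply: le_lt_trans t2; rewrite lerD2l lerN2 ge_min lexx.
    have t4 : t0 - d' < t by apply: le_lt_trans t2; rewrite lerD2l lerN2 ge_min lexx orbT.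
    have ht : 0 <= t <= T by lra.
    apply: half_angle_lt (NE t) (NE t0) (m0 _ ht) (m0 _ ht0) _ _.
      have -> : X t * Y t0 - Y t * X t0 = (c ^+ 2 + s ^+ 2) *
         (Re (z t0) * (Im (z t0) - Im (z t)) - Im (z t0) * (Re (z t0) - Re (z t))).
        by rewrite /X /Y; ring.
      rewrite cs mul1r; apply: Hd => //; last by rewrite subrr normr0.
      by rewrite ltr0_norm; lra.
    by apply: pos; apply: Hd'; rewrite ltr0_norm; lra.
by rewrite /q /X /Y /N zT ltxx.
Qed.

End FilippovDynamics.

(** * Rigidity of periodic solutions: constancy of the weighted distance *)

Section Isolation.
Local Open Scope classical_set_scope.
Local Open Scope complex_scope.
Variable R : realType.
Local Notation normc := (@ComplexField.Normc.normc R).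
Local Notation Re := (@complex.Re R).
Local Notation Im := (@complex.Im R).

Lemma mirror_field (h : {poly R[i]}) (e : R) z :
  (perturbed (mirror h) e).[z^*] = - ((perturbed h e).[z])^*.
Proof.
have H : (map_poly conjc h).[z^*] = h.[z]^* by exact: horner_map.
rewrite /perturbed /mirror !hornerD !hornerZ !hornerX hornerN H.
case: (z) => x y; case: (h.[_])  => a b.
by apply/eqP; rewrite eq_complex /=; apply/andP; split; apply/eqP; ring.
Qed.

Variables (s0 K e : R) (hp hm : {poly R[i]}).
Hypotheses (he : `|e| * K <= 1 / 80) (hpK : kbound hp s0 K) (hmK : kbound hm s0 K)
  (gK : kbound (mirror hm) s0 K).
Local Notation Fp := (perturbed hp e).
Local Notation Fm := (perturbed hm e).
Variables (V W : R -> R -> R).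
Hypotheses (hV : first_integral hp s0 e V) (hW : first_integral (mirror hm) s0 e W).

Section Solution.
Variables (T : R) (z : R -> R[i]).
Hypotheses (T0 : 0 < T) (fz : fsol Fp Fm T z)
  (ann : forall t, 0 <= t <= T -> annulus s0 (3 / 4) (z t)).

Lemma upper_level a b : 0 <= a -> a <= b -> b <= T -> (forall t, a < t < b -> 0 < Im (z t)) ->
  levelz V (z b) = levelz V (z a).
Proof.
move=> a0 ab bT up; have [cx cy _] := fz.
apply: (levelz_const (sp := 1) hpK he hV ab cx cy).
  by move=> t ht; apply: ann; lra.
move=> t ht; have [|d1 d2] := fsol_derive fz a0 bT ht (F := Fp).
  by move=> u w hu [wp _ _]; apply: wp; exact: up.
by rewrite !mul1r; split => //; exact: up.
Qed.

Lemma lower_level a b : 0 <= a -> a <= b -> b <= T -> (forall t, a < t < b -> Im (z t) < 0) ->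
  levelz W (z b)^* = levelz W (z a)^*.
Proof.
move=> a0 ab bT lo; have [cx cy _] := fz.
have reE : Re \o (fun t => (z t)^*) = Re \o z by apply/funext => t /=; case: (z t).
have imE : Im \o (fun t => (z t)^*) = (fun t => - Im (z t)) by apply/funext => t /=; case: (z t).
apply: (levelz_const (z := fun t => (z t)^*) (sp := -1) gK he hW ab).
- by move=> t; rewrite reE; exact: cx.
- by move=> t; rewrite imE; exact: (@continuousN _ _ _ (Im \o z) t (cy t)).
- by move=> t ht; apply/annulus_conj; apply: ann; lra.
move=> t ht; have [|d1 d2] := fsol_derive fz a0 bT ht (F := Fm).
  by move=> u w hu [_ wm _]; apply: wm; exact: lo.
have y0 := lo t ht; rewrite reE imE mirror_field; split.
- by move: y0; case: (z t) => x y /=; rewrite oppr_gt0.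
- by apply: derive_eq d1 _; case: (Fm.[z t]) => x y /=; ring.
- have d3 : is_derive t 1 (fun t => - Im (z t)) (- Im Fm.[z t]) by exact: is_deriveN d2.
  by apply: derive_eq d3 _; case: (Fm.[z t]) => x y /=; ring.
Qed.

(** On the axis the rotation decides: a solution leaves the positive half-axis upwards and the
    negative one downwards, at once. Thus, near each time and on each side of it, the solution lies
    in one open half-plane, with no accumulation of crossings. *)
Lemma sign_right t0 : 0 <= t0 < T -> exists2 d, 0 < d &
  (forall t, t0 < t < t0 + d -> t <= T -> 0 < Im (z t)) /\ (0 < Im (z t0) \/ Im (z t0) = 0 /\ 0 < Re (z t0))
  \/ (forall t, t0 < t < t0 + d -> t <= T -> Im (z t) < 0) /\ (Im (z t0) < 0 \/ Im (z t0) = 0 /\ Re (z t0) < 0).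
Proof.
move=> ht; have ht' : 0 <= t0 <= T by lra.
have [_ cy _] := fz; have /contP cI := cy t0.
have [d d0 Hd] := fsol_rotates he hpK hmK fz (ann ht').
have cr t : t0 < t < t0 + d -> t <= T -> 0 < Re (z t0) * (Im (z t) - Im (z t0)) - Im (z t0) * (Re (z t) - Re (z t0)).
  move=> h1 h2; apply: Hd; [lra|lra|by []|by rewrite subrr normr0|by rewrite gtr0_norm; lra].
case: (ltrgt0P (Im (z t0))) => y0.
- have [d' d'0 Hd'] := cI _ y0; exists d' => //; left; split; last by left.
  move=> t h1 h2; have := Hd' t; rewrite /= gtr0_norm; last by lra.
  by move=> h3; have := h3 ltac:(lra); rewrite ltr_norml; lra.
- have y0' : 0 < - Im (z t0) by lra.
  have [d' d'0 Hd'] := cI _ y0'; exists d' => //; right; split; last by left.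
  move=> t h1 h2; have := Hd' t; rewrite /= gtr0_norm; last by lra.
  by move=> h3; have := h3 ltac:(lra); rewrite ltr_norml; lra.
- have [x0|x0|x0] := ltrgt0P (Re (z t0)).
  + exists d => //; left; split; last by right.
    by move=> t h1 h2; have := cr t h1 h2; rewrite y0 mul0r !subr0 pmulr_rgt0.
  + exists d => //; right; split; last by right.
    by move=> t h1 h2; have := cr t h1 h2; rewrite y0 mul0r !subr0 nmulr_rgt0.
  + have := annulus_gt0 (ann ht'); rewrite normcE x0 y0 !expr0n addr0 sqrtr0 ltxx //.
Qed.

Lemma sign_left t0 : 0 < t0 <= T -> exists2 d, 0 < d &
  (forall t, t0 - d < t < t0 -> 0 <= t -> 0 < Im (z t)) /\ (0 < Im (z t0) \/ Im (z t0) = 0 /\ Re (z t0) < 0)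
  \/ (forall t, t0 - d < t < t0 -> 0 <= t -> Im (z t) < 0) /\ (Im (z t0) < 0 \/ Im (z t0) = 0 /\ 0 < Re (z t0)).
Proof.
move=> ht; have ht' : 0 <= t0 <= T by lra.
have [_ cy _] := fz; have /contP cI := cy t0.
have [d d0 Hd] := fsol_rotates he hpK hmK fz (ann ht').
have cr t : t0 - d < t < t0 -> 0 <= t -> 0 < Re (z t0) * (Im (z t0) - Im (z t)) - Im (z t0) * (Re (z t0) - Re (z t)).
  move=> h1 h2; apply: Hd; [by []|lra|lra|by rewrite ltr0_norm; lra|by rewrite subrr normr0].
case: (ltrgt0P (Im (z t0))) => y0.
- have [d' d'0 Hd'] := cI _ y0; exists d' => //; left; split; last by left.
  move=> t h1 h2; have := Hd' t; rewrite /= ltr0_norm; last by lra.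
  by move=> h3; have := h3 ltac:(lra); rewrite ltr_norml; lra.
- have y0' : 0 < - Im (z t0) by lra.
  have [d' d'0 Hd'] := cI _ y0'; exists d' => //; right; split; last by left.
  move=> t h1 h2; have := Hd' t; rewrite /= ltr0_norm; last by lra.
  by move=> h3; have := h3 ltac:(lra); rewrite ltr_norml; lra.
- have [x0|x0|x0] := ltrgt0P (Re (z t0)).
  + exists d => //; right; split; last by right.
    by move=> t h1 h2; have := cr t h1 h2; rewrite y0 mul0r subr0 sub0r pmulr_rgt0// oppr_gt0.
  + exists d => //; left; split; last by right.
    by move=> t h1 h2; have := cr t h1 h2; rewrite y0 mul0r subr0 sub0r nmulr_rgt0// oppr_lt0.
  + have := annulus_gt0 (ann ht'); rewrite normcE x0 y0 !expr0n addr0 sqrtr0 ltxx //.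
Qed.

Variables (c1 c2 la sn s sg : R).
Hypotheses (la0 : 0 < la).
Hypothesis pos_ax : forall x : R, 0 < x -> (exists2 t, 0 <= t <= T & z t = x%:C) ->
  (ln x = s -> V (ln x) 0 = c1) /\
  (ln x != s -> sn * (la * `|W (ln x) 0 - c2|) < sn * `|V (ln x) 0 - c1|) /\
  (sn * (la * `|W (ln x) 0 - c2|) <= sn * `|V (ln x) 0 - c1|).
Hypothesis neg_ax : forall x : R, 0 < x -> (exists2 t, 0 <= t <= T & z t = (- x)%:C) ->
  sn * `|V (ln x) pi - c1| <= sn * (la * `|W (ln x) pi - c2|).
Hypothesis sn0 : sn != 0.
Hypothesis zT : z T = z 0.

(** Locally constant off the axis, with jumps in the direction of [sn] on it. On the axis it takes
    the upper value, so only the arrival at the positive half-axis and the departure from the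
    negative one can be jumps. *)
Let Y t := if 0 <= Im (z t) then `|levelz V (z t) - c1| else la * `|levelz W (z t)^* - c2|.

Let Yp t : 0 <= Im (z t) -> Y t = `|levelz V (z t) - c1|.
Proof. by rewrite /Y => ->. Qed.

Let Yn t : Im (z t) < 0 -> Y t = la * `|levelz W (z t)^* - c2|.
Proof. by rewrite /Y ltNge => /negbTE ->. Qed.

Lemma levelz_pos (U : R -> R -> R) x : 0 < x -> levelz U x%:C = U (ln x) 0.
Proof.
move=> x0; rewrite /levelz /argz normcE /= expr0n addr0 sqrtr_sqr gtr0_norm//.
by rewrite divff ?gt_eqF// acos1.
Qed.

Lemma levelz_neg (U : R -> R -> R) x : 0 < x -> levelz U (- x)%:C = U (ln x) pi.
Proof.
move=> x0; rewrite /levelz /argz normcE /= expr0n addr0 sqrtr_sqr normrN gtr0_norm//.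
by rewrite mulNr divff ?gt_eqF// acosN1.
Qed.

Lemma real_conj (w : R[i]) : Im w = 0 -> w = (Re w)%:C /\ w^* = (Re w)%:C.
Proof. by case: w => x y /= ->; rewrite oppr0. Qed.

Let right_ok t0 : 0 <= t0 < T -> exists2 d, 0 < d &
  forall t, t0 < t < t0 + d -> t <= T -> sn * Y t0 <= sn * Y t.
Proof.
move=> ht; have [d d0 [[up H]|[lo H]]] := sign_right ht; exists d => // t h1 h2.
  have y0 : 0 <= Im (z t0) by case: H => [|[->]]; lra.
  have yt := up t h1 h2.
  rewrite (Yp y0) (Yp (ltW yt)) (@upper_level t0 t)//; try lra.
  by move=> u hu; apply: up; lra.
have yt := lo t h1 h2.
have E : levelz W (z t)^* = levelz W (z t0)^*.
  by apply: lower_level; [lra|lra|lra|move=> u hu; apply: lo; lra].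
rewrite (Yn yt) E; case: H => [y0|[y0 x0]]; first by rewrite (Yn y0).
rewrite Yp ?y0//; have [E1 E2] := real_conj y0.
move: E1 E2 x0; set r := Re (z t0) => E1 E2 x0.
have x0' : 0 < - r by rewrite oppr_gt0.
rewrite E2 E1 -[r]opprK !levelz_neg//; apply: neg_ax => //.
by exists t0; rewrite ?opprK//; lra.
Qed.

Let left_ok t0 : 0 < t0 <= T -> exists2 d, 0 < d &
  forall t, t0 - d < t < t0 -> 0 <= t -> sn * Y t <= sn * Y t0.
Proof.
move=> ht; have [d d0 [[up H]|[lo H]]] := sign_left ht; exists d => // t h1 h2.
  have y0 : 0 <= Im (z t0) by case: H => [|[->]]; lra.
  have yt := up t h1 h2.
  rewrite (Yp y0) (Yp (ltW yt)) (@upper_level t t0)//; try lra.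
  by move=> u hu; apply: up; lra.
have yt := lo t h1 h2.
have E : levelz W (z t0)^* = levelz W (z t)^*.
  by apply: lower_level; [lra|lra|lra|move=> u hu; apply: lo; lra].
rewrite (Yn yt) -E; case: H => [y0|[y0 x0]]; first by rewrite (Yn y0).
rewrite (Yp (t := t0)) ?y0//; have [E1 E2] := real_conj y0.
move: E1 E2 x0; set r := Re (z t0) => E1 E2 x0.
rewrite E2 E1 !levelz_pos//; apply: (pos_ax _ _).2.2 => //.
by exists t0 => //; lra.
Qed.

Let mono a b : 0 <= a -> a <= b -> b <= T -> sn * Y a <= sn * Y b.
Proof.
move=> a0; rewrite le_eqVlt => /predU1P[->//|ab] bT.
apply: (@real_induction R (fun t t' => sn * Y t <= sn * Y t') a b ab).
- by move=> ? ? ? _ _ _ _; exact: le_trans.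
- move=> x hx; have [|d d0 H] := @right_ok x; first by lra.
  by exists d => // y h1 h2; apply: H => //; lra.
- move=> x hx; have [|d d0 H] := @left_ok x; first by lra.
  by exists d => // y h1 h2; apply: H => //; lra.
Qed.

Lemma periodic_level t : 0 <= t <= T ->
  (0 <= Im (z t) -> levelz V (z t) = c1) /\ (Im (z t) < 0 -> levelz W (z t)^* = c2).
Proof.
have Yc u : 0 <= u <= T -> Y u = Y 0.
  move=> /andP[u0 uT]; apply: (mulfI sn0); apply/eqP; rewrite eq_le (mono (lexx 0) u0 uT) andbT.
  have -> : Y 0 = Y T by rewrite /Y zT.
  exact: mono.
suff Y0 : Y 0 = 0.
  move=> ht; have := Yc t ht; rewrite Y0 /Y; case: leP => [y0 /eqP|y0 /eqP]; rewrite ?mulf_eq0 ?(gt_eqF la0) /=.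
    by rewrite normr_eq0 subr_eq0 => /eqP.
  by rewrite normr_eq0 subr_eq0 => /eqP.
have [t0 ht0 E0] := fsol_angle he hpK hmK 0 T0 fz zT ann.
(* The jump at the crossing is read from its left, so a crossing at time [0] is moved to time
   [T]. *)
have [t1 ht1 E1] : exists2 t1, 0 < t1 <= T & z t1 = (normc (z t1))%:C.
  have E : z t0 = (normc (z t0))%:C by rewrite {1}E0 /cis cos0 sin0 mulr1.
  have [t00|] := ltP 0 t0; first by exists t0; rewrite ?t00//; lra.
  move=> h; have t00 : t0 = 0 by lra.
  by exists T; rewrite ?T0 ?lexx// zT -t00.
have x0 : 0 < normc (z t1) by apply: annulus_gt0 (ann _); lra.
set x := normc (z t1) in x0 E1.
have hx : exists2 t, 0 <= t <= T & z t = x%:C by exists t1 => //; lra.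
have [p1 [p2 p3]] := pos_ax x0 hx.
have Y1 : Y t1 = `|V (ln x) 0 - c1| by rewrite Yp E1 ?lexx//= levelz_pos.
have [sx|sx] := eqVneq (ln x) s.
  by rewrite -(Yc t1); [rewrite Y1 p1// subrr normr0|lra].
have [d d0 [[_ H]|[lo _]]] := sign_left ht1.
  by move: H; rewrite E1 /= ltxx => -[//|[_]]; rewrite ltNge (ltW x0).
(* A time just before the crossing, spent below the axis. Unless [ln x = s] the jump there is
   strict, which contradicts the constancy of [Y]. *)
pose t2 := Num.max 0 (t1 - d / 2).
have t12 : t1 - d < t2 < t1 by rewrite /t2; case: (leP 0 (t1 - d / 2)) => h; lra.
have t00 : 0 <= t2 by rewrite /t2 le_max lexx.
have yt := lo t2 t12 t00.
have E : levelz W (z t1)^* = levelz W (z t2)^*.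
  by apply: lower_level; [lra|lra|lra|move=> u hu; apply: lo; lra].
have Yt : Y t2 = la * `|W (ln x) 0 - c2|.
  by rewrite (Yn yt) -E E1 /= oppr0 levelz_pos.
have := p2 sx; rewrite -Y1 -Yt !Yc ?ltxx//; lra.
Qed.

End Solution.

(** The second solution meets every ray, and on a given ray the level determines the radius: this
    replaces uniqueness of solutions. *)
Lemma level_images (T T' : R) (z z' : R -> R[i]) (c1 c2 : R) : 0 < T' ->
  (forall t, 0 <= t <= T -> annulus s0 (3 / 4) (z t)) ->
  (forall t, 0 <= t <= T -> (0 <= Im (z t) -> levelz V (z t) = c1) /\
     (Im (z t) < 0 -> levelz W (z t)^* = c2)) ->
  fsol Fp Fm T' z' -> z' T' = z' 0 -> (forall t, 0 <= t <= T' -> annulus s0 (3 / 4) (z' t)) ->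
  (forall t, 0 <= t <= T' -> (0 <= Im (z' t) -> levelz V (z' t) = c1) /\
     (Im (z' t) < 0 -> levelz W (z' t)^* = c2)) ->
  z @` `[0, T] `<=` z' @` `[0, T'].
Proof.
move=> T'0 ann lev fz' zT' ann' lev' w [t]; rewrite /= in_itv /= => ht <-.
have /annulus_ln[n0 hn] := ann t ht.
have [phi E] := polar_exists n0.
have [t' ht' E'] := fsol_angle he hpK hmK phi T'0 fz' zT' ann'.
exists t'; first by rewrite /= in_itv.
have /annulus_ln[n0' hn'] := ann' t' ht'.
set N := normc (z t) in n0 hn E; set N' := normc (z' t') in n0' hn' E'.
have p0 := pi_gt0 R.
suff LN : ln N' = ln N.
  have NN : N' = N by rewrite -(lnK n0') LN lnK.
  by rewrite E' NN -E.
have argE (x : R) : 0 < x -> argz (x%:C * cis phi) = acos (cos phi).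
  by move=> x0; rewrite /argz normc_polar ?ltW// /= mul0r subr0 mulrC mulKf ?gt_eqF.
have argcE (x : R) : 0 < x -> argz (x%:C * cis phi)^* = acos (cos phi).
  move=> x0; have -> : (x%:C * cis phi)^* = x%:C * cis (- phi).
    by apply/eqP; rewrite eq_complex /= cosN sinN; apply/andP; split; apply/eqP; ring.
  by rewrite /argz normc_polar ?ltW// /= cosN mul0r subr0 mulrC mulKf ?gt_eqF.
have imE (x : R) : Im (x%:C * cis phi) = x * sin phi by rewrite /= mul0r addr0.
have th1 : -1 < acos (cos phi).
  by have := @acos_ge0 R (cos phi); rewrite cos_geN1 cos_le1 => /(_ isT); lra.
have [l1 l2] := lev t ht; have [l1' l2'] := lev' t' ht'.
have [sp|sp] := leP 0 (sin phi).
  apply: (level_inj hpK he hV hn' hn th1).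
  have y1 : 0 <= Im (z t) by rewrite E imE mulr_ge0// ltW.
  have y2 : 0 <= Im (z' t') by rewrite E' imE mulr_ge0// ltW.
  have := l1 y1; have := l1' y2; rewrite /levelz -/N -/N'.
  by rewrite [z t]E [z' t']E' !argE// => -> ->.
apply: (level_inj gK he hW hn' hn th1).
have y1 : Im (z t) < 0 by rewrite E imE pmulr_rlt0.
have y2 : Im (z' t') < 0 by rewrite E' imE pmulr_rlt0.
have := l2 y1; have := l2' y2; rewrite /levelz !normc_conj -/N -/N'.
by rewrite [z t]E [z' t']E' !argcE// => -> ->.
Qed.

End Isolation.

(** * Construction of the periodic orbit *)

Section Clock.
Local Open Scope classical_set_scope.

(** With [f] the time spent per unit of angle, [Tm] is time as a function of the angle and [Th] its
    inverse. The interval [(-1, 5)] contains [[0, pi]] with room, so derivatives at both ends are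
    two-sided. *)
Lemma clock_exists (R : realType) (f : R -> R) :
  (forall t : R, -1 < t < 5 -> {for t, continuous f} /\ 1 / 2 <= f t) ->
  exists tau (Th : R -> R), [/\ 0 < tau, Th 0 = 0, Th tau = pi,
    forall t : R, 0 <= t <= tau -> -1 < Th t < 5 /\ is_derive t 1 Th (f (Th t))^-1
    & forall t : R, 0 < t < tau -> 0 < Th t < pi].
Proof.
move=> fP.
have p4 : pi < 4 :> R by have /andP[_ h1] := pihalf_02 R; lra.
have p0 := pi_gt0 R.
pose Tm t := \int[@lebesgue_measure R]_(x in `[-1 / 2, t]) f x.
have dT (t : R) : -1 / 2 < t < 19 / 4 -> is_derive t 1 Tm (f t).
  move=> ht; apply: (@ftc1 _ _ _ (39 / 8)); first by lra.
  by move=> y hy; apply: (fP y _).1; lra.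
have Tmvt t t' : -1 / 4 <= t <= 9 / 2 -> -1 / 4 <= t' <= 9 / 2 ->
    exists2 c, -1 / 4 <= c <= 9 / 2 & Tm t' - Tm t = f c * (t' - t).
  move=> ht ht'; have [|c cb E] := @mvt R Tm f t t'.
    by move=> x; case: (ltP t t') => hlt hx; apply: dT; lra.
  by exists c => //; move: cb; case: (ltP t t') => hlt hx; lra.
have Tlt t t' : -1 / 4 <= t <= 9 / 2 -> -1 / 4 <= t' <= 9 / 2 -> t <= t' ->
    1 / 2 * (t' - t) <= Tm t' - Tm t.
  move=> ht ht' tt; have [c hc ->] := Tmvt t t' ht ht'.
  have f1 : 1 / 2 <= f c by apply: (fP c _).2; lra.
  by rewrite ler_wpM2r// subr_ge0.
pose t0 := Tm 0; pose tau := Tm pi - t0.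
have h0 : -1 / 4 <= (0 : R) <= 9 / 2 by lra.
have hpi : -1 / 4 <= (pi : R) <= 9 / 2 by lra.
have hm : -1 / 4 <= (-1 / 4 : R) <= 9 / 2 by lra.
have hM : -1 / 4 <= (9 / 2 : R) <= 9 / 2 by lra.
have tau0 : 0 < tau by have := Tlt 0 pi h0 hpi (ltW p0); rewrite /tau /t0; lra.
have em : Tm (-1 / 4) - t0 <= -1 / 8.
  have hle : -1 / 4 <= 0 :> R by lra.
  by have := Tlt _ _ hm h0 hle; rewrite /t0; lra.
have eM : tau + 1 / 4 <= Tm (9 / 2) - t0.
  have hle : pi <= 9 / 2 :> R by lra.
  by have := Tlt _ _ hpi hM hle; rewrite /tau; lra.
have [Th hTh] : exists Th : R -> R, forall t : R, -1 / 8 <= t <= tau + 1 / 4 ->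
    -1 / 4 <= Th t <= 9 / 2 /\ Tm (Th t) = t + t0.
  suff /choice[Th H] : forall t : R, exists th, -1 / 8 <= t <= tau + 1 / 4 ->
    -1 / 4 <= th <= 9 / 2 /\ Tm th = t + t0 by exists Th.
  move=> t; case: (pselect (-1 / 8 <= t <= tau + 1 / 4)) => [ht|n]; last by exists 0.
  have [|x hx||c cb E] := @ivt_incr R Tm (-1 / 4) (9 / 2) (t + t0); first by lra.
  - by apply: derive_cont (dT x _); lra.
  - by lra.
  - by exists c.
have Tinj x y : -1 / 4 <= x <= 9 / 2 -> -1 / 4 <= y <= 9 / 2 -> Tm x = Tm y -> x = y.
  move=> hx hy E; case: (ltrgtP x y) => // hlt.
    by have := Tlt x y hx hy (ltW hlt); rewrite E; lra.
  by have := Tlt y x hy hx (ltW hlt); rewrite E; lra.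
have Th0 : Th 0 = 0.
  have [|h1 h2] := hTh 0; first by lra.
  by apply: Tinj => //; rewrite h2 add0r.
have Thtau : Th tau = pi.
  have [|h1 h2] := hTh tau; first by lra.
  by apply: Tinj => //; rewrite h2 /tau subrK.
have dTh (t : R) : 0 <= t <= tau -> is_derive t 1 Th (f (Th t))^-1.
  move=> ht; have ht' : -1 / 8 <= t <= tau + 1 / 4 by lra.
  have [h1 h2] := hTh t ht'.
  have near (y : R) : `|y - t| < 1 / 8 -> -1 / 8 <= y <= tau + 1 / 4 by rewrite ltr_norml; lra.
  have c0 : 0 < 1 / 2 :> R by lra.
  have r0 : 0 < 1 / 8 :> R by lra.
  have hTt : -1 < Th t < 5 by lra.
  have fn : f (Th t) != 0 by have := (fP (Th t) hTt).2; lra.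
  have dTt : is_derive (Th t) 1 Tm (f (Th t)) by apply: dT; lra.
  have := @implicit_derive R Tm (fun t => t + t0) Th t (1 / 2) (f (Th t)) _ (1 / 8) c0 r0 _ _ dTt fn
    (derive_add (derive_id t) (derive_const t0 t)).
  move=> H; apply: derive_eq (H _ _) _.
  - by move=> y /near /hTh[].
  - move=> y /near /hTh[h3 h4]; have [c hc ->] := Tmvt (Th t) (Th y) h1 h3.
    have f1 : 1 / 2 <= f c by apply: (fP c _).2; lra.
    by rewrite normrM ler_wpM2r// (le_trans f1)// ler_norm.
  - by rewrite addr0 div1r.
have Thb t : 0 < t < tau -> 0 < Th t < pi.
  move=> ht; have [|h1 h2] := hTh t; first by lra.
  apply/andP; split; rewrite ltNge; apply/negP => hle.
    by have := Tlt _ _ h1 h0 hle; rewrite h2 -/t0; lra.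
  by have := Tlt _ _ hpi h1 hle; rewrite h2; move: ht; rewrite /tau; lra.
have Thc (t : R) : 0 <= t <= tau -> -1 < Th t < 5.
  by move=> ht; have [|h1 _] := hTh t; lra.
exists tau, Th; split=> // t ht.
by split; [exact: Thc|exact: dTh].
Qed.

End Clock.

(** * Half orbits parametrised from level curves *)

Section Arc.
Local Open Scope classical_set_scope.
Local Open Scope complex_scope.
Variable R : realType.
Local Notation normc := (@ComplexField.Normc.normc R).
Local Notation Re := (@complex.Re R).
Local Notation Im := (@complex.Im R).
Variables (h : {poly R[i]}) (s0 K : R).
Hypothesis hK : kbound h s0 K.
Variables (e : R) (V : R -> R -> R).
Hypotheses (he : `|e| * K <= 1 / 80) (hV : first_integral h s0 e V).

Let K0 : 0 < K. Proof. by case: hK. Qed.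

Section Level.
Variables (s : R) (S : R -> R).
Hypothesis hs : `|s - s0| < 1 / 2.
Hypothesis hS : forall t : R, -1 < t <= 5 -> `|S t - s| <= 20 * K * `|e| /\ V (S t) t = V s 0.

Let d1 : 20 * K * `|e| <= 1 / 4.
Proof. by rewrite (_ : 20 * K * `|e| = 20 * (`|e| * K)); [move: he; lra|ring]. Qed.

Let inS (t : R) : -1 < t <= 5 -> `|S t - s0| < 3 / 4.
Proof.
move=> /hS [h1 _]; have h2 := d1; move: h1 hs; rewrite ler_norml !ltr_norml; lra.
Qed.

Let lipS (t t' : R) : -1 < t <= 5 -> -1 < t' <= 5 -> `|S t' - S t| <= 4 * K * `|e| * `|t' - t|.
Proof.
move=> ht ht'; have t1 : -1 < t by lra.
have t1' : -1 < t' by lra.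
have := level_expand hK he hV (inS ht) (inS ht') t1'.
have := level_angle hK he hV (inS ht) t1 t1'.
rewrite (hS ht').2 -(hS ht).2 (distrC (V (S t) t)); lra.
Qed.

(** Implicit differentiation of [V (S t) t]. The increment in [s] is a mean value slope [kim] at
    [c t'], continuous by the joint continuity of [kim]; the increment in [t] is taken at the fixed
    radius [S t], through a Caratheodory slope. *)
Lemma level_derive (t : R) : -1 < t < 5 -> is_derive t 1 S (kre h e (S t) t / kim h e (S t) t).
Proof.
move=> ht; have ht4 : -1 < t <= 5 by lra.
have t1 : -1 < t by lra.
have iS := inS ht4; have iS1 : `|S t - s0| <= 1 by lra.
have iS2 : `|S t - s0| < 1 by lra.
have hk := kim_bounds hK t he iS1.
have kn : kim h e (S t) t != 0 by lra.
have [g [gE gc gt]] := (is_derive1_caratheodory _ _ _).1 (hV iS t1).2.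
pose A (t' : R) := -1 < t' <= 5.
have [c cP] : exists c : R -> R, forall t' : R, A t' ->
    V (S t') t' - V (S t) t' = kim h e (c t') t' * (S t' - S t) /\
    Num.min (S t) (S t') <= c t' <= Num.max (S t) (S t').
  suff /choice[c H] : forall t' : R, exists c, A t' ->
    V (S t') t' - V (S t) t' = kim h e c t' * (S t' - S t) /\
    Num.min (S t) (S t') <= c <= Num.max (S t) (S t') by exists c.
  move=> t'; case: (pselect (A t')) => [ht'|n]; last by exists 0.
  have t1' : -1 < t' by have /andP[] := ht'.
  have [c cb E] := level_mvt hV iS (inS ht') t1'.
  by exists c.
have cc (t' : R) : A t' -> `|c t' - S t| <= `|S t' - S t| /\ `|c t' - s0| <= 1.
  move=> ht'; have [_] := cP t' ht'; have := inS ht'; move: iS.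
  case: (ltP (S t) (S t')) => hlt h1 h2 h3; split.
  - by rewrite !ger0_norm; lra.
  - by move: h1 h2; rewrite !ltr_norml ler_norml; lra.
  - by rewrite !ler0_norm; lra.
  - by move: h1 h2; rewrite !ltr_norml ler_norml; lra.
pose w t' := kim h e (c t') t'.
have tA (t' : R) : `|t' - t| < Num.min (t + 1) (5 - t) -> A t'.
  by rewrite lt_min !ltr_norml /A; lra.
have r0 : 0 < Num.min (t + 1) (5 - t) by rewrite lt_min; lra.
have c00 : c t = S t.
  by have [] := cc t ht4; rewrite subrr normr0 normr_le0 subr_eq0 => /eqP.
have cw : {for t, continuous w}.
  apply/contP => e' e'0.
  have [d d0 Hd] := kim_jcont hK he t iS2 e'0.
  have k0 : 0 < 4 * K * `|e| + 1 by rewrite ltr_pwDr// !mulr_ge0// ltW.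
  exists (Num.min (Num.min (t + 1) (5 - t)) (Num.min d (d / (4 * K * `|e| + 1)))).
    by rewrite lt_min r0 lt_min d0 divr_gt0.
  move=> t'; rewrite lt_min => /andP[/tA ht']; rewrite lt_min ltr_pdivlMr// => /andP[y1 y2].
  rewrite /w c00; apply: Hd => //; have [h1 _] := cc t' ht'.
  apply: le_lt_trans h1 _; apply: le_lt_trans (lipS ht4 ht') _.
  by have := normr_ge0 (t' - t); lra.
have H : is_derive t 1 (fun t' => S t + (- g t' / w t') * (t' - t)) (kre h e (S t) t / kim h e (S t) t).
  suff H0 : is_derive t 1 (fun t' => (- g t' / w t') * (t' - t)) (kre h e (S t) t / kim h e (S t) t).
    by apply: derive_eq (derive_add (derive_const (S t) t) H0) _; rewrite add0r.
  apply/is_derive1_caratheodory; exists (fun t' => - g t' / w t'); split.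
  - by move=> z; rewrite subrr mulr0 subr0.
  - apply: (@continuousM _ _ (fun t' => - g t') (fun t' => (w t')^-1)).
      exact: (@continuousN _ _ _ g).
    by apply: continuousV => //; rewrite /w c00.
  - by rewrite gt opprK /w c00.
apply: derive_near r0 _ H => t' /tA ht'.
have [E1 _] := cP t' ht'; have [_ hc] := cc t' ht'.
have w0 : w t' != 0 by rewrite /w; have := kim_bounds hK t' he hc; lra.
have E2 : w t' * (S t' - S t) = - g t' * (t' - t).
  rewrite mulNr -gE -E1 (hS ht').2 -(hS ht4).2; ring.
by rewrite mulrAC -E2 mulrAC mulfV// mul1r addrC subrK.
Qed.

End Level.

(** The curve of constant level is already the trajectory as a set; running along it with the right
    clock makes it a solution. *)
Lemma arc_exists s : `|s - s0| < 1 / 2 -> exists tau s' z, [/\ 0 < tau,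
  forall t : R, 0 <= t <= tau -> is_derive t 1 (Re \o z) (Re (perturbed h e).[z t]) /\
     is_derive t 1 (Im \o z) (Im (perturbed h e).[z t]),
  [/\ z 0 = (expR s)%:C, z tau = (- expR s')%:C, `|s' - s| <= 20 * K * `|e| & V s' pi = V s 0],
  forall t : R, 0 < t < tau -> 0 < Im (z t) &
  forall t : R, 0 <= t <= tau -> 0 < normc (z t) /\ `|ln (normc (z t)) - s| <= 20 * K * `|e|].
Proof.
move=> hs.
have p4 : pi < 4 :> R by have /andP[_ h1] := pihalf_02 R; lra.
have p0 := pi_gt0 R.
have n10 : -1 < 0 :> R by lra.
have [S hS] : exists S : R -> R, forall t : R, -1 < t <= 5 -> `|S t - s| <= 20 * K * `|e| /\ V (S t) t = V s 0.
  suff /choice[S H] : forall t : R, exists s', -1 < t <= 5 -> `|s' - s| <= 20 * K * `|e| /\ V s' t = V s 0 by exists S.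
  move=> t; case: (pselect (-1 < t <= 5)) => [ht|n]; last by exists 0.
  have t1 : -1 < t by lra.
  have t5 : `|t - 0| <= 5 by rewrite subr0 ler_norml; lra.
  have [s' h1 h2] := level_exists hK he hV hs n10 t1 t5.
  by exists s'.
have dS := level_derive hs hS.
have d1 : 20 * K * `|e| <= 1 / 4.
  by rewrite (_ : 20 * K * `|e| = 20 * (`|e| * K)); [move: he; lra|ring].
have inS (t : R) : -1 < t <= 5 -> `|S t - s0| <= 1.
  by move=> /hS [h1 _]; move: h1 hs; rewrite !ler_norml !ltr_norml; lra.
(* Time per unit of angle: the angular velocity of the field is [1 + e * kb]. *)
pose f t := (1 + e * kb h (S t) t)^-1.
have fb (t : R) : -1 < t <= 5 -> 79 / 80 <= 1 + e * kb h (S t) t <= 81 / 80.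
  by move=> ht; have [_] := small_k hK t he (inS t ht); rewrite ler_norml; lra.
have fb2 (t : R) : -1 < t <= 5 -> 1 / 2 <= f t <= 2.
  move=> /fb /andP[h1 h2]; have b0 : 0 < 1 + e * kb h (S t) t by lra.
  by rewrite /f -[X in _ <= X <= _]mul1r ler_pdivlMr// ler_pdivrMr//; lra.
have cf (t : R) : -1 < t < 5 -> {for t, continuous f}.
  move=> ht; have ht4 : -1 < t <= 5 by lra.
  have cS := derive_cont (dS t ht).
  apply: continuousV; first by have := fb t ht4; lra.
  apply: (@continuousD _ _ _ (fun=> (1 : R)) (fun t => e * kb h (S t) t)); first exact: cst_continuous.
  apply: (@continuousM _ _ (fun=> e) (fun t => kb h (S t) t)); first exact: cst_continuous.
  have /contP cS' := cS; apply/contP => e' e'0.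
  have K20 : 0 < 2 * K + 1 by rewrite ltr_pwDr// mulr_ge0// ltW.
  have e'' : 0 < e' / (2 * K + 1) by rewrite divr_gt0.
  have [d d0 Hd] := cS' _ e''.
  exists (Num.min (Num.min (t + 1) (5 - t)) (Num.min d (e' / (2 * K + 1)))).
    by rewrite !lt_min d0 e'' !andbT; lra.
  move=> t'; rewrite !lt_min => /andP[/andP[y1 y2] /andP[/Hd y3 y4]].
  have ht' : -1 < t' <= 5 by move: y1 y2; rewrite !ltr_norml; lra.
  apply: le_lt_trans (kb_lip hK t t' (inS _ ht4) (inS _ ht')) _.
  move: y3 y4; rewrite !ltr_pdivlMr// => y3 y4.
  have := normr_ge0 (S t' - S t); have := normr_ge0 (t' - t); have := K0.
  by lra.
have fP (t : R) : -1 < t < 5 -> {for t, continuous f} /\ 1 / 2 <= f t.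
  move=> ht; split; first exact: cf.
  by have ht4 : -1 < t <= 5 by [lra]; case/andP: (fb2 t ht4).
have [tau [Th [tau0 Th0 Thtau TP Thb]]] := clock_exists fP.
have Thc t ht := (TP t ht).1.
have dTh (t : R) (ht : 0 <= t <= tau) : is_derive t 1 Th (1 + e * kb h (S (Th t)) (Th t)).
  by have := (TP t ht).2; rewrite /f invrK.
pose z t := (expR (S (Th t)))%:C * cis (Th t).
have zRe : Re \o z = fun t => expR (S (Th t)) * cos (Th t).
  by apply/funext => t /=; rewrite mul0r subr0.
have zIm : Im \o z = fun t => expR (S (Th t)) * sin (Th t).
  by apply/funext => t /=; rewrite mul0r addr0.
have p5 : -1 < (pi : R) <= 5 by lra.
have o5 : -1 < (0 : R) <= 5 by lra.
have zn t : normc (z t) = expR (S (Th t)) by rewrite normc_polar ?expR_ge0.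
exists tau, (S pi), z; split => //.
- move=> t ht; have hc := Thc t ht; have hc5 : -1 < Th t <= 5 by lra.
  have iS := inS _ hc5.
  set A := e * ka h (S (Th t)) (Th t); set B := 1 + e * kb h (S (Th t)) (Th t).
  have FE : (perturbed h e).[z t] = z t * (A +i* B) by exact: fieldE.
  have Bn : B != 0 by have := fb _ hc5; rewrite /B; lra.
  have Dn : kden h e (S (Th t)) (Th t) != 0 by have := kden_bounds hK (Th t) he iS; lra.
  have dSTh : is_derive t 1 (fun t => S (Th t)) A.
    apply: derive_eq (derive_comp (f := S) (g := Th) (dS (Th t) hc) (dTh t ht)) _.
    by rewrite /kre /kim -/A -/B; field; rewrite Bn Dn.
  have dE := derive_comp (f := @expR R) (g := fun t => S (Th t)) (is_derive_expR _) dSTh.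
  have dC := derive_comp (f := @cos R) (g := Th) (is_derive_cos _) (dTh t ht).
  have dSi := derive_comp (f := @sin R) (g := Th) (is_derive_sin _) (dTh t ht).
  rewrite zRe zIm FE; split.
    by apply: derive_eq (derive_mul dE dC) _; rewrite /z /= -/B; ring.
  by apply: derive_eq (derive_mul dE dSi) _; rewrite /z /= -/B; ring.
- split.
  + rewrite /z Th0; have -> : S 0 = s.
      have [h1 h2] := hS 0 o5.
      have i1 : `|S 0 - s0| < 3 / 4 by move: h1 hs; rewrite ler_norml !ltr_norml; lra.
      have i2 : `|s - s0| < 3 / 4 by lra.
      exact: (level_inj hK he hV i1 i2 n10 h2).
    by rewrite /cis cos0 sin0 mulr1.
  + rewrite /z Thtau /cis cospi sinpi; apply/eqP; rewrite eq_complex /=.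
    by apply/andP; split; apply/eqP; ring.
  + by have [] := hS pi p5.
  + by have [] := hS pi p5.
- move=> t /Thb hb; have := congr1 (fun f : R -> R => f t) zIm; rewrite /= => ->.
  by rewrite mulr_gt0 ?expR_gt0// sin_gt0_pi.
- move=> t ht; rewrite zn expRK expR_gt0; split => //.
  by have [|] := hS (Th t); first by have := Thc t ht; lra.
Qed.

End Arc.

(** * Concatenation of two arcs across the axis *)

Section Gluing.
Local Open Scope classical_set_scope.
Local Open Scope complex_scope.
Variable R : realType.
Local Notation mu := (@lebesgue_measure R).
Local Notation normc := (@ComplexField.Normc.normc R).
Local Notation Re := (@complex.Re R).
Local Notation Im := (@complex.Im R).

(** The velocity may jump at [tau], so the fundamental theorem is applied on each side and the
    integrals are added. *)
Lemma glue_integral (U1 U2 u1 u2 : R -> R) (tau T : R) : 0 <= tau -> tau <= T ->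
  (forall t : R, 0 <= t <= tau -> is_derive t 1 U1 (u1 t)) ->
  (forall t : R, tau <= t <= T -> is_derive t 1 U2 (u2 t)) ->
  (forall t : R, 0 <= t <= tau -> {for t, continuous u1}) ->
  (forall t : R, tau <= t <= T -> {for t, continuous u2}) ->
  U1 tau = U2 tau ->
  let u t := if t <= tau then u1 t else u2 t in
  mu.-integrable `[0, T] (EFin \o u) /\
  forall t : R, 0 <= t <= T ->
   (if t <= tau then U1 t else U2 t) = U1 0 + \int[mu]_(s in `[0, t]) u s.
Proof.
move=> tau0 tauT d1 d2 c1 c2 E u.
have iu : mu.-integrable `[0, T] (EFin \o u).
  pose v1 : R -> R := u1 \_ `[0, tau]; pose v2 : R -> R := u2 \_ `]tau, T].
  have i1 : mu.-integrable `[0, T] (EFin \o v1).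
    rewrite -restrict_EFin; apply/integrable_restrict => //.
    apply: (@integrableS _ _ _ mu `[0, tau]) => //; first exact: measurableI.
    exact: cont_integrable.
  have i2 : mu.-integrable `[0, T] (EFin \o v2).
    rewrite -restrict_EFin; apply/integrable_restrict => //.
    apply: (@integrableS _ _ _ mu `[tau, T]) => //; first exact: measurableI.
      by apply: subset_trans (@subIsetr _ _ _) _; apply: subset_itvr; rewrite bnd_simp.
    exact: cont_integrable.
  have i12 : mu.-integrable `[0, T] ((EFin \o v1) \+ (EFin \o v2))%E.
    exact: integrableD.
  apply: eq_integrable i12 => // x; rewrite inE /= in_itv /= => hx.
  rewrite /u /v1 /v2 !patchE; case: (leP x tau) => h.
    rewrite mem_set /= ?in_itv /=; last by lra.
    rewrite memNset /= ?in_itv /=; last by case/andP; lra.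
    by rewrite adde0.
  rewrite memNset /= ?in_itv /=; last by case/andP; lra.
  rewrite mem_set /= ?in_itv /=; last by lra.
  by rewrite add0e.
split=> // t ht.
have low s : 0 <= s <= tau -> \int[mu]_(x in `[0, s]) u x = U1 s - U1 0.
  move=> hs; rewrite (@eq_Rintegral _ _ _ mu _ u1); last first.
    by move=> x; rewrite inE /= in_itv /= => hx; rewrite /u; case: leP => //; lra.
  have s0 : 0 <= s by lra.
  have d1' (x : R) : 0 <= x <= s -> is_derive x 1 U1 (u1 x) by move=> hx; apply: d1; lra.
  have c1' (x : R) : 0 <= x <= s -> {for x, continuous u1} by move=> hx; apply: c1; lra.
  exact: ftc2 s0 d1' c1'.
case: (leP t tau) => htau; first by rewrite low; [ring|lra].
have it : mu.-integrable `[0, t] (EFin \o u).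
  apply: integrableS iu => // y; rewrite /= !in_itv /= => hy; case/andP: ht => _ tT.
  by case/andP: hy => -> yt; rewrite (le_trans yt tT).
have := @Rintegral_itvB R u (BLeft 0) (BRight t) tau it; rewrite !bnd_simp.
move=> /(_ tau0 (ltW htau)); rewrite (low tau); last by lra.
rewrite (@eq_Rintegral _ _ _ mu `]tau, t] u2); last first.
  by move=> x; rewrite inE /= in_itv /= => hx; rewrite /u; case: leP => //; lra.
rewrite Rintegral_itv_obnd_cbnd; last first.
  apply: (@integrableS _ _ _ mu `[tau, T]) => //.
    by move=> x; rewrite /= !in_itv /=; lra.
  exact: cont_integrable.
have d2' (x : R) : tau <= x <= t -> is_derive x 1 U2 (u2 x) by move=> hx; apply: d2; lra.
have c2' (x : R) : tau <= x <= t -> {for x, continuous u2} by move=> hx; apply: c2; lra.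
by rewrite (ftc2 (ltW htau) d2' c2') E; lra.
Qed.

Lemma glue_solution (Fp Fm : {poly R[i]}) (z1 z2 : R -> R[i]) (tau T : R) :
  0 <= tau -> tau <= T -> z1 tau = z2 tau ->
  (forall t : R, 0 <= t <= tau -> 0 <= Im (z1 t) /\ is_derive t 1 (Re \o z1) (Re Fp.[z1 t]) /\
     is_derive t 1 (Im \o z1) (Im Fp.[z1 t])) ->
  (forall t : R, tau <= t <= T -> Im (z2 t) <= 0 /\ is_derive t 1 (Re \o z2) (Re Fm.[z2 t]) /\
     is_derive t 1 (Im \o z2) (Im Fm.[z2 t])) ->
  filippov_solution Fp Fm T (fun t => if t <= tau then z1 t else z2 t).
Proof.
move=> tau0 tauT E h1 h2; exists (fun t => if t <= tau then Fp.[z1 t] else Fm.[z2 t]).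
have c1 (t : R) : 0 <= t <= tau -> {for t, continuous (fun t => Re Fp.[z1 t])} /\
    {for t, continuous (fun t => Im Fp.[z1 t])}.
  by move=> /h1[_ [dx dy]]; apply: horner_continuous; [exact: derive_cont dx|exact: derive_cont dy].
have c2 (t : R) : tau <= t <= T -> {for t, continuous (fun t => Re Fm.[z2 t])} /\
    {for t, continuous (fun t => Im Fm.[z2 t])}.
  by move=> /h2[_ [dx dy]]; apply: horner_continuous; [exact: derive_cont dx|exact: derive_cont dy].
have [iR eR] := glue_integral tau0 tauT (fun t ht => (h1 t ht).2.1) (fun t ht => (h2 t ht).2.1)
   (fun t ht => (c1 t ht).1) (fun t ht => (c2 t ht).1) (congr1 Re E).
have [iI eI] := glue_integral tau0 tauT (fun t ht => (h1 t ht).2.2) (fun t ht => (h2 t ht).2.2)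
   (fun t ht => (c1 t ht).2) (fun t ht => (c2 t ht).2) (congr1 Im E).
have fR : (fun t => Re (if t <= tau then Fp.[z1 t] else Fm.[z2 t])) =
   (fun t => if t <= tau then Re Fp.[z1 t] else Re Fm.[z2 t]).
  by apply/funext => t; case: ifP.
have fI : (fun t => Im (if t <= tau then Fp.[z1 t] else Fm.[z2 t])) =
   (fun t => if t <= tau then Im Fp.[z1 t] else Im Fm.[z2 t]).
  by apply/funext => t; case: ifP.
split.
- by rewrite fR.
- by rewrite fI.
- move=> t ht; have := eR t ht; have := eI t ht; rewrite fR fI tau0.
  case: (leP t tau) => _ e2 e1; apply/eqP; rewrite eq_complex /=.
    by rewrite -[Re (z1 t)]/((Re \o z1) t) -[Im (z1 t)]/((Im \o z1) t) e1 e2 /=; case: (z1 0) => a b /=; rewrite !eqxx.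
  by rewrite -[Re (z2 t)]/((Re \o z2) t) -[Im (z2 t)]/((Im \o z2) t) e1 e2 /=; case: (z1 0) => a b /=; rewrite !eqxx.
(* The inclusion holds at every time: on the axis each field alone is an admissible convex
   combination, with weight [1] for the first arc and [0] for the second. *)
- apply: aeW => t ht; case: (leP t tau) => htau.
    have [y0 _] := h1 t ltac:(lra); split => //; first by rewrite ltNge y0.
    by move=> _; exists 1; rewrite ?lexx ?ler01// mul1r subrr mul0r addr0.
  have [y0 _] := h2 t ltac:(lra); split => //; first by rewrite ltNge y0.
  by move=> _; exists 0; rewrite ?lexx ?ler01// mul0r subr0 mul1r add0r.
Qed.

End Gluing.

(** * Full turns, and localisation of axis points near a given level *)

Section Loop.
Local Open Scope classical_set_scope.
Local Open Scope complex_scope.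
Variable R : realType.
Local Notation normc := (@ComplexField.Normc.normc R).
Local Notation Re := (@complex.Re R).
Local Notation Im := (@complex.Im R).

Lemma derive_compare (f g : R -> R) (x a b l1 l2 : R) : is_derive x 1 f a -> is_derive x 1 g b ->
  0 < a -> 0 < b -> 0 < l1 -> 0 < l2 -> l1 * b < l2 * a ->
  exists2 k, 0 < k & forall y, `|y - x| < k -> y != x ->
    l1 * `|g y - g x| < l2 * `|f y - f x|.
Proof.
move=> /is_deriveP df /is_deriveP dg a0 b0 l10 l20 lab.
pose e := (l2 * a - l1 * b) / (2 * (l1 + l2)).
have s0 : 0 < 2 * (l1 + l2) by rewrite mulr_gt0 ?addr_gt0.
have e0 : 0 < e by rewrite divr_gt0// subr_gt0.
have eE : e * (l1 + l2) = (l2 * a - l1 * b) / 2 by rewrite /e; field; rewrite gt_eqF ?addr_gt0.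
have [d1 d10 H1] := df _ e0; have [d2 d20 H2] := dg _ e0.
exists (Num.min d1 d2); first by rewrite lt_min d10.
move=> y; rewrite lt_min => /andP[/H1 h1 /H2 h2] yx.
have n0 : 0 < `|y - x| by rewrite normr_gt0 subr_eq0.
have f1 : (a - e) * `|y - x| <= `|f y - f x|.
  have := ler_normD (f y - f x) (- (f y - f x - a * (y - x))).
  rewrite normrN opprB addrC subrK normrM (gtr0_norm a0); lra.
have g1 : `|g y - g x| <= (b + e) * `|y - x|.
  have := ler_normD (g y - g x - b * (y - x)) (b * (y - x)).
  rewrite subrK normrM (gtr0_norm b0); lra.
have f2 : l2 * ((a - e) * `|y - x|) <= l2 * `|f y - f x| by rewrite ler_pM2l.
have g2 : l1 * `|g y - g x| <= l1 * ((b + e) * `|y - x|) by rewrite ler_pM2l.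
apply: le_lt_trans g2 (lt_le_trans _ f2).
by rewrite !mulrA ltr_pM2r//; lra.
Qed.

Lemma ln_dist (a b : R) : 0 < a -> 0 < b -> Num.min a b * `|ln a - ln b| <= `|a - b|.
Proof.
move=> a0 b0.
have key A B : B <= A -> expR B * (A - B) <= expR A - expR B :> R.
  move=> BA; have -> : expR A = expR B * expR (A - B) by rewrite -expRD addrC subrK.
  rewrite -[X in _ <= _ - X]mulr1 -mulrBr ler_pM2l ?expR_gt0//.
  by have := expR_ge1Dx (A - B); lra.
case: (leP b a) => ba.
  have lab : ln b <= ln a by rewrite ler_ln.
  rewrite !ger0_norm ?subr_ge0//.
  by have := key _ _ lab; rewrite !lnK.
have lab : ln a <= ln b by rewrite ler_ln// ltW.
rewrite distrC (distrC a) !ger0_norm ?subr_ge0// ?(ltW ba)//.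
by have := key _ _ lab; rewrite !lnK.
Qed.

Lemma normc_dist (z w : R[i]) : `|normc z - normc w| <= normc (z - w).
Proof.
have tri (x y : R[i]) : normc x <= normc (x - y) + normc y.
  by have := @le_normcD R (x - y) y; rewrite subrK.
have sym : normc (z - w) = normc (w - z).
  by rewrite !normcE; case: (z) => a b; case: (w) => c d /=; congr Num.sqrt; ring.
by have := tri z w; have := tri w z; rewrite -sym ler_norml; lra.
Qed.

(** Here [sg] is a sign and [acos sg] is [0] or [pi]. A point [w] of the given level close to the
    axis has an angle close to [acos sg]; since the level varies little with the angle and steeply
    with the radius, [ln x] is close to [a]. *)
Lemma near_axis (f : {poly R[i]}) (s0 K e : R) (U : R -> R -> R) (a sg : R) :
  kbound f s0 K -> `|e| * K <= 1 / 80 -> first_integral f s0 e U ->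
  `|a - s0| < 1 / 2 -> sg ^+ 2 = 1 -> forall k, 0 < k -> exists2 eta, 0 < eta &
  forall (x : R) w, 0 < x -> annulus s0 (1 / 2) w -> levelz U w = U a (acos sg) ->
    normc ((sg * x)%:C - w) < eta -> `|ln x - a| < k.
Proof.
move=> fK he hU ha sg2 k k0; have K0 : 0 < K by case: fK.
(* Norms in the annulus exceed [2 m], so small distances give small differences of angles and of
   logarithms of radii. *)
pose m := expR (s0 - 1 / 2) / 2; have m0 : 0 < m by rewrite divr_gt0 ?expR_gt0.
have sgb : -1 <= sg <= 1.
  have /eqP : (sg - 1) * (sg + 1) = 0 by rewrite (_ : _ * _ = sg ^+ 2 - 1); [rewrite sg2 subrr|ring].
  by rewrite mulf_eq0 => /orP[] /eqP; lra.
have k20 : 0 < k / 2 by rewrite divr_gt0.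
have [d d0 Hd] := acos_within sgb k20.
exists (Num.min m (Num.min (m * k / 2) (m * d / 2))).
  have q1 : 0 < m * k / 2 by rewrite divr_gt0// mulr_gt0.
  have q2 : 0 < m * d / 2 by rewrite divr_gt0// mulr_gt0.
  by rewrite !lt_min m0 q1.
move=> x w x0 hw lev; rewrite !lt_min => /and3P[e1 e2 e3].
have /annulus_ln[n0 hn] := hw.
have w1 : 2 * m < normc w by have /andP[] := hw; rewrite /m; lra.
have nx : normc (sg * x)%:C = x.
  rewrite normcE /= expr0n addr0 exprMn sg2 mul1r sqrtr_sqr gtr0_norm//.
have dxw := normc_dist (sg * x)%:C w; rewrite nx in dxw.
have dw : `|x - normc w| < m by apply: le_lt_trans dxw e1.
have xm : m < x by move: dw; rewrite ltr_norml; lra.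
have r1 : `|ln x - ln (normc w)| < k / 2.
  have h1 := ln_dist x0 n0.
  have h2 : m <= Num.min x (normc w) by rewrite le_min !ltW//; lra.
  have h3 : m * `|ln x - ln (normc w)| <= Num.min x (normc w) * `|ln x - ln (normc w)|.
    by rewrite ler_wpM2r.
  rewrite -(ltr_pM2l m0); apply: le_lt_trans h3 _; apply: le_lt_trans h1 _.
  by apply: le_lt_trans dxw _; rewrite mulrA.
have r2 : `|argz w - acos sg| < k / 2.
  apply: Hd; first exact: argz_dom.
  have -> : Re w / normc w - sg = (Re w - sg * normc w) / normc w by field; rewrite gt_eqF.
  rewrite normrM normfV (gtr0_norm n0) ltr_pdivrMr//.
  have h1 : `|Re w - sg * x| <= normc ((sg * x)%:C - w).
    have := normc_Re ((sg * x)%:C - w); rewrite (_ : Re _ = sg * x - Re w); last by case: (w).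
    by rewrite distrC.
  have h2 : `|sg * x - sg * normc w| <= normc ((sg * x)%:C - w).
    rewrite -mulrBr normrM; have -> : `|sg| = 1.
      by apply/eqP; rewrite -sqrp_eq1// sqr_absr sg2.
    by rewrite mul1r.
  have h3 := ler_normD (Re w - sg * x) (sg * x - sg * normc w); rewrite addrA subrK in h3.
  have h4 : d * (2 * m) <= d * normc w by rewrite ler_wpM2l// ltW.
  have h5 : 0 < d * m by rewrite mulr_gt0.
  by lra.
have p0 := pi_gt0 R.
have t1 : -1 < argz w by have := argz_bounds w; lra.
have t2 : -1 < acos sg by have := acos_ge0 sgb; lra.
have hn' : `|ln (normc w) - s0| < 3 / 4 by lra.
have ha' : `|a - s0| < 3 / 4 by lra.
have h1 := level_expand fK he hU ha' hn' t2.
have h2 := level_angle fK he hU hn' t1 t2.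
rewrite -lev /levelz in h1.
have r3 : 4 * K * `|e| * `|acos sg - argz w| <= 1 * `|acos sg - argz w|.
  rewrite ler_wpM2r// (_ : 4 * K * `|e| = 4 * (`|e| * K)); last by ring.
  by move: he; lra.
have := ler_normD (ln x - ln (normc w)) (ln (normc w) - a); rewrite addrA subrK.
rewrite (distrC (acos sg)) in h2 r3.
by lra.
Qed.

Variables (s0 K e : R) (hp hm : {poly R[i]}).
Hypotheses (he : `|e| * K <= 1 / 80) (hpK : kbound hp s0 K) (hmK : kbound hm s0 K)
  (gK : kbound (mirror hm) s0 K).
Local Notation Fp := (perturbed hp e).
Local Notation Fm := (perturbed hm e).
Variables (V W : R -> R -> R).
Hypotheses (hV : first_integral hp s0 e V) (hW : first_integral (mirror hm) s0 e W).

(** The two ends are kept distinct for the return map; [s' = s] gives the cycle itself. *)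
Lemma loop_exists s s' sg : `|s - s0| < 1 / 2 -> `|s' - s0| < 1 / 2 -> `|sg - s0| < 3 / 4 ->
  V sg pi = V s 0 -> W sg pi = W s' 0 ->
  exists T z, [/\ 0 < T, filippov_solution Fp Fm T z, z 0 = (expR s)%:C, z T = (expR s')%:C &
   [/\ forall t : R, 0 < t < T -> Im (z t) = 0 -> z t = (- expR sg)%:C,
       (exists2 t, 0 < t < T & z t = (- expR sg)%:C) &
       forall t : R, 0 <= t <= T -> 0 < normc (z t) /\
        (`|ln (normc (z t)) - s| <= 20 * K * `|e| \/ `|ln (normc (z t)) - s'| <= 20 * K * `|e|)]].
Proof.
move=> hs hs' hsg EV EW.
have p0 := pi_gt0 R; have p1 : -1 < pi :> R by lra.
have [t1 [s1 [z1 [t10 d1 [z10 z1t a1 b1] up1 ann1]]]] := arc_exists hpK he hV hs.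
have [t2 [s2 [z2 [t20 d2 [z20 z2t a2 b2] up2 ann2]]]] := arc_exists gK he hW hs'.
have K0 : 0 < K by case: hpK.
have c1 : 20 * K * `|e| <= 1 / 4.
  by rewrite (_ : 20 * K * `|e| = 20 * (`|e| * K)); [move: he; lra|ring].
have E1 : s1 = sg.
  apply: (level_inj hpK he hV _ hsg p1); last by rewrite b1.
  by move: a1 hs; rewrite ler_norml !ltr_norml; lra.
have E2 : s2 = sg.
  apply: (level_inj gK he hW _ hsg p1); last by rewrite b2.
  by move: a2 hs'; rewrite ler_norml !ltr_norml; lra.
rewrite {}E1 in z1t a1 b1; rewrite {}E2 in z2t a2 b2.
(* The mirrored arc from [s'] to [sg], conjugated and run backwards, is the lower arc from [sg] to
   [s']. *)
pose T := t1 + t2; pose zl t := (z2 (T - t))^*.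
have zl1 : zl t1 = (- expR sg)%:C.
  by rewrite /zl /T addrAC subrr add0r z2t /= oppr0.
have imz1 (t : R) : 0 <= t <= t1 -> 0 <= Im (z1 t).
  move=> /andP[]; rewrite le_eqVlt => /predU1P[<-|t0]; first by rewrite z10.
  rewrite le_eqVlt => /predU1P[->|tt]; first by rewrite z1t.
  by rewrite ltW// up1// t0.
have imzl (t : R) : Im (zl t) = - Im (z2 (T - t)) by rewrite /zl; case: (z2 _).
have rezl (t : R) : Re (zl t) = Re (z2 (T - t)) by rewrite /zl; case: (z2 _).
have nzl (t : R) : normc (zl t) = normc (z2 (T - t)) by rewrite normc_conj.
have lo (t : R) : t1 < t < T -> Im (zl t) < 0.
  by move=> ht; rewrite imzl oppr_lt0 up2// /T; move: ht; rewrite /T; lra.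
exists T, (fun t => if t <= t1 then z1 t else zl t); split.
- by rewrite /T; lra.
- apply: glue_solution; [exact: ltW|by rewrite /T; lra|by rewrite z1t zl1|..].
    by move=> t ht; split; [exact: imz1|exact: d1].
  move=> t ht; split.
    have [->|n1] := eqVneq t t1; first by rewrite zl1.
    have [->|n2] := eqVneq t T; first by rewrite imzl subrr z20 /= oppr0.
    by rewrite ltW// lo//; move: ht; rewrite !le_eqVlt (eq_sym t1) (negbTE n1) (negbTE n2).
  have [|dx dy] := d2 (T - t); first by move: ht; rewrite /T; lra.
  have dT : is_derive t 1 (fun t => T - t) (-1).
    by apply: derive_eq (derive_sub (derive_const T t) (derive_id t)) _; rewrite sub0r.
  have zz : z2 (T - t) = (zl t)^* by rewrite /zl conjcK.
  have dx' := derive_comp (f := Re \o z2) (g := fun t => T - t) dx dT.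
  have dy' := derive_comp (f := Im \o z2) (g := fun t => T - t) dy dT.
  have dyN : is_derive t 1 (fun t => - (Im \o z2) (T - t)) (- (Im (perturbed (mirror hm) e).[z2 (T - t)] * -1)).
    exact: is_deriveN dy'.
  split.
    have -> : Re \o zl = fun t => (Re \o z2) (T - t) by apply/funext => u; rewrite /= rezl.
    by apply: derive_eq dx' _; rewrite zz mirror_field; case: (Fm.[_]) => x y /=; ring.
  have -> : Im \o zl = fun t => - (Im \o z2) (T - t) by apply/funext => u; rewrite /= imzl.
  by apply: derive_eq dyN _; rewrite zz mirror_field; case: (Fm.[_]) => x y /=; ring.
- by rewrite ltW// z10.
- by rewrite leNgt /T ltrDl t20 /= /zl /T subrr z20 /= oppr0.
- split.
  + move=> t ht; case: (leP t t1) => tt y0.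
      have [->|n1] := eqVneq t t1; first by rewrite z1t.
      have : 0 < Im (z1 t) by apply: up1; case/andP: ht => -> _; rewrite lt_neqAle n1 tt.
      by rewrite y0 ltxx.
    have : Im (zl t) < 0 by apply: lo; rewrite tt; case/andP: ht.
    by rewrite y0 ltxx.
  + by exists t1; rewrite ?lexx ?z1t// t10 /T; lra.
  + move=> t ht; case: (leP t t1) => tt.
      have [|n1 n2] := ann1 t; first by move: ht; lra.
      by split => //; left.
    have [|n1 n2] := ann2 (T - t); first by move: ht; rewrite /T; lra.
    by rewrite nzl; split => //; right.
Qed.

End Loop.

(** * Isolation and hyperbolicity of the cycle *)

Section Cycle.
Local Open Scope classical_set_scope.
Local Open Scope complex_scope.
Variable R : realType.
Local Notation normc := (@ComplexField.Normc.normc R).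
Local Notation Re := (@complex.Re R).
Local Notation Im := (@complex.Im R).
Variables (s0 K e : R) (hp hm : {poly R[i]}).
Hypotheses (he : `|e| * K <= 1 / 80) (hpK : kbound hp s0 K) (hmK : kbound hm s0 K)
  (gK : kbound (mirror hm) s0 K).
Local Notation Fp := (perturbed hp e).
Local Notation Fm := (perturbed hm e).
Local Notation g := (mirror hm).
Variables (V W : R -> R -> R).
Hypotheses (hV : first_integral hp s0 e V) (hW : first_integral g s0 e W).
Variables (s sg : R).
Hypotheses (hs : `|s - s0| < 1 / 8) (hsg : `|sg - s0| < 3 / 8) (EV : V sg pi = V s 0) (EW : W sg pi = W s 0).

Let a1 := kim hp e s 0.
Let a2 := kim g e s 0.
Let b1 := kim hp e sg pi.
Let b2 := kim g e sg pi.

Let small20 : 20 * K * `|e| <= 1 / 4.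
Proof. by rewrite (_ : 20 * K * `|e| = 20 * (`|e| * K)); [move: he; lra|ring]. Qed.

Let hs34 : `|s - s0| < 3 / 4. Proof. by apply: lt_trans hs _; lra. Qed.
Let hsg34 : `|sg - s0| < 3 / 4. Proof. by apply: lt_trans hsg _; lra. Qed.
Let hs1 : `|s - s0| <= 1. Proof. by apply: ltW; apply: lt_trans hs _; lra. Qed.
Let hsg1 : `|sg - s0| <= 1. Proof. by apply: ltW; apply: lt_trans hsg _; lra. Qed.
Let p0 : -1 < 0 :> R. Proof. by lra. Qed.
Let ppi : -1 < pi :> R. Proof. by have := pi_gt0 R; lra. Qed.

Let a10 : 0 < a1. Proof. by have := kim_bounds hpK 0 he hs1; rewrite /a1; lra. Qed.
Let a20 : 0 < a2. Proof. by have := kim_bounds gK 0 he hs1; rewrite /a2; lra. Qed.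
Let b10 : 0 < b1. Proof. by have := kim_bounds hpK pi he hsg1; rewrite /b1; lra. Qed.
Let b20 : 0 < b2. Proof. by have := kim_bounds gK pi he hsg1; rewrite /b2; lra. Qed.

(* A weight for which the distance to the level curves of the cycle is strictly
   monotone at both crossings of the axis, increasing if [sn = 1] and decreasing if
   [sn = - 1]. *)
Lemma weight_exists : a1 * b2 != a2 * b1 -> exists la sn k, [/\ 0 < la, sn != 0, 0 < k,
  (forall x, `|x - s| < k -> x != s ->
    sn * (la * `|W x 0 - W s 0|) < sn * `|V x 0 - V s 0|) &
  (forall x, `|x - sg| < k -> x != sg ->
    sn * `|V x pi - V s 0| < sn * (la * `|W x pi - W s 0|))].
Proof.
move=> ne.
have dV0 := (hV hs34 p0).1; have dW0 := (hW hs34 p0).1.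
have dVp := (hV hsg34 ppi).1; have dWp := (hW hsg34 ppi).1.
rewrite -/a1 in dV0; rewrite -/a2 in dW0; rewrite -/b1 in dVp; rewrite -/b2 in dWp.
(* Strictly between the ratios of the slopes of [V] and [W] at the two crossings, so [la * a2 - a1]
   and [la * b2 - b1] have opposite signs; which ratio is larger decides [sn]. *)
pose la := (a1 / a2 + b1 / b2) / 2.
have r1 : 0 < a1 / a2 by rewrite divr_gt0.
have r2 : 0 < b1 / b2 by rewrite divr_gt0.
have la0 : 0 < la by rewrite /la; lra.
have one : 0 < 1 :> R by [].
have laa : la * a2 = a1 + (b1 / b2 - a1 / a2) / 2 * a2.
  by rewrite /la; field; rewrite !gt_eqF.
have lab : la * b2 = b1 + (a1 / a2 - b1 / b2) / 2 * b2.
  by rewrite /la; field; rewrite !gt_eqF.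
have diff : a1 / a2 - b1 / b2 = (a1 * b2 - a2 * b1) / (a2 * b2) by field; rewrite !gt_eqF.
have ab0 : 0 < a2 * b2 by rewrite mulr_gt0.
have [lt|gt] : a2 * b1 < a1 * b2 \/ a1 * b2 < a2 * b1 by case: (ltgtP (a2 * b1) (a1 * b2)) ne => // ? _; [left|right].
- have d0 : 0 < a1 / a2 - b1 / b2 by rewrite diff divr_gt0// subr_gt0.
  have c1 : la * a2 < 1 * a1.
    have : 0 < (a1 / a2 - b1 / b2) / 2 * a2 by rewrite mulr_gt0// divr_gt0.
    by rewrite laa; lra.
  have c2 : 1 * b1 < la * b2.
    have : 0 < (a1 / a2 - b1 / b2) / 2 * b2 by rewrite mulr_gt0// divr_gt0.
    by rewrite lab; lra.
  have [k1 k10 H1] := derive_compare dV0 dW0 a10 a20 la0 one c1.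
  have [k2 k20 H2] := derive_compare dWp dVp b20 b10 one la0 c2.
  exists la, 1, (Num.min k1 k2); split=> //; rewrite ?oner_neq0 ?lt_min ?k10//.
    by move=> x; rewrite lt_min => /andP[h1 _] xs; have := H1 x h1 xs; rewrite !mul1r.
  by move=> x; rewrite lt_min => /andP[_ h2] xs; have := H2 x h2 xs; rewrite EV EW !mul1r.
- have d0 : 0 < b1 / b2 - a1 / a2 by rewrite -opprB diff -mulNr divr_gt0// opprB subr_gt0.
  have c1 : 1 * a1 < la * a2.
    have : 0 < (b1 / b2 - a1 / a2) / 2 * a2 by rewrite mulr_gt0// divr_gt0.
    by rewrite laa; lra.
  have c2 : la * b2 < 1 * b1.
    have : 0 < (b1 / b2 - a1 / a2) / 2 * b2 by rewrite mulr_gt0// divr_gt0.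
    by rewrite lab; lra.
  have [k1 k10 H1] := derive_compare dW0 dV0 a20 a10 one la0 c1.
  have [k2 k20 H2] := derive_compare dVp dWp b10 b20 la0 one c2.
  exists la, (-1), (Num.min k1 k2); split=> //; rewrite ?oppr_eq0 ?oner_neq0 ?lt_min ?k10//.
    by move=> x; rewrite lt_min => /andP[h1 _] xs; have := H1 x h1 xs; rewrite !mulN1r ltrN2 mul1r.
  by move=> x; rewrite lt_min => /andP[_ h2] xs; have := H2 x h2 xs; rewrite EV EW !mulN1r ltrN2 mul1r.
Qed.

Let implicit_map (h : {poly R[i]}) (hK : kbound h s0 K) (U : R -> R -> R) (hU : first_integral h s0 e U)
  (th x r dG : R) (p G : R -> R) : -1 < th -> 0 < r ->
  (forall y, `|y - x| < r -> `|p y - s0| < 3 / 4 /\ U (p y) th = G y) ->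
  is_derive x 1 G dG -> is_derive x 1 p (dG / kim h e (p x) th).
Proof.
move=> ht r0 H dG'.
have [px _] : `|p x - s0| < 3 / 4 /\ U (p x) th = G x by apply: H; rewrite subrr normr0.
have half0 : 0 < 1 / 2 :> R by lra.
have px1 : `|p x - s0| <= 1 by lra.
have kn : kim h e (p x) th != 0 by have := kim_bounds hK th he px1; lra.
apply: (@implicit_derive R (U^~ th) G p x (1 / 2) _ _ r half0 r0 _ _ (hU _ _ px ht).1 kn dG').
  by move=> y /H[].
by move=> y /H[py _]; have Q := level_expand hK he hU px py ht; exact: Q.
Qed.

(** The return map goes through the upper half map [q], then solves [W (p x) 0 = W (q x) pi]. Its
    derivative at [s] is [(a1 / b1) * (b2 / a2)], which differs from [1] by transversality. *)
Lemma return_map_exists : a1 * b2 != a2 * b1 -> exists (d1 : R) (p : R -> R), [/\ 0 < d1,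
  (forall x, `|x - s| < d1 -> `|x - s0| < 1 / 2 /\ `|p x - s0| < 1 / 2 /\
    exists2 y, `|y - s0| < 3 / 4 & V y pi = V x 0 /\ W y pi = W (p x) 0),
  p s = s & exists2 l, is_derive s 1 p l & 0 < l /\ l != 1].
Proof.
move=> ne; have [q qP] := half_map_exists hpK he hV.
have hs' := hs; have hsg' := hsg; have sm := small20.
have p5 := pi_le5 R.
have inv x : `|x - s| < 1 / 8 -> `|q x - s0| < 1 / 2 + 1 / 100 /\ V (q x) pi = V x 0.
  move=> hx; have hx4 : `|x - s0| <= 1 / 4.
    by have := ler_normD (x - s) (s - s0); rewrite addrA subrK; lra.
  by have [_ h1 h2] := qP x hx4; split => //; lra.
have qs : q s = sg.
  have hss : `|s - s| < 1 / 8 by rewrite subrr normr0; lra.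
  have [h1 h2] := inv s hss; apply: (level_inj hpK he hV _ hsg34 ppi); last by rewrite h2.
  by lra.
have dq : is_derive s 1 q (a1 / b1).
  have r8 : 0 < 1 / 8 :> R by lra.
  rewrite /b1 -qs; apply: (implicit_map hpK hV ppi r8 _ (hV hs34 p0).1).
  by move=> y /inv[h1 h2]; split => //; lra.
have /contP cq := derive_cont dq; have r8 : 0 < 1 / 16 :> R by lra.
have [d d0 Hd] := cq _ r8.
pose A x := `|x - s| < Num.min d (1 / 8).
have [p pP] : exists p : R -> R, forall x, A x -> `|p x - s0| < 3 / 4 /\ `|p x - q x| <= 20 * K * `|e| /\ W (p x) 0 = W (q x) pi.
  suff /choice[p H] : forall x, exists y, A x -> `|y - s0| < 3 / 4 /\ `|y - q x| <= 20 * K * `|e| /\ W y 0 = W (q x) pi by exists p.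
  move=> x; case: (pselect (A x)) => [|n]; last by exists 0.
  rewrite /A lt_min => /andP[/Hd hq _]; rewrite qs in hq.
  have h12 : `|q x - s0| < 1 / 2.
    by have := ler_normD (q x - sg) (sg - s0); rewrite addrA subrK; lra.
  have [|y h1 h2] := level_exists gK he hW h12 ppi p0; first by rewrite sub0r normrN gtr0_norm// pi_gt0.
  exists y => _; split => //.
  by have := ler_normD (y - q x) (q x - s0); rewrite addrA subrK; have := small20; lra.
have As : A s by rewrite /A subrr normr0 lt_min d0; lra.
have ps : p s = s.
  have [h1 [_ h2]] := pP s As; apply: (level_inj gK he hW h1 hs34 p0).
  by rewrite h2 qs EW.
have dmin : 0 < Num.min d (1 / 8) by rewrite lt_min d0; lra.
have dWq : is_derive s 1 (fun x => W (q x) pi) (b2 * (a1 / b1)).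
  apply: (derive_comp (f := W^~ pi) (g := q)) => //; rewrite qs.
  exact: (hW hsg34 ppi).1.
have dp : is_derive s 1 p (b2 * (a1 / b1) / a2).
  rewrite /a2 -[X in kim g e X 0]ps.
  apply: (implicit_map gK hW p0 dmin _ dWq).
  by move=> y /pP[h1 [_ h2]].
have /contP cp := derive_cont dp.
have r4 : 0 < 1 / 4 :> R by lra.
have [d2 d20 Hd2] := cp _ r4; rewrite ps in Hd2.
exists (Num.min (Num.min d (1 / 8)) d2), p; split => //.
- by rewrite lt_min dmin.
- move=> x; rewrite lt_min => /andP[Ax /Hd2 hp2].
  have [h1 [_ h2]] := pP x Ax; move: (Ax); rewrite /A lt_min => /andP[_ hx8].
  split; first by have := ler_normD (x - s) (s - s0); rewrite addrA subrK; lra.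
  split; first by have := ler_normD (p x - s) (s - s0); rewrite addrA subrK; lra.
  have [h3 h4] := inv x hx8; exists (q x); first by lra.
  by rewrite h2.
- exists (b2 * (a1 / b1) / a2) => //; split.
    by apply: divr_gt0 a20; apply: mulr_gt0 b20 _; exact: divr_gt0.
  apply/eqP => E; move/eqP: ne; apply.
  have : b2 * (a1 / b1) / a2 * (a2 * b1) = a2 * b1 by rewrite E mul1r.
  by move=> <-; field; rewrite !gt_eqF.
Qed.

Let conjB_real (x : R) (w : R[i]) : x%:C - w^* = (x%:C - w)^*.
Proof.
case: w => p q; apply/eqP; rewrite eq_complex /=.
by apply/andP; split; apply/eqP => //; rewrite !sub0r.
Qed.

Lemma cycle_bounds (z : R -> R[i]) T : (forall t : R, 0 <= t <= T -> 0 < normc (z t) /\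
    (`|ln (normc (z t)) - s| <= 20 * K * `|e| \/ `|ln (normc (z t)) - s| <= 20 * K * `|e|)) ->
  forall t : R, 0 <= t <= T -> annulus s0 (3 / 8) (z t).
Proof.
move=> H t /H[n0 h]; apply/annulus_ln; split => //.
have {}h : `|ln (normc (z t)) - s| <= 20 * K * `|e| by case: h.
have := ler_normD (ln (normc (z t)) - s) (s - s0); rewrite addrA subrK.
by have := small20; have := hs; lra.
Qed.

Lemma annulus_le r r' (z : R[i]) : r <= r' -> annulus s0 r z -> annulus s0 r' z.
Proof.
move=> rr /annulus_ln[n0 h]; apply/annulus_ln; split => //; exact: lt_le_trans h rr.
Qed.

Theorem hyperbolic_cycle : a1 * b2 != a2 * b1 -> exists G,
  [/\ hyperbolic_limit_cycle Fp Fm G,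
   (forall z, G z -> 0 < normc z /\ `|ln (normc z) - s| <= 20 * K * `|e|) &
   (forall phi, exists2 z, G z & z = (normc z)%:C * cis phi)].
Proof.
move=> ne.
have hs' := hs; have hsg' := hsg.
have hs12 : `|s - s0| < 1 / 2 by lra.
have [T [z [T0 solz z0 zT [onreal [tm htm ztm] ann]]]] :=
  loop_exists he hpK gK hV hW hs12 hs12 hsg34 EV EW.
have ann8 := cycle_bounds ann.
have ann4 t : 0 <= t <= T -> annulus s0 (3 / 4) (z t).
  by move=> /ann8; apply: annulus_le; lra.
have zTz : z T = z 0 by rewrite zT z0.
have es0 : 0 < expR s by exact: expR_gt0.
have eg0 : 0 < expR sg by exact: expR_gt0.
have [y fy yz] := fsol_of T0 solz.
have yT : y T = y 0 by rewrite !yz ?lexx ?ltW// zTz.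
have anny t : 0 <= t <= T -> annulus s0 (3 / 4) (y t).
  by move=> ht; rewrite yz//; exact: ann4.
have realpts t : 0 <= t <= T -> Im (z t) = 0 -> z t = (expR s)%:C \/ z t = (- expR sg)%:C.
  move=> /andP[]; rewrite le_eqVlt => /predU1P[<-|t0]; first by left.
  rewrite le_eqVlt => /predU1P[->|tT] y0; first by left.
  by right; apply: onreal => //; rewrite t0.
have pos_pt x : 0 < x -> (exists2 t, 0 <= t <= T & z t = x%:C) -> ln x = s.
  move=> x0 [t ht zt]; have [|E|E] := realpts t ht; first by rewrite zt.
    by move: E; rewrite zt => -[->]; rewrite expRK.
  by move: E; rewrite zt => -[E]; move: x0; rewrite E oppr_gt0 ltNge (ltW eg0).
have neg_pt x : 0 < x -> (exists2 t, 0 <= t <= T & z t = (- x)%:C) -> ln x = sg.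
  move=> x0 [t ht zt]; have [|E|E] := realpts t ht; first by rewrite zt.
    by move: E; rewrite zt => -[E]; move: es0; rewrite -E oppr_gt0 ltNge (ltW x0).
  by move: E; rewrite zt => -[/oppr_inj ->]; rewrite expRK.
have levy t : 0 <= t <= T -> (0 <= Im (y t) -> levelz V (y t) = V s 0) /\
    (Im (y t) < 0 -> levelz W (y t)^* = W s 0).
  have toz x : (exists2 t, 0 <= t <= T & y t = x) -> exists2 t, 0 <= t <= T & z t = x.
    by move=> [t' ht' <-]; exists t'; rewrite ?yz.
  (* The constructed loop meets the axis only at the radii [s] and [sg], where both distances
     vanish; any weight and sign will do. *)
  apply: (periodic_level he hpK hmK gK hV hW T0 fy anny (la := 1) (sn := 1) (s := s)) => //.
  - move=> x x0 /toz/(pos_pt x x0) ->; rewrite eqxx; split => //; split => //.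
    by rewrite !subrr normr0 !mulr0.
  - by move=> x x0 /toz/(neg_pt x x0) ->; rewrite EV EW !subrr normr0 !mulr0.
pose G := z @` `[0, T].
have Gy : G = y @` `[0, T].
  by apply/seteqP; split => w [t ht <-]; exists t => //; rewrite yz//; move: ht; rewrite /= in_itv.
have Gin w : G w -> exists2 t, 0 <= t <= T & z t = w.
  by move=> [t ht <-]; exists t => //; move: ht; rewrite /= in_itv.
have hz0 : 0 <= (0 : R) <= T by rewrite lexx ltW.
have htm' : 0 <= tm <= T by case/andP: htm => h1 h2; rewrite !ltW.
exists G; split; last first.
- move=> phi; have [t ht E] := fsol_angle he hpK hmK phi T0 fy yT anny.
  exists (z t); first by exists t => //; rewrite /= in_itv.
  by move: E; rewrite yz.
- by move=> w /Gin[t ht <-]; have [n0 h] := ann t ht; split => //; case: h.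
have perG : periodic_orbit Fp Fm G.
  exists T, z; split => //; exists tm => //; rewrite ztm z0; apply/eqP => -[E].
  by move: es0; rewrite -E oppr_gt0 ltNge (ltW eg0).
split.
- split => //.
  have [la [sn [k [la0 sn0 k0 Hpos Hneg]]]] := weight_exists ne.
  have acos1 : acos 1 = 0 :> R by exact: acos1.
  have acosN1 : acos (-1) = pi :> R by exact: acosN1.
  have N2 : (-1) ^+ 2 = 1 :> R by rewrite sqrrN expr1n.
  (* A point of [G] close to an axis point of [G'] may lie in either half-plane, so closeness is
     drawn from both [V] and [W] at each of the two crossings. *)
  have [e1 e10 H1] := near_axis hpK he hV hs12 (expr1n R 2) k0.
  have hsg12 : `|sg - s0| < 1 / 2 by lra.
  have [e2 e20 H2] := near_axis hpK he hV hsg12 N2 k0.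
  have [e3 e30 H3] := near_axis gK he hW hs12 (expr1n R 2) k0.
  have [e4 e40 H4] := near_axis gK he hW hsg12 N2 k0.
  (* Margins between the annulus of half-width [3/8] containing [G] and that of half-width [3/4] in
     which [G'] has to stay. *)
  have r1 : 0 < expR (s0 - 3 / 8) - expR (s0 - 3 / 4) by rewrite subr_gt0 ltr_expR; lra.
  have r2 : 0 < expR (s0 + 3 / 4) - expR (s0 + 3 / 8) by rewrite subr_gt0 ltr_expR; lra.
  pose eta := Num.min (Num.min (Num.min e1 e2) (Num.min e3 e4))
     (Num.min (expR (s0 - 3 / 8) - expR (s0 - 3 / 4)) (expR (s0 + 3 / 4) - expR (s0 + 3 / 8))).
  exists eta; first by rewrite !lt_min e10 e20 e30 e40 r1.
  move=> G' [T' [z' [T'0 solz' z'T _ GE]]] nearG.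
  have [y' fy' y'z'] := fsol_of T'0 solz'.
  have y'T : y' T' = y' 0 by rewrite !y'z' ?lexx ?ltW// z'T.
  have G'in t : 0 <= t <= T' -> exists2 w, G w & normc (y' t - w) < eta.
    by move=> ht; apply: nearG; rewrite GE; exists t; rewrite ?y'z' //= in_itv.
  have levG w : G w -> annulus s0 (1 / 2) w /\ ((levelz V w = V s 0) \/ (levelz W w^* = W s 0)).
    move=> /Gin[t ht <-]; split; first by apply: annulus_le (ann8 t ht); lra.
    have [l1 l2] := levy t ht; rewrite yz// in l1 l2.
    by case: (leP 0 (Im (z t))) => h; [left; exact: l1|right; exact: l2].
  have anny' t : 0 <= t <= T' -> annulus s0 (3 / 4) (y' t).
    move=> /G'in[w Gw]; rewrite !lt_min => /andP[_ /andP[h1 h2]].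
    have [t' ht' E] := Gin w Gw; have /andP[n1 n2] := ann8 t' ht'; rewrite E in n1 n2.
    have := normc_dist (y' t) w; rewrite ler_norml => /andP[m1 m2].
    by apply/andP; split; lra.
  have near_pos x : 0 < x -> (exists2 t, 0 <= t <= T' & y' t = x%:C) -> `|ln x - s| < k.
    move=> x0 [t /G'in[w Gw + E]]; rewrite E !lt_min => /andP[/andP[/andP[h1 _] /andP[h3 _]] _].
    have [aw [lw|lw]] := levG w Gw.
      by apply: (H1 x w) => //; rewrite ?acos1 ?mul1r.
    apply: (H3 x w^*) => //; [exact/(annulus_conj s0)|by rewrite acos1|].
    by rewrite mul1r conjB_real normc_conj.
  have near_neg x : 0 < x -> (exists2 t, 0 <= t <= T' & y' t = (- x)%:C) -> `|ln x - sg| < k.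
    move=> x0 [t /G'in[w Gw + E]]; rewrite E !lt_min => /andP[/andP[/andP[_ h2] /andP[_ h4]] _].
    have [aw [lw|lw]] := levG w Gw.
      by apply: (H2 x w) => //; rewrite ?acosN1 ?mulN1r ?EV.
    apply: (H4 x w^*) => //; [exact/(annulus_conj s0)|by rewrite acosN1 EW|].
    by rewrite mulN1r conjB_real normc_conj.
  have levy' t : 0 <= t <= T' -> (0 <= Im (y' t) -> levelz V (y' t) = V s 0) /\
      (Im (y' t) < 0 -> levelz W (y' t)^* = W s 0).
    apply: (periodic_level he hpK hmK gK hV hW T'0 fy' anny' la0 (sn := sn) (s := s)) => //.
    + move=> x x0 hx; have hk := near_pos x x0 hx.
      split; first by move=> ->.
      split; first by move=> xs; exact: Hpos.
      have [->|xs] := eqVneq (ln x) s; first by rewrite !subrr normr0 !mulr0.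
      by apply: ltW; exact: Hpos.
    + move=> x x0 hx; have hk := near_neg x x0 hx.
      have [->|xs] := eqVneq (ln x) sg; first by rewrite EV EW !subrr normr0 !mulr0.
      by apply: ltW; exact: Hneg.
  have -> : G' = y' @` `[0, T'].
    rewrite GE; apply/seteqP; split => w [t ht <-]; exists t => //; rewrite y'z'//; move: ht; by rewrite /= in_itv.
  rewrite Gy; apply/seteqP; split.
    exact: (level_images he hpK hmK gK hV hW T0 anny' levy' fy yT anny levy).
  exact: (level_images he hpK hmK gK hV hW T'0 anny levy fy' y'T anny' levy').
- move=> x /Gin[t ht zt].
  have aw := ann4 t ht.
  have y0 : Im (z t) = 0 by rewrite zt.
  have c1 := field_crosses he hpK aw y0; have c2 := field_crosses he hmK aw y0.
  have := mulr_gt0 c1 c2; rewrite zt /= mulrACA pmulr_rgt0//.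
  have x0 : x != 0 by apply: contraTneq c1; rewrite zt /= => ->; rewrite mul0r ltxx.
  by rewrite -expr2 exprn_even_gt0.
- have [d1 [p [d10 Hp ps [l dl [l0 l1]]]]] := return_map_exists ne.
  (* Conjugation by the exponential leaves the multiplier at the fixed point unchanged. *)
  pose x0 := expR s; pose P x := expR (p (ln x)).
  have lnx0 : ln x0 = s by rewrite expRK.
  have dP : is_derive x0 1 P l.
    have dln : is_derive x0 1 (@ln R) x0^-1 by exact: is_derive1_ln.
    have d2 : is_derive x0 1 (fun x => p (ln x)) (l * x0^-1).
      by apply: (derive_comp (f := p) (g := @ln R)) dln; rewrite lnx0.
    have d3 := derive_comp (f := @expR R) (g := fun x => p (ln x)) (is_derive_expR _) d2.
    by apply: derive_eq d3 _; rewrite lnx0 ps -/x0; field; rewrite gt_eqF.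
  have Px0 : P x0 = x0 by rewrite /P lnx0 ps.
  have /contP cP := derive_cont dP.
  have /contP cln : {for x0, continuous (@ln R)} by exact: continuous_ln.
  have h20 : 0 < x0 / 2 by rewrite divr_gt0.
  have [d3 d30 H3] := cP _ h20; rewrite Px0 in H3.
  have [d4 d40 H4] := cln _ d10; rewrite lnx0 in H4.
  pose d0 := Num.min (x0 / 2) (Num.min d3 d4).
  have d00 : 0 < d0 by rewrite !lt_min h20 d30.
  (* A section of radius [x0 / 2] lies on the positive half-axis, so the intermediate crossing of
     the negative one is not a return. *)
  exists x0, d0, (x0 / 2), P; split.
  + by exists 0; rewrite /= ?in_itv//= z0.
  + by rewrite d00 /= ge_min lexx.
  + move=> x; rewrite /ball /= distrC !lt_min => /and3P[hx1 hx3 hx4].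
    have xp : 0 < x by move: hx1; rewrite ltr_norml; lra.
    have [i1 [i2 [u i3 [E1 E2]]]] := Hp (ln x) (H4 _ hx4).
    have [T1 [z1 [T10 sol1 z10 z1T [on1 _ _]]]] := loop_exists he hpK gK hV hW i1 i2 i3 E1 E2.
    exists T1, z1; split => //.
    * by rewrite z10 lnK.
    * split; first by exists (P x) => //; rewrite /ball /= distrC; exact: H3.
      move=> t ht [x' + E]; rewrite /ball /= distrC ltr_norml => hx'.
      have x'0 : 0 < x' by lra.
      have y0 : Im (z1 t) = 0 by rewrite -E.
      have := on1 t ht y0; rewrite -E => -[E']; move: x'0.
      by rewrite E' oppr_gt0 ltNge expR_ge0.
  + by split => //; rewrite (derive1_val dP) gtr0_norm.
Qed.

End Cycle.

(** * Bifurcation from simple zeros *)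

Section Bifurcation.
Local Open Scope classical_set_scope.
Local Open Scope complex_scope.
Variable R : realType.
Local Notation normc := (@ComplexField.Normc.normc R).
Implicit Types (h g hp hm : {poly R[i]}) (s r : R).

Lemma cont_bounded (f : R -> R) s0 d : 0 <= d -> (forall s, {for s, continuous f}) ->
  exists2 B, 0 <= B & forall s, `|s - s0| <= d -> `|f s| <= B.
Proof.
move=> d0 cf.
have le : s0 - d <= s0 + d by lra.
have cn : {within `[s0 - d, s0 + d], continuous (fun s => `|f s|)}.
  by apply: within_cont => x _; apply: (@continuous_comp _ _ _ f (@Num.norm R R)); [exact: cf|exact: norm_continuous].
have [c _ Hc] := EVT_max le cn.
exists `|f c| => // s; rewrite ler_norml => hs.
by apply: Hc; rewrite in_itv /=; move: hs; lra.
Qed.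

Lemma half2_cont h s : {for s, continuous (half2 h)}.
Proof. exact: derive_cont (half2_derive h s). Qed.

Lemma kdb_ds h s t : exists l, is_derive s 1 (fun s => kdb h s t) l.
Proof. by eexists; exact: etrig_ds. Qed.

Lemma dhalf1_cont h s : {for s, continuous (dhalf1 h)}.
Proof. exact: derive_cont (derive_sub (kb_ds h s pi) (kb_ds h s 0)). Qed.

Lemma dhalf2_cont h s : {for s, continuous (dhalf2 h)}.
Proof.
have [l dl] := kdb_ds h s pi.
have d1 := derive_mul dl (half1_derive h s).
have [l' dl'] : exists l, is_derive s 1 (dhalf1 h) l.
  by eexists; exact: (derive_sub (kb_ds h s pi) (kb_ds h s 0)).
have d2 := derive_mul (kb_ds h s pi) dl'.
have d3 t := derive_sub (derive_sqr (ka_ds h s t)) (derive_sqr (kb_ds h s t)).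
exact: derive_cont (derive_add (derive_add d1 d2) (derive_sub (d3 pi) (d3 0))).
Qed.

Definition expansion h g s0 K (l : nat) (m dm : R -> R) (C : R) := forall e s s1 s2 : R,
  `|e| * K <= 1 / 80 -> `|e| <= 1 -> `|s - s0| <= 1 / 4 ->
  `|s1 - s0| <= 1 / 2 -> `|s2 - s0| <= 1 / 2 ->
  half_map_graph h s0 e s s1 -> half_map_graph g s0 e s s2 ->
  `|s1 - s2 - e ^+ l * m s| <= C * `|e| ^+ l.+1 /\
  `|kim h e s 0 / kim h e s1 pi - kim g e s 0 / kim g e s2 pi - e ^+ l * dm s|
    <= C * `|e| ^+ l.+1.

Let eq_norm_le (x y : R) : x = y -> `|x| <= `|y|. Proof. by move=> ->. Qed.

Let expansion_bound (E1 E2 e c C1 C2 B : R) : `|e| <= 1 ->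
  `|E1| <= C1 * `|e| ^+ 3 -> `|E2| <= C2 * `|e| ^+ 3 -> `|c| <= B ->
  `|E1 - E2 + e ^+ 2 * c| <= (`|C1| + `|C2| + B) * `|e| ^+ 2.
Proof.
move=> e1 h1 h2 hc.
have e0 : 0 <= `|e| by exact: normr_ge0.
have e3 : `|e| ^+ 3 <= `|e| ^+ 2 by rewrite exprS ler_piMl// exprn_ge0.
have bd (E C : R) : `|E| <= C * `|e| ^+ 3 -> `|E| <= `|C| * `|e| ^+ 2.
  move=> h; apply: le_trans h _.
  apply: (@le_trans _ _ (`|C| * `|e| ^+ 3)); first by rewrite ler_wpM2r ?exprn_ge0// ler_norm.
  by rewrite ler_wpM2l.
rewrite !mulrDl; apply: le_trans (ler_normD _ _) _; apply: lerD.
  by apply: le_trans (ler_normB _ _) _; apply: lerD; exact: bd.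
by rewrite normrM normrX mulrC ler_wpM2r// exprn_ge0.
Qed.

(** The second order terms, bounded near [s0] by continuity, go into the remainder. *)
Lemma expansion1 h g s0 K : kbound h s0 K -> kbound g s0 K -> exists C,
  expansion h g s0 K 1 (fun s => half1 h s - half1 g s) (fun s => dhalf1 h s - dhalf1 g s) C.
Proof.
move=> hK gK; have [C1 H1] := half_map_exp hK; have [C2 H2] := half_map_exp gK.
have q4 : 0 <= 1 / 4 :> R by lra.
have [B1 B10 b1] := @cont_bounded (fun s => half2 h s - half2 g s) s0 (1 / 4) q4
  (fun s => continuousB (@half2_cont h s) (@half2_cont g s)).
have [B2 B20 b2] := @cont_bounded (fun s => dhalf2 h s - dhalf2 g s) s0 (1 / 4) q4
  (fun s => continuousB (@dhalf2_cont h s) (@dhalf2_cont g s)).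
exists (`|C1| + `|C2| + (B1 + B2)) => e s s1 s2 eK e1 ss hs1 hs2 hg gg.
have [a1 a2] := H1 e s s1 eK e1 ss hs1 hg; have [c1 c2] := H2 e s s2 eK e1 ss hs2 gg.
have d1 : `|half2 h s - half2 g s| <= B1 + B2 by have := b1 s ss; lra.
have d2 : `|dhalf2 h s - dhalf2 g s| <= B1 + B2 by have := b2 s ss; lra.
have := expansion_bound e1 a1 c1 d1; have := expansion_bound e1 a2 c2 d2.
set x := kim h e s 0 / _; set y := kim g e s 0 / _ => E2 E1.
by split; [apply: le_trans E1|apply: le_trans E2]; apply: eq_norm_le; ring.
Qed.

Lemma expansion2 h g s0 K : kbound h s0 K -> kbound g s0 K ->
  (forall s, half1 h s = half1 g s) -> exists C,
  expansion h g s0 K 2 (fun s => half2 h s - half2 g s) (fun s => dhalf2 h s - dhalf2 g s) C.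
Proof.
move=> hK gK E; have [C1 H1] := half_map_exp hK; have [C2 H2] := half_map_exp gK.
have dE s : dhalf1 h s = dhalf1 g s.
  rewrite -(derive1_val (half1_derive h s)) -(derive1_val (half1_derive g s)).
  by congr (derive1 _ s); apply/funext.
exists (C1 + C2) => e s s1 s2 eK e1 ss hs1 hs2 hg gg.
have [a1 a2] := H1 e s s1 eK e1 ss hs1 hg; have [c1 c2] := H2 e s s2 eK e1 ss hs2 gg.
rewrite E in a1; rewrite dE in a2.
have bd (E1 E2 : R) : `|E1| <= C1 * `|e| ^+ 3 -> `|E2| <= C2 * `|e| ^+ 3 ->
    `|E1 - E2| <= (C1 + C2) * `|e| ^+ 3.
  by move=> h1 h2; rewrite mulrDl; apply: le_trans (ler_normB _ _) _; exact: lerD.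
have := bd _ _ a1 c1; have := bd _ _ a2 c2.
set x := kim h e s 0 / _; set y := kim g e s 0 / _ => E2 E1.
by split; [apply: le_trans E1|apply: le_trans E2]; apply: eq_norm_le; ring.
Qed.

Lemma kbound_common h1 h2 h3 s0 : exists K,
  [/\ kbound h1 s0 K, kbound h2 s0 K & kbound h3 s0 K].
Proof.
have [K1 k1] := kbound_exists h1 s0; have [K2 k2] := kbound_exists h2 s0.
have [K3 k3] := kbound_exists h3 s0.
have [p1 _] := k1; have [p2 _] := k2; have [p3 _] := k3.
by exists (K1 + K2 + K3); split; [apply: kbound_le k1|apply: kbound_le k2|apply: kbound_le k3]; lra.
Qed.

Definition cycle_near (Fp Fm : {poly R[i]}) (G : set R[i]) s0 (d : R) :=
  [/\ hyperbolic_limit_cycle Fp Fm G,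
   (forall z, G z -> 0 < normc z /\ `|ln (normc z) - s0| <= d) &
   (forall phi, exists2 z, G z & z = (normc z)%:C * cis phi)].

Lemma expansion_cycle hp hm s0 K l m dm C : kbound hp s0 K -> kbound hm s0 K ->
  kbound (mirror hm) s0 K -> (forall s, is_derive (s : R) 1 m (dm s)) ->
  {for s0, continuous dm} -> m s0 = 0 -> dm s0 != 0 ->
  expansion hp (mirror hm) s0 K l m dm C ->
  exists2 e0, 0 < e0 & exists D : R, forall e : R, 0 < `|e| < e0 ->
    exists G, cycle_near (perturbed hp e) (perturbed hm e) G s0 (D * `|e|).
Proof.
move=> hpK hmK gK dm1 cdm m0 dm0 ex.
have [e1 e10 [C' H]] := fixed_point hpK gK dm1 cdm m0 dm0 ex.
pose C1 := `|C'| + 1.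
have C10 : 0 < C1 by rewrite /C1; have := normr_ge0 C'; lra.
exists (Num.min e1 (1 / (16 * C1))); first by rewrite lt_min e10 divr_gt0// mulr_gt0.
exists (C1 + 20 * K) => e; rewrite lt_min => /andP[en /andP[h1 h2]].
have [eK HH] : `|e| * K <= 1 / 80 /\ _ := H e (introT andP (conj en h1)).
have [V hV] := first_integral_exists hpK eK; have [W hW] := first_integral_exists gK eK.
have [s [sg [ss sgs EV EW ne]]] := HH V W hV hW.
have C1e : C1 * `|e| < 1 / 16.
  by move: h2; rewrite ltr_pdivlMr ?mulr_gt0//; lra.
have C'e : C' * `|e| <= C1 * `|e|.
  by rewrite ler_wpM2r// /C1; have := ler_norm C'; lra.
have hs : `|s - s0| < 1 / 8 by lra.
have hsg : `|sg - s0| < 3 / 8.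
  by have := ler_normD (sg - s) (s - s0); rewrite addrA subrK; lra.
have [G [hG near ang]] := hyperbolic_cycle eK hpK hmK gK hV hW hs hsg EV EW ne.
exists G; split => // z /near[n0 hz]; split => //.
have := ler_normD (ln (normc z) - s) (s - s0); rewrite addrA subrK mulrDl.
move: hz ss C'e; lra.
Qed.

Lemma averaged_zero_cycle hp hm M r : first_averaged_function hp hm M ->
  simple_positive_zero M r ->
  exists2 e0, 0 < e0 & exists D : R, forall e : R, 0 < `|e| < e0 ->
    exists G, cycle_near (perturbed hp e) (perturbed hm e) G (ln r) (D * `|e|).
Proof.
move=> fM [r0 Mr0 _ dM0].
have [K [hpK hmK gK]] := kbound_common hp hm (mirror hm) (ln r).
(* Since [M x = x * m (ln x)], a simple zero of [M] at [r] is a simple zero of [m] at [ln r]. *)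
have zeroE (m dm : R -> R) : (forall s, is_derive (s : R) 1 m (dm s)) ->
    (forall x, 0 < x -> M x = x * m (ln x)) -> m (ln r) = 0 /\ dm (ln r) != 0.
  move=> dm1 ME.
  have m0 : m (ln r) = 0.
    by apply/eqP; move/eqP: Mr0; rewrite ME// mulf_eq0 gt_eqF.
  split => //; apply: contra_neq dM0 => d0.
  have dln : is_derive r 1 (@ln R) r^-1 by exact: is_derive1_ln.
  have d1 := derive_mul (derive_id r) (derive_comp (f := m) (g := @ln R) (dm1 _) dln).
  apply: derive1_val.
  have d2 : is_derive r 1 (fun x => x * m (ln x)) 0.
    by apply: derive_eq d1 _; rewrite m0 d0 mul0r !mulr0 addr0.
  apply: (derive_near r0) d2 => y; rewrite ltr_norml => hy; rewrite ME//; lra.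
case: fM => [[E _]|[E v1 _]].
- have dm s := derive_sub (half1_derive hp s) (half1_derive (mirror hm) s).
  have ME x : 0 < x -> M x = x * (half1 hp (ln x) - half1 (mirror hm) (ln x)).
    by move=> x0; rewrite E M1E.
  have [m0 dm0] := zeroE _ _ dm ME.
  have [C ex] := expansion1 hpK gK.
  apply: (expansion_cycle hpK hmK gK dm _ m0 dm0 ex).
  exact: continuousB (@dhalf1_cont _ _) (@dhalf1_cont _ _).
- have h1E s : half1 hp s = half1 (mirror hm) s.
    have := v1 _ (expR_gt0 s); rewrite M1E ?expR_gt0// expRK => /eqP.
    by rewrite mulf_eq0 gt_eqF ?expR_gt0//= subr_eq0 => /eqP.
  have dm s := derive_sub (half2_derive hp s) (half2_derive (mirror hm) s).
  have ME x : 0 < x -> M x = x * (half2 hp (ln x) - half2 (mirror hm) (ln x)).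
    by move=> x0; rewrite E M2E// h1E; ring.
  have [m0 dm0] := zeroE _ _ dm ME.
  have [C ex] := expansion2 hpK gK h1E.
  apply: (expansion_cycle hpK hmK gK dm _ m0 dm0 ex).
  exact: continuousB (@dhalf2_cont _ _) (@dhalf2_cont _ _).
Qed.

End Bifurcation.

Section BifurcationSeq.
Local Open Scope classical_set_scope.
Local Open Scope complex_scope.
Variable R : realType.
Local Notation normc := (@ComplexField.Normc.normc R).
Implicit Types (h g hp hm : {poly R[i]}) (s : seq R) (r : R).

Lemma common_radius (T : eqType) (s : seq T) (P : T -> R -> Prop) :
  (forall x, x \in s -> exists2 d : R, 0 < d & forall e : R, 0 < `|e| < d -> P x e) ->
  exists2 d : R, 0 < d & forall e : R, 0 < `|e| < d -> forall x, x \in s -> P x e.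
Proof.
elim: s => [|x s IH] H; first by exists 1.
have [d1 d10 h1] := H x (mem_head _ _).
have [|d2 d20 h2] := IH; first by move=> y ys; apply: H; rewrite inE ys orbT.
exists (Num.min d1 d2); first by rewrite lt_min d10.
move=> e; rewrite lt_min => /andP[e0 /andP[l1 l2]] y; rewrite inE => /predU1P[->|ys].
  by apply: h1; rewrite e0.
by apply: h2 => //; rewrite e0.
Qed.

Let small_mul (a b : R) : 0 <= a -> 0 < b -> exists2 d : R, 0 < d &
  forall e : R, 0 < `|e| < d -> a * `|e| < b.
Proof.
move=> a0 b0; have a1 : 0 < a + 1 by lra.
exists (b / (a + 1)); first by rewrite divr_gt0.
move=> e /andP[e0]; rewrite ltr_pdivlMr// => h.
by apply: lt_trans h; rewrite mulrDr mulr1 mulrC ltrDl.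
Qed.

Lemma near_circle r (eta : R) : 0 < r -> 0 < eta -> exists2 k : R, 0 < k &
  forall z : R[i], 0 < normc z -> `|ln (normc z) - ln r| < k -> `|normc z - r| < eta.
Proof.
move=> r0 eta0; have /contP/(_ _ eta0)[k k0 H] : {for ln r, continuous (@expR R)}.
  exact: continuous_expR.
by exists k => // z z0 /H; rewrite !lnK.
Qed.

Lemma normc_real_cis (x t : R) : normc (x%:C * cis t) = `|x|.
Proof.
rewrite normcE /= !mul0r subr0 addr0 !exprMn -mulrDr cos2Dsin2 mulr1.
exact: sqrtr_sqr.
Qed.

Theorem averaging_bifurcation hp hm s : averaging_zeros hp hm s -> hyperbolic_bifurcation hp hm s.
Proof.
move=> [M [fM us simple]].
have /choice[D] : forall r, exists D : R, r \in s -> 0 <= D /\ exists2 e0, 0 < e0 &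
    forall e : R, 0 < `|e| < e0 -> exists G,
      cycle_near (perturbed hp e) (perturbed hm e) G (ln r) (D * `|e|).
  move=> r; case: (pselect (r \in s)) => [rs|]; last by exists 0.
  have [e0 e00 [D H]] := averaged_zero_cycle fM (simple r rs).
  exists `|D| => _; split => //; exists e0 => // e /H[G [h1 h2 h3]]; exists G; split => // z /h2[z0 hz].
  by split => //; apply: le_trans hz _; rewrite ler_wpM2r// ler_norm.
move=> HD.
(* The cycle has to be a function of the pair [(r, e)], so a set is chosen for every pair, empty
   when no suitable cycle exists. *)
have ex_cycle q : exists G,
   (exists G, cycle_near (perturbed hp q.2) (perturbed hm q.2) G (ln q.1) (D q.1 * `|q.2|)) ->
   cycle_near (perturbed hp q.2) (perturbed hm q.2) G (ln q.1) (D q.1 * `|q.2|).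
  case: (pselect (exists G, cycle_near (perturbed hp q.2)
    (perturbed hm q.2) G (ln q.1) (D q.1 * `|q.2|))) => [[G hG]|n]; first by exists G.
  by exists set0.
have [G0 GP] := choice ex_cycle.
pose G r e := G0 (r, e).
have {}GP r : r \in s -> exists2 e0, 0 < e0 & forall e : R, 0 < `|e| < e0 ->
    cycle_near (perturbed hp e) (perturbed hm e) (G r e) (ln r) (D r * `|e|).
  move=> /HD[_ [e0 e00 H]]; exists e0 => // e /H ex; exact: (GP (r, e) ex).
have [d1 d10 H1] := common_radius GP.
(* For small [e] the bands around two distinct values of [ln r] are disjoint; this separates the
   cycles. *)
have pairs (q : R * R) : q \in [seq (x, y) | x <- s, y <- s] -> exists2 d, 0 < d &
    forall e : R, 0 < `|e| < d -> q.1 != q.2 -> (D q.1 + D q.2) * `|e| < `|ln q.1 - ln q.2|.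
  move=> /allpairsP[[x y] /= [xs ys ->]] /=.
  have [->|ne] := eqVneq x y; first by exists 1 => // e _; rewrite eqxx.
  have [Dx _] := HD x xs; have [Dy _] := HD y ys.
  have [x0 _ _ _] := simple x xs; have [y0 _ _ _] := simple y ys.
  have [||d d0 hd] := @small_mul (D x + D y) `|ln x - ln y|; first exact: addr_ge0.
    by rewrite normr_gt0 subr_eq0; apply: contra_neq ne => /ln_inj; apply.
  by exists d => // e /hd.
have [d2 d20 H2] := common_radius pairs.
exists (Num.min d1 d2), G; split.
- by rewrite lt_min d10.
- move=> e r; rewrite lt_min => /andP[e0 /andP[l1 _]] rs.
  by have [] := H1 e (introT andP (conj e0 l1)) r rs.
- move=> e; rewrite lt_min => /andP[e0 /andP[l1 l2]] x y xs ys /= Exy.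
  apply/eqP; apply: contraT => ne.
  have [_ nx ang] := H1 e (introT andP (conj e0 l1)) x xs.
  have [_ ny _] := H1 e (introT andP (conj e0 l1)) y ys.
  have [z Gz _] := ang 0; have [_ hx] := nx z Gz; rewrite Exy in Gz; have [_ hy] := ny z Gz.
  have xyin : (x, y) \in [seq (x, y) | x <- s, y <- s] by apply/allpairsP; exists (x, y).
  have := H2 e (introT andP (conj e0 l2)) (x, y) xyin ne.
  rewrite /= ltNge -[ln x - ln y](subrKA (ln (normc z))) => /negP[].
  by apply: le_trans (ler_normD _ _) _; rewrite mulrDl lerD// distrC.
- move=> r rs eta eta0; have [r0 _ _ _] := simple r rs.
  have [k k0 near] := near_circle r0 eta0.
  have [Dr _] := HD r rs; have [d3 d30 H3] := small_mul Dr k0.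
  exists (Num.min d1 d3); first by rewrite lt_min d10.
  move=> e; rewrite lt_min => /andP[e0 /andP[l1 l3]].
  have [_ nr ang] := H1 e (introT andP (conj e0 l1)) r rs.
  have Gnear z : G r e z -> `|normc z - r| < eta.
    move=> /nr[z0 hz]; apply: near => //; apply: le_lt_trans hz _.
    by apply: H3; rewrite e0.
  split => // t; have [z Gz Ez] := ang t; exists z => //.
  by rewrite {1}Ez -mulrBl -rmorphB normc_real_cis; exact: Gnear.
Qed.

End BifurcationSeq.

(** * Perturbations attaining the bound *)

Section Alternation.
Variable R : realType.
Implicit Types (P Q : {poly R}) (k : nat).

(* The sign of [c] is the sign of [P] at [x 0]. *)
Definition alternates P k := exists (x : nat -> R) (c : R),
  [/\ 0 < x 0%N, forall i, (i < k)%N -> x i < x i.+1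
    & forall i, (i <= k)%N -> 0 < c * (-1) ^+ i * P.[x i]].

Let finite_small (k : nat) (a b : nat -> R) : (forall i, (i <= k)%N -> 0 < a i) ->
  exists2 d : R, 0 < d & forall i, (i <= k)%N -> d * `|b i| < a i.
Proof.
elim: k => [|k IH] H.
  have a0 := H _ (leqnn 0); exists (a 0%N / (`|b 0%N| + 1)); first by rewrite divr_gt0// ltr_wpDl.
  move=> i; rewrite leqn0 => /eqP ->; rewrite mulrAC ltr_pdivrMr ?ltr_wpDl//.
  by rewrite ltr_pM2l// ltrDl.
have [|d d0 hd] := IH; first by move=> i ik; apply: H; exact: leqW.
have ak := H _ (leqnn k.+1).
pose d' := a k.+1 / (`|b k.+1| + 1).
have d'0 : 0 < d' by rewrite divr_gt0// ltr_wpDl.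
exists (Num.min d d'); first by rewrite lt_min d0.
move=> i; rewrite leq_eqVlt => /predU1P[->|]; last first.
  by move=> /hd; apply: le_lt_trans; rewrite ler_wpM2r// ge_min lexx.
apply: (@le_lt_trans _ _ (d' * `|b k.+1|)); first by rewrite ler_wpM2r// ge_min lexx orbT.
by rewrite /d' mulrAC ltr_pdivrMr ?ltr_wpDl// ltr_pM2l// ltrDl.
Qed.

Lemma alternates_perturb P Q k : alternates P k ->
  exists2 d : R, 0 < d & forall g, `|g| < d -> alternates (P + g *: Q) k.
Proof.
move=> [x [c [x0 xs H]]].
have [d d0 hd] := finite_small (fun i => c * (-1) ^+ i * Q.[x i]) H.
exists d => // g gd; exists x, c; split=> // i ik.
rewrite hornerD hornerZ mulrDr.
have E : c * (-1) ^+ i * (g * Q.[x i]) = g * (c * (-1) ^+ i * Q.[x i]) by ring.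
have h := hd i ik.
have h2 : `|g * (c * (-1) ^+ i * Q.[x i])| <= d * `|c * (-1) ^+ i * Q.[x i]|.
  by rewrite normrM ler_wpM2r// ltW.
by rewrite E; move: h2; rewrite ler_norml => /andP[]; lra.
Qed.

(** A small multiple of [Q] does not disturb the signs already present, while its higher degree
    dictates the sign at a far point, where one more alternation is placed. *)
Lemma alternates_extend P Q k : alternates P k -> (size P < size Q)%N ->
  exists2 g : R, g != 0 & alternates (P + g *: Q) k.+1.
Proof.
move=> [x [c [x0 xs H]]] sPQ.
have [d d0 hd] := finite_small (fun i => c * (-1) ^+ i * Q.[x i]) H.
have Q0 : lead_coef Q != 0 by rewrite lead_coef_eq0 -size_poly_gt0; apply: leq_trans sPQ.
have c0 : c != 0 by have := H _ (leqnn k); apply: contraTneq => ->; rewrite !mul0r ltxx.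
pose sg := c * (-1) ^+ k.+1 * lead_coef Q.
have sg0 : sg != 0 by rewrite !mulf_neq0// signr_eq0.
(* The sign of [g] gives the leading coefficient the sign required at the point of index [k.+1]. *)
pose g := Num.sg sg * (d / 2).
have ng : `|g| = d / 2 by rewrite normrM normr_sg sg0 mul1r gtr0_norm// divr_gt0.
have g0 : g != 0 by rewrite -normr_eq0 ng gt_eqF// divr_gt0.
exists g => //.
pose F := c * (-1) ^+ k.+1 *: (P + g *: Q).
have lF : 0 < lead_coef F.
  rewrite lead_coefZ addrC lead_coefDl ?size_scale// lead_coefZ.
  have -> : c * (-1) ^+ k.+1 * (g * lead_coef Q) = sg * Num.sg sg * (d / 2).
    by rewrite /g; set w := Num.sg sg; rewrite /sg; set u := (-1) ^+ _; field.
  by rewrite mulr_gt0 ?divr_gt0// mulrC -normrEsg normr_gt0.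
have [X HX] := polyrcf.poly_pinfty_gt_lc lF.
pose y := Num.max X (x k + 1).
exists (fun i => if (i <= k)%N then x i else y), c; split.
- by [].
- move=> i; rewrite ltnS => ik; rewrite ik; case: ltnP => ik2; first exact: xs.
  have -> : i = k by apply/eqP; rewrite eqn_leq ik.
  by rewrite /y lt_max ltrDl ltr01 orbT.
- move=> i ik1; case: leqP => ik.
    have h := hd i ik; rewrite hornerD hornerZ mulrDr.
    have E : c * (-1) ^+ i * (g * Q.[x i]) = g * (c * (-1) ^+ i * Q.[x i]) by ring.
    have h2 : `|g * (c * (-1) ^+ i * Q.[x i])| <= d * `|c * (-1) ^+ i * Q.[x i]|.
      by rewrite normrM ng ler_wpM2r//; lra.
    by rewrite E; move: h2; rewrite ler_norml => /andP[]; lra.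
  have -> : i = k.+1 by apply/eqP; rewrite eqn_leq ik1.
  have yX : X <= y by rewrite /y le_max lexx.
  by have := lt_le_trans lF (HX _ yX); rewrite /F hornerZ.
Qed.

Lemma alternates_roots P k : alternates P k ->
  exists s, [/\ uniq s, size s = k & forall r, r \in s -> 0 < r /\ root P r].
Proof.
move=> [x [c [x0 xs H]]].
have xi0 i : (i <= k)%N -> 0 < x i.
  by elim: i => // i IH ik; apply: lt_trans (xs i ik); apply: IH; exact: ltnW.
suff : forall j, (j <= k)%N -> exists s, [/\ uniq s, size s = j &
    forall r, r \in s -> [/\ 0 < r, root P r & r < x j]].
  move=> /(_ k (leqnn k))[s [us sz hs]]; exists s; split=> // r /hs[r0 rP _]; by split.
elim=> [|j IH] jk; first by exists [::].
have [s [us sz hs]] := IH (ltnW jk).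
pose Q := c * (-1) ^+ j.+1 *: P.
have xj := xs j jk.
have [|r] := @polyrcf.poly_ivtoo _ Q (x j) (x j.+1) (ltW xj).
  have := H j (ltnW jk); have := H j.+1 jk; rewrite /Q !hornerZ => h1 h2.
  rewrite nmulr_rlt0//; move: h2; rewrite exprS; lra.
rewrite in_itv /= => /andP[r1 r2] rQ.
have cj : c * (-1) ^+ j.+1 != 0.
  by have := H j.+1 jk; apply: contraTneq => ->; rewrite mul0r ltxx.
have rP : root P r by move: rQ; rewrite /Q /root hornerZ mulf_eq0 (negbTE cj).
exists (r :: s); split=> /=; last 2 first.
- by rewrite sz.
- move=> t; rewrite inE => /predU1P[->|/hs[t0 tP tx]].
    by split=> //; apply: lt_trans r1; apply: xi0; exact: ltnW.
  by split=> //; exact: lt_trans tx xj.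
rewrite us andbT; apply/negP => /hs[_ _]; by rewrite ltNge (ltW r1).
Qed.

End Alternation.

(** * Perturbations with vanishing first averaged function *)

Section ComplexPoly.
Variable R : realType.
Implicit Types (A B b f q : {poly R}).

Definition cplx A b : {poly R[i]} :=
  map_poly (real_complex R) A + 'i%C *: map_poly (real_complex R) b.

Lemma reC_cplx A b j : reC (cplx A b) j = A`_j.
Proof. by rewrite /reC coefD coefZ !coef_map /= mul0r mulr0 subr0 addr0. Qed.

Lemma imC_cplx A b j : imC (cplx A b) j = b`_j.
Proof. by rewrite /imC coefD coefZ !coef_map /= mulr0 mul1r !add0r. Qed.

Lemma cplx_mul A b A' b' : cplx A b * cplx A' b' = cplx (A * A' - b * b') (A * b' + b * A').
Proof.
apply/polyP => j; rewrite [RHS]coefD coefZ !coef_map /= !(coefD, coefN) /=.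
rewrite /cplx mulrDl !mulrDr !coefD -!scalerAl -!scalerAr !coefZ -!rmorphM !coef_map /=.
set a := (A * A')`_j; set c := (b * b')`_j; set d := (A * b')`_j; set e := (b * A')`_j.
apply/eqP; rewrite eq_complex /=; apply/andP; split; apply/eqP; ring.
Qed.

Lemma size_cplx A b : (size b <= size A)%N -> size (cplx A b) = size A.
Proof.
move=> sb; have [A0|A0] := eqVneq A 0.
  move: sb; rewrite A0 size_poly0 leqn0 size_poly_eq0 => /eqP ->.
  by rewrite /cplx !rmorph0 scaler0 addr0 size_poly0.
apply/eqP; rewrite eqn_leq; apply/andP; split.
  apply/leq_sizeP => j hj; apply/eqP; rewrite eq_complex /=.
  have := reC_cplx A b j; have := imC_cplx A b j; rewrite /imC /reC => -> ->.
  by rewrite !nth_default ?eqxx// (leq_trans sb).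
rewrite leqNgt; apply/negP => h; have := reC_cplx A b (size A).-1.
rewrite /reC nth_default /=; first by move/esym/eqP; rewrite -lead_coefE lead_coef_eq0 (negbTE A0).
by rewrite -ltnS prednK ?size_poly_gt0.
Qed.

(** Even coefficients are dropped and an odd one of index [j] is multiplied by [- 2 / (j - 2)]: the
    effect on real coefficients of the half turn increment in [prim2p]. *)
Definition oddint f : {poly R} := \poly_(j < size f) (f`_j * half_coef R 2 j).

Lemma coef_oddint f j : (oddint f)`_j = f`_j * half_coef R 2 j.
Proof. by rewrite coef_poly; case: ltnP => // h; rewrite nth_default// mul0r. Qed.

Lemma oddintD f q : oddint (f + q) = oddint f + oddint q.
Proof. by apply/polyP => j; rewrite !(coefD, coef_oddint) mulrDl. Qed.

Lemma oddintZ c f : oddint (c *: f) = c *: oddint f.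
Proof. by apply/polyP => j; rewrite !(coefZ, coef_oddint) mulrA. Qed.

Lemma half_coef2_even j : ~~ odd j -> half_coef R 2 j = 0.
Proof. by move=> o; rewrite half_coef_odd// addn2 /= negbK. Qed.

Lemma oddint_even f : (forall j, odd j -> f`_j = 0) -> oddint f = 0.
Proof.
move=> H; apply/polyP => j; rewrite coef_oddint coef0; have [/H ->|/half_coef2_even ->] := boolP (odd j).
  by rewrite mul0r.
by rewrite mulr0.
Qed.

Definition oddp b := forall j, ~~ odd j -> b`_j = 0.

Lemma oddp_sqr b : oddp b -> forall j, odd j -> (b * b)`_j = 0.
Proof.
move=> H j oj; rewrite coefM; apply: big1 => i _.
have [oi|/H ->] := boolP (odd i); last by rewrite mul0r.
by rewrite (H (j - i)%N) ?mulr0// oddB ?oj ?oi// -ltnS.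
Qed.

Definition averaged2 A b : {poly R} := pi *: ('X * b - (2 * b`_1) *: 'X^2) + oddint (A * A).

(** Odd imaginary coefficients are invisible at first order, and normalising the real coefficient of
    ['X] leaves the same [pi *: 'X] on both sides, so that [M1p] vanishes while [b] remains free at
    second order. *)
Lemma half1p_cplx A b : A`_1 = 1 -> oddp b -> half1p (cplx A b) = pi *: 'X.
Proof.
move=> A1 ob; apply/polyP => j; rewrite coef_half1p imC_cplx reC_cplx coefZ coefX.
have [->|j1] := eqVneq j 1%N.
  by rewrite A1 half_coef_odd// mulr0 add0r !mulr1.
rewrite mulr0n addr0 mulr0; have [jo|/ob ->] := boolP (odd j); last by rewrite mul0r.
by rewrite half_coef_odd ?mulr0// addn1 /= negbK.
Qed.

Lemma kbp_cplx A b : oddp b -> kbp (cplx A b) = b.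
Proof.
move=> ob; apply/polyP => j; rewrite coef_kbp imC_cplx.
have [jo|/ob ->] := boolP (odd j); last by rewrite mulr0.
by rewrite -signr_odd /= jo /= mul1r.
Qed.

Lemma prim2p_cplx A b : A`_1 = 1 -> oddp b ->
  prim2p (cplx A b) = oddint (A * A) - (2 * pi * b`_1) *: 'X^2.
Proof.
move=> A1 ob; apply/polyP => j; rewrite coef_prim2p cplx_mul reC_cplx imC_cplx.
rewrite !(coefB, coefZ, coef_oddint) coefXn; congr (_ - _).
  have [jo|/half_coef2_even ->] := boolP (odd j); last by rewrite !mulr0.
  by rewrite (oddp_sqr ob)// subr0.
case: eqVneq => [->|_]; last by rewrite mulr0n mulr0.
rewrite mulr1n mulr1 coefD !coefM !big_ord_recl !big_ord0 /= /bump /=.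
rewrite (ob 0%N)// (ob 2%N)// A1; ring.
Qed.

Lemma M2p_cplx A b A' : A`_1 = 1 -> A'`_1 = 1 -> oddp b ->
  M2p (cplx A b) (cplx A' 0) = averaged2 A b - oddint (A' * A').
Proof.
move=> A1 A'1 ob; have o0 : oddp (0 : {poly R}) by move=> j _; rewrite coef0.
rewrite /M2p /half2p /averaged2 !half1p_cplx// !kbp_cplx// !prim2p_cplx// coef0.
rewrite -!mul_polyC; set p := pi%:P; set Q := _ * _; rewrite !polyCM mulr0; ring.
Qed.

Lemma M1p_cplx A b A' : A`_1 = 1 -> A'`_1 = 1 -> oddp b -> M1p (cplx A b) (cplx A' 0) = 0.
Proof.
move=> A1 A'1 ob; rewrite /M1p !half1p_cplx ?subrr// => j _; exact: coef0.
Qed.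

End ComplexPoly.

(** * Adding the monomials one at a time *)

Section Extremal.
Variable R : realType.
Implicit Types (e o c q f p : {poly R}).

Definition dil q : {poly R} := q \Po 'X^2.

Lemma coef_dil q k : (dil q)`_k = if odd k then 0 else q`_(k./2).
Proof. by rewrite coef_comp_poly_Xn// dvdn2 divn2; case: (odd k). Qed.

Lemma coef_Xdil q k : ('X * dil q)`_k = if odd k then q`_(k./2) else 0.
Proof.
rewrite coefXM coef_dil; case: k => //= k; rewrite uphalf_half.
by case: (odd k).
Qed.

Lemma coef_interleave e o k : (dil e + 'X * dil o)`_k = if odd k then o`_(k./2) else e`_(k./2).
Proof. by rewrite coefD coef_dil coef_Xdil; case: (odd k); rewrite ?add0r ?addr0. Qed.

Lemma dilM p q : dil (p * q) = dil p * dil q. Proof. exact: rmorphM. Qed.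
Lemma dilD p q : dil (p + q) = dil p + dil q. Proof. exact: rmorphD. Qed.
Lemma dilZ a q : dil (a *: q) = a *: dil q. Proof. exact: linearZ. Qed.
Lemma dil0 : dil 0 = 0. Proof. exact: rmorph0. Qed.

Lemma size_dil q : (size (dil q) <= (size q).-1.*2.+1)%N.
Proof.
by apply: leq_trans (size_comp_poly_leq _ _) _; rewrite size_polyXn muln2.
Qed.

(* For [A = e (X^2) + X o (X^2)] the odd part of [A^2], hence the odd part of the
   second averaged function, depends on the product [e o] only. *)
Definition averaged_eo q c : {poly R} :=
  pi *: ('X^2 * dil c - (2 * c`_0) *: 'X^2) + 2 *: oddint ('X * dil q).

Lemma averaged_eoE e o c :
  averaged2 (dil e + 'X * dil o) ('X * dil c) = averaged_eo (e * o) c.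
Proof.
rewrite /averaged2 /averaged_eo coef_Xdil /= mulrA -expr2; congr (_ + _).
have -> : (dil e + 'X * dil o) * (dil e + 'X * dil o) =
    dil (e * e + 'X * (o * o)) + 2 *: ('X * dil (e * o)).
  rewrite dilD !dilM /dil comp_polyX -mul_polyC (_ : 2%:P = 2); last by rewrite rmorph_nat.
  ring.
rewrite oddintD oddintZ [X in X + _]oddint_even ?add0r// => j oj.
by rewrite coef_dil oj.
Qed.

Lemma averaged_eo_linear q q' c c' g :
  averaged_eo (q + g *: q') (c + g *: c') = averaged_eo q c + g *: averaged_eo q' c'.
Proof.
rewrite /averaged_eo !(dilD, dilZ, mulrDr) oddintD -!scalerAr oddintZ coefD coefZ.
rewrite -!mul_polyC !(polyCM, polyCD); ring.
Qed.

Lemma size_averaged_eo q c : (size (averaged_eo q c) <= maxn (size q).*2 (size c).*2.+1)%N.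
Proof.
have hq : (size (2 *: oddint ('X * dil q)) <= (size q).*2)%N.
  have [->|q0] := eqVneq q 0.
    by rewrite dil0 mulr0 (_ : oddint 0 = 0) ?scaler0 ?size_poly0// oddint_even// => j _; rewrite coef0.
  apply: leq_trans (size_scale_leq _ _) _; apply: leq_trans (size_poly _ _) _.
  apply: leq_trans (size_polyMleq _ _) _; rewrite size_polyX.
  by have := size_dil q; have : (0 < size q)%N; [rewrite size_poly_gt0|lia].
have hc : (size (pi *: ('X^2 * dil c - (2 * c`_0) *: 'X^2) : {poly R}) <= (size c).*2.+1)%N.
  have [->|c0] := eqVneq c 0.
    by rewrite dil0 mulr0 coef0 mulr0 scale0r subr0 scaler0 size_poly0.
  have sc : (0 < size c)%N by rewrite size_poly_gt0.
  apply: leq_trans (size_scale_leq _ _) _; apply: leq_trans (size_polyD _ _) _.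
  rewrite geq_max size_polyN; apply/andP; split.
    apply: leq_trans (size_polyMleq _ _) _; rewrite size_polyXn.
    by have := size_dil c; lia.
  by apply: leq_trans (size_scale_leq _ _) _; rewrite size_polyXn; lia.
apply: leq_trans (size_polyD _ _) _; rewrite geq_max; apply/andP; split; lia.
Qed.

Lemma coef_neq0_size p k : p`_k != 0 -> (k < size p)%N.
Proof. by apply: contraNltn => h; rewrite nth_default. Qed.

Lemma half_coef_neq0' k : half_coef R 2 k.*2.+1 != 0.
Proof. by apply: half_coef_neq0; rewrite addn2 /= odd_double. Qed.

Lemma size_averaged_Xn i : (i.+1.*2 < size (averaged_eo 0 'X^i))%N.
Proof.
apply: coef_neq0_size; rewrite /averaged_eo dil0 mulr0 (_ : oddint 0 = 0); last first.
  by rewrite oddint_even// => j _; rewrite coef0.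
rewrite scaler0 addr0 coefZ coefB coefXnM /= coef_dil !coefZ !coefXn /= doubleS /= !subSS subn0.
rewrite odd_double doubleK eqxx mulf_neq0 ?(gt_eqF (pi_gt0 R))//.
(* For [i = 0] both terms in ['X^2] contribute, and the coefficient is [1 - 2 = - 1], still
   non-zero. *)
by case: i => [|i] /=; rewrite ?mulr0 ?mul0r ?subr0 ?oner_neq0// !mulr1; lra.
Qed.

Lemma size_averaged_mulX q : q != 0 -> ((size q).*2.+1 < size (averaged_eo (q * 'X) 0))%N.
Proof.
move=> q0; have sq : (0 < size q)%N by rewrite size_poly_gt0.
apply: coef_neq0_size; rewrite /averaged_eo dil0 mulr0 coef0 mulr0 scale0r subr0 scaler0 add0r.
rewrite coefZ coef_oddint coef_Xdil /= odd_double /= uphalf_double coefMX.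
rewrite -[in X in X == 0%N](prednK sq) /=.
apply: mulf_neq0; first by rewrite pnatr_eq0.
apply: mulf_neq0; last exact: half_coef_neq0'.
by rewrite -lead_coefE lead_coef_eq0.
Qed.

(** [j] is the degree of [e * o], split so that [dil e + 'X * dil o] has degree [j.+1]; [i] counts
    the coefficients available in [c]. The condition on the constant term of [o] is the
    normalisation of the coefficient of ['X]. *)
Definition extremal j i := exists e o c, [/\ size e = (uphalf j).+1, size o = (j./2).+1,
  o`_0 = 1, (size c <= i)%N & alternates (averaged_eo (e * o) c) (j + i)].

Lemma size_eo e o j : size e = (uphalf j).+1 -> size o = (j./2).+1 -> size (e * o) = j.+1.
Proof.
move=> se so; rewrite size_mul -?size_poly_eq0 ?se ?so//.
by have := uphalf_half j; have := odd_double_half j; lia.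
Qed.

Lemma extremal_start : extremal 0 0.
Proof.
exists 1, 1, 0; rewrite size_poly1 size_poly0 coef1; split=> //.
exists (fun=> 1), 1; split=> // i; rewrite leqn0 => /eqP -> /=.
have -> : averaged_eo (1 * 1) 0 = 4 *: 'X.
  rewrite /averaged_eo mulr1 dil0 mulr0 coef0 mulr0 scale0r subr0 scaler0 add0r.
  rewrite /dil comp_polyC mulr1; apply/polyP => k; rewrite !coefZ coef_oddint coefX.
  case: eqVneq => [->|_]; last by rewrite mul0r !mulr0.
  rewrite /half_coef /shift_exp -signr_odd /= expr1 (_ : 1%:R - 2%:R = -1 :> R); last by ring.
  by rewrite invrN1; ring.
by rewrite hornerZ hornerX !mulr1 mul1r; lra.
Qed.

Lemma extremal_even i : extremal i i -> extremal i i.+1.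
Proof.
move=> [e [ o [c [se so o0 sc al]]]].
have sP : (size (averaged_eo (e * o) c) < size (averaged_eo 0 'X^i))%N.
  apply: leq_ltn_trans (size_averaged_eo _ _) _; apply: leq_trans (size_averaged_Xn i).
  by rewrite (size_eo se so); lia.
have [g g0 al'] := alternates_extend al sP.
exists e, o, (c + g *: 'X^i); split=> //.
  apply: leq_trans (size_polyD _ _) _; rewrite geq_max leqW//=.
  by apply: leq_trans (size_scale_leq _ _) _; rewrite size_polyXn.
by rewrite -averaged_eo_linear scaler0 addr0 in al'; rewrite addnS.
Qed.

(** A new odd monomial must not destroy the product form. Adding [g *: (e * o * 'X)] multiplies
    [e * o] by [1 + g *: 'X], a factor that can be given to [o] or to [e] according to the parity of
    [j], and whose constant term preserves the normalisation. The bound on [i] makes the new odd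
    degree exceed the even ones already present. *)
Lemma extremal_odd j i : (i <= j.+1)%N -> extremal j i -> extremal j.+1 i.
Proof.
move=> ij [e [ o [c [se so o0 sc al]]]].
have seo := size_eo se so.
have q0 : e * o != 0 by rewrite -size_poly_eq0 seo.
have sP : (size (averaged_eo (e * o) c) < size (averaged_eo (e * o * 'X) 0))%N.
  apply: leq_ltn_trans (size_averaged_eo _ _) _; apply: leq_trans (size_averaged_mulX q0).
  by rewrite seo; lia.
have [g g0 al'] := alternates_extend al sP.
rewrite -averaged_eo_linear scaler0 addr0 in al'.
pose l : {poly R} := 1 + g *: 'X.
have sl : size l = 2%N.
  by rewrite /l addrC size_polyDl size_scale// size_polyX// size_poly1.
have szl p : p != 0 -> size (p * l) = (size p).+1.
  by move=> p0; rewrite size_mul// -?size_poly_eq0 sl// addn2.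
have E : e * o + g *: (e * o * 'X) = e * o * l.
  by rewrite /l mulrDr mulr1 -scalerAr.
have eo0 : e != 0 /\ o != 0 by rewrite -!size_poly_eq0 se so.
rewrite E in al'; case: (boolP (odd j)) => oj.
- exists e, (o * l), c; rewrite szl ?eo0.2// so se mulrA addSn; split=> //.
  + by move: oj => /=; lia.
  + by move: oj => /=; lia.
  + by rewrite coef0M o0 /l coefD coef1 coefZ coefX /= mulr0 addr0 mulr1.
- exists (e * l), o, c; rewrite szl ?eo0.1// so se mulrAC addSn; split=> //.
  + by move: oj => /=; lia.
  + by move: oj => /=; lia.
Qed.

(** Even and odd degrees alternate along the diagonal until the even monomials are exhausted; after
    that only odd ones are added. Degrees always increase, as [alternates_extend] requires. *)
Lemma extremal_exists n : (0 < n)%N -> extremal n.-1 (n.+1)./2.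
Proof.
move=> n0; have diag i : extremal i i.
  elim: i => [|i IH]; first exact: extremal_start.
  by apply: extremal_odd => //; exact: extremal_even.
have up d i : extremal (i + d) i.+1.
  elim: d => [|d IH]; first by rewrite addn0; apply: extremal_even.
  by rewrite addnS; apply: extremal_odd => //; lia.
have := up (n.-1 - (n.+1)./2.-1)%N (n.+1)./2.-1.
by rewrite subnKC ?prednK//; lia.
Qed.

Lemma extremal_poly n : (0 < n)%N -> exists A b : {poly R},
  [/\ size A = n.+1, A`_1 = 1, (size b <= n.+1)%N, oddp b
    & alternates (averaged2 A b) ((3 * n - 1) %/ 2)].
Proof.
move=> n0; have [e [ o [c [se so o0 sc al]]]] := extremal_exists n0.
have e0 : e`_(n./2) != 0.
  have : lead_coef e != 0 by rewrite lead_coef_eq0 -size_poly_eq0 se.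
  by rewrite lead_coefE se /= (_ : uphalf n.-1 = n./2)//; lia.
have oo : o`_(n.-1./2) != 0.
  have : lead_coef o != 0 by rewrite lead_coef_eq0 -size_poly_eq0 so.
  by rewrite lead_coefE so.
exists (dil e + 'X * dil o), ('X * dil c); split.
- apply/eqP; rewrite eqn_leq; apply/andP; split.
    apply/leq_sizeP => k nk; rewrite coef_interleave.
    by case: ifP => ok; rewrite nth_default ?se ?so//; lia.
  apply: coef_neq0_size; rewrite coef_interleave; case: ifP => // on.
  by rewrite (_ : n./2 = n.-1./2)//; lia.
- by rewrite coef_interleave.
- apply/leq_sizeP => k nk; rewrite coef_Xdil; case: ifP => // ok.
  by rewrite nth_default//; apply: leq_trans sc _; lia.
- by move=> k ok; rewrite coef_Xdil (negbTE ok).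
- rewrite averaged_eoE (_ : ((3 * n - 1) %/ 2)%N = (n.-1 + (n.+1)./2)%N)//; lia.
Qed.

End Extremal.

(** * Exact degrees, simplicity of the zeros, and the limit cycles obtained *)

Section Attained.
Variable R : realType.
Implicit Types (h g : {poly R[i]}) (s : seq R).

Lemma mirrorK h : mirror (mirror h) = h.
Proof.
apply/polyP => j; rewrite /mirror rmorphN opprK !coef_map /=.
by apply/eqP; rewrite eq_complex; case: (h`_j) => a b /=; rewrite !opprK !eqxx.
Qed.

Lemma horner_derive (p : {poly R}) (x : R) : is_derive x 1 (horner p) p^`().[x].
Proof. exact: is_derive_poly. Qed.

(** Simplicity comes for free: the roots are only one fewer than the admissible exponents. *)
Lemma averaging_zeros_M2p n h g s : (0 < n)%N -> (size h <= n.+1)%N -> (size g <= n.+1)%N ->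
  M1p h g = 0 -> M2p h g != 0 -> uniq s -> size s = ((3 * n - 1) %/ 2)%N ->
  (forall r, r \in s -> 0 < r /\ root (M2p h g) r) -> averaging_zeros h (mirror g) s.
Proof.
move=> n0 sh sg M10 M20 us ss hs.
have ME r : 0 < r -> M2 h (mirror g) r = (M2p h g).[r] / r by move=> r0; rewrite M2pE// mirrorK.
exists (M2 h (mirror g)); split=> //.
  right; split=> //.
    by move=> r r0; rewrite M1pE// mirrorK M10 horner0.
  move=> v; move/eqP: M20; apply; apply: vanishing_poly => r r0.
  by have /eqP := v r r0; rewrite ME// mulf_eq0 invr_eq0 (gt_eqF r0) orbF => /eqP.
move=> r rs; have [r0 rM] := hs r rs.
have dM : is_derive r 1 (M2 h (mirror g)) ((M2p h g)^`().[r] / r).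
  have d1 := derive_div (horner_derive (M2p h g) r) (derive_id r) (lt0r_neq0 r0).
  have d2 : is_derive r 1 (fun y => (M2p h g).[y] / y) ((M2p h g)^`().[r] / r).
    apply: derive_eq d1 _; move: rM; rewrite /root => /eqP ->.
    by field; rewrite gt_eqF.
  apply: (derive_near r0) d2 => y; rewrite ltr_norml => hy; rewrite ME//; lra.
split=> //.
- by rewrite ME//; move: rM; rewrite /root => /eqP ->; rewrite mul0r.
- have sz : size (averaged_exponents n) = (size s).+1 by rewrite size_averaged_exponents// ss.
  rewrite (derive1_val dM) mulf_neq0//; last by rewrite invr_eq0 gt_eqF.
  exact: (few_roots_simple M20 (M2p_support n0 sh sg M10) us hs sz).
Qed.

(** The partner ['X] would suffice for the zeros but has degree one. A small multiple of ['X^m]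
    corrects the degree, and finitely many strict signs survive it. *)
Lemma extremal_pair n m : (0 < m)%N -> (m <= n)%N -> exists h g s,
  [/\ size h = n.+1, size g = m.+1, M1p h g = 0, M2p h g != 0
    & [/\ uniq s, size s = ((3 * n - 1) %/ 2)%N & forall r, r \in s -> 0 < r /\ root (M2p h g) r]].
Proof.
move=> m0 mn; have [A [b [sA A1 sb ob al]]] := extremal_poly R (leq_trans m0 mn).
pose Q : {poly R} := if m == 1%N then 0 else 'X^m.
have [d d0 hd] := alternates_perturb (- (2 *: oddint ('X * Q))) al.
pose c := d / 2; have nc : `|c| < d by rewrite /c gtr0_norm; lra.
pose S := 'X + c *: Q.
have sS : size S = m.+1.
  rewrite /S /Q; case: eqVneq => [->|m1]; first by rewrite scaler0 addr0 size_polyX.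
  have c0 : c != 0 by rewrite /c gt_eqF//; lra.
  rewrite addrC size_polyDl size_scale// ?size_polyXn// size_polyX.
  by move: m0 m1; case: (m) => [|[|]].
have S1 : S`_1 = 1.
  rewrite coefD coefX coefZ /Q /=; case: eqVneq => [_|m1]; first by rewrite coef0 mulr0 addr0.
  by rewrite coefXn eq_sym (negbTE m1) mulr0 addr0.
(* In [S * S] the squares of ['X] and of [Q] have even exponents, so only the cross term reaches the
   averaged function. *)
have SS : oddint (S * S) = 2 *: (c *: oddint ('X * Q)).
  have -> : S * S = ('X^2 + (c * c) *: (Q * Q)) + (2 * c) *: ('X * Q).
    rewrite /S -!mul_polyC; set X := 'X; set q := Q; rewrite expr2 !polyCM (_ : 2%:P = 2); last by rewrite rmorph_nat.
    by ring.
  rewrite oddintD [X in X + _]oddint_even ?add0r ?oddintZ ?scalerA// => j oj.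
  rewrite coefD coefXn coefZ /Q.
  have -> : (j == 2)%N = false by case: eqP oj => // ->.
  case: ifP => _; first by rewrite mul0r coef0 mulr0 addr0.
  rewrite -exprD coefXn; have -> : (j == m + m)%N = false by case: eqP oj => // ->; rewrite addnn odd_double.
  by rewrite mulr0 addr0.
have ME : M2p (cplx A b) (cplx S 0) = averaged2 A b + c *: - (2 *: oddint ('X * Q)).
  by rewrite M2p_cplx// SS scalerN !scalerA mulrC.
have {}al := hd c nc; rewrite -ME in al.
have [s [us ss hs]] := alternates_roots al.
exists (cplx A b), (cplx S 0), s; split=> //.
- by rewrite size_cplx ?sA.
- by rewrite size_cplx ?size_poly0// sS.
- exact: M1p_cplx.
- apply/eqP => M0; have [x [k [_ _ H]]] := al; have := H 0%N (leq0n _).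
  by rewrite M0 horner0 mulr0 ltxx.
Qed.

Lemma M1p_sym h g : M1p g h = - M1p h g. Proof. by rewrite /M1p opprB. Qed.
Lemma M2p_sym h g : M2p g h = - M2p h g. Proof. by rewrite /M2p opprB. Qed.

Theorem extremal_perturbation np nm : (0 < np)%N -> (0 < nm)%N -> exists (hp hm : {poly R[i]}) (s : seq R),
  [/\ size hp = np.+1, size hm = nm.+1, averaging_zeros hp hm s
    & size s = ((3 * maxn np nm - 1) %/ 2)%N].
Proof.
move=> p0 m0; case: (leqP nm np) => [mp|/ltnW pm].
  have [h [g [s [sh sg M10 M20 [us ss hs]]]]] := extremal_pair m0 mp.
  exists h, (mirror g), s; rewrite size_mirror; split=> //.
  by apply: (averaging_zeros_M2p p0); rewrite ?sh ?sg.
have [h [g [s [sh sg M10 M20 [us ss hs]]]]] := extremal_pair p0 pm.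
exists g, (mirror h), s; rewrite size_mirror; split=> //.
apply: (averaging_zeros_M2p m0); rewrite ?sh ?sg//.
- by rewrite M1p_sym M10 oppr0.
- by rewrite M2p_sym oppr_eq0.
- by move=> r /hs[r0 hr]; split=> //; rewrite M2p_sym /root hornerN oppr_eq0.
Qed.

(** The leading coefficient can cancel only for [n = 1], where it is [i + e * h_1]; the last
    hypothesis excludes [e * h_1 = - i]. *)
Lemma size_perturbed n h (e : R) : (0 < n)%N -> size h = n.+1 -> e != 0 ->
  `|e| * ComplexField.Normc.normc h`_1 < 1 -> size (perturbed h e) = n.+1.
Proof.
move=> n0 sh e0 he.
have cE j : (perturbed h e)`_j = 'i%C * (j == 1)%:R + e%:C%C * h`_j.
  by rewrite /perturbed coefD !coefZ coefX.
apply/eqP; rewrite eqn_leq; apply/andP; split.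
  apply/leq_sizeP => j nj; rewrite cE nth_default ?sh// mulr0 addr0.
  by case: eqP nj => [->|_ _]; [lia|rewrite mulr0].
apply: contraT; rewrite -ltnNge ltnS => /leq_sizeP/(_ n (leqnn _)); rewrite cE.
have hn : h`_n != 0.
  have : lead_coef h != 0 by rewrite lead_coef_eq0 -size_poly_eq0 sh.
  by rewrite lead_coefE sh.
case: eqVneq => [n1|_]; last first.
  rewrite mulr0 add0r => /eqP; rewrite mulf_eq0 (negbTE hn) orbF => /eqP[] /eqP.
  by rewrite (negbTE e0).
rewrite mulr1 n1 => /eqP; rewrite addrC addr_eq0 => /eqP E.
have := congr1 (@ComplexField.Normc.normc R) E.
rewrite ComplexField.Normc.normcM /= !expr0n /= !addr0 oppr0 sqrrN expr1n !expr0n /= add0r sqrtr1 sqrtr_sqr.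
by move=> E1; move: he; rewrite E1 ltxx.
Qed.

End Attained.

Theorem theoremA (R : realType) (np nm : nat) (hnp : (1 <= np)%N) (hnm : (1 <= nm)%N) :
  let N := ((3 * maxn np nm - 1) %/ 2)%N in
  [/\ (forall (hp hm : {poly R[i]}) (s : seq R),
         size hp = np.+1 -> size hm = nm.+1 -> averaging_zeros hp hm s ->
         (size s <= N)%N /\ hyperbolic_bifurcation hp hm s),
      (exists (hp hm : {poly R[i]}) (s : seq R),
         [/\ size hp = np.+1, size hm = nm.+1, averaging_zeros hp hm s,
             size s = N & hyperbolic_bifurcation hp hm s])
    & (N%:R%:E <= max_limit_cycles R np nm)%E].
Proof.
move=> N; have [hp [hm [s [shp shm az ss]]]] := extremal_perturbation R hnp hnm.
have hb := averaging_bifurcation az.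
split.
- move=> hp' hm' s' shp' shm' az'; split; last exact: averaging_bifurcation.
  exact: averaging_zeros_bound az'.
- by exists hp, hm, s.
have [e0 [G [e00 hyp inj _]]] := hb.
pose nc (h : {poly R[i]}) := ComplexField.Normc.normc h`_1.
have nc0 h : 0 <= nc h by exact: (normc_ge0 h`_1).
(* One value of [e] below [e0] and [1 / k] keeps the degrees of both perturbed fields equal to [np]
   and [nm]. *)
pose k := nc hp + nc hm + 1; have k0 : 0 < k by have := nc0 hp; have := nc0 hm; rewrite /k; lra.
pose e := Num.min e0 k^-1 / 2.
have m0 : 0 < Num.min e0 k^-1 by rewrite lt_min e00 invr_gt0.
have e1 : 0 < e by rewrite divr_gt0.
have ee0 : e < e0 by have : Num.min e0 k^-1 <= e0; [rewrite ge_min lexx|rewrite /e; lra].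
have ek : e * k < 1.
  rewrite -ltr_pdivlMr// div1r; have : Num.min e0 k^-1 <= k^-1 by rewrite ge_min lexx orbT.
  by rewrite /e; lra.
have ne : `|e| = e by rewrite gtr0_norm.
have he : 0 < `|e| < e0 by rewrite ne e1.
have small h : nc h <= k -> `|e| * nc h < 1.
  by move=> h1; rewrite ne; apply: le_lt_trans ek; rewrite ler_pM2l.
apply: ereal_sup_ubound; exists N => //.
exists (perturbed hp e), (perturbed hm e), (fun i : 'I_N => G (nth 0 s i) e); split.
- apply: size_perturbed => //; first by rewrite gt_eqF.
  by apply: small; rewrite /k; have := nc0 hm; lra.
- apply: size_perturbed => //; first by rewrite gt_eqF.
  by apply: small; rewrite /k; have := nc0 hp; lra.
- move=> i j /= Gij; have us : uniq s by case: az => M [].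
  apply/val_inj/eqP => /=; rewrite -(nth_uniq 0 _ _ us) ?ss//; apply/eqP.
  by apply: (inj e he) => //=; rewrite mem_nth// ss.
- move=> i; have ri : nth 0 s i \in s by rewrite mem_nth// ss.
  by case: (hyp e _ he ri).
Qed.
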